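(* Let $(\mathcal{H}^{(1)},\ldots,\mathcal{H}^{(n)})$ be a dynamic $s$-uniform hypergraph on the bin set $[n]$ which is $\beta$-balanced for some constant $\beta\ge 1$, $\varepsilon$-visible for some constant $\varepsilon\in(0,1)$, and satisfies the $c_0$-size property for some constant $c_0\ge 1$. Fix $d=d(n)$ with $2\le d=o(\log n)$ and $d\le s$. Then there exists $m$ with $\Theta(n)\le m\le n$ such that, after the balanced allocation process on $(\mathcal{H}^{(1)},\ldots,\mathcal{H}^{(n)})$ has allocated $m$ balls, the maximum load is $\log_d\log n+\mathcal{O}(1/\varepsilon)$ with high probability. Moreover, for every fixed positive integer $\gamma$ with $\gamma m\le n$, after allocating $\gamma m$ balls the maximum load is at most $\gamma(\log_d\log n+\mathcal{O}(1/\varepsilon))$ with high probability.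
   Context: Bins are $[n]=\{1,\ldots,n\}$; all statements are asymptotic as $n\to\infty$, with $s=s(n)$ an integer, $2\le s\le n$. A dynamic $s$-uniform hypergraph is a sequence $(\mathcal{H}^{(1)},\ldots,\mathcal{H}^{(n)})$ of hypergraphs $\mathcal{H}^{(t)}=([n],\mathcal{E}_t)$ in which every edge has exactly $s$ vertices; the edge sets may change with $t$. Let $H_t$ denote an edge chosen uniformly at random from $\mathcal{E}_t$. $\beta$-balanced: $\Pr[i\in H_t]\le \beta s/n$ for every $1\le t\le n$ and every $i\in[n]$. Visibility of a pair of distinct bins: $\mathrm{viz}(i,j)=|\{t\in\{1,\ldots,n\}: \{i,j\}\subseteq H \text{ for some } H\in\mathcal{E}_t\}|$; $\varepsilon$-visible means $\mathrm{viz}(i,j)\le s\,n^{1-\varepsilon}$ for all distinct $i,j$. $c_0$-size property: $s=\Omega(\log n)$ and $|\mathcal{E}_t|\le n^{c_0}$ for every $t$. Balanced allocation process: in round $t=1,2,\ldots$, ball $t$ chooses an edge $H_t$ uniformly at random from $\mathcal{E}_t$, then chooses a set $D_t$ of $d$ distinct bins uniformly at random from $H_t$, and is placed into a bin of $D_t$ with the fewest balls, ties broken uniformly at random. The load of a bin is its number of balls; the maximum load is the largest load. ''With high probability'' means with probability at least $1-n^{-c}$ for every constant $c>0$. *)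

(* Defs.v *)
From HB Require Import structures.
From mathcomp Require Import all_boot all_order all_algebra.
From mathcomp Require Import all_classical all_reals all_analysis.

Set Implicit Arguments.
Unset Strict Implicit.
Unset Printing Implicit Defensive.

Import Order.TTheory GRing.Theory Num.Theory.
Import numFieldNormedType.Exports.

Local Open Scope ring_scope.

(* Bins and rounds are both numbered by 'I_n: the ordinal t : 'I_n stands for
   round t.+1, so rounds range over 1, ..., n. [H t] is the edge set of the
   t-th hypergraph on the bin set 'I_n. *)
Definition dynamic_hypergraph (n : nat) := 'I_n -> {set {set 'I_n}}.

(* Probability mass function of the uniform distribution on a finite set. *)
Definition uniform_pmf (R : realType) (T : finType) (A : {set T}) (x : T) : R :=
  if x \in A then #|A|%:R^-1 else 0.

(* Edge sets are required to be nonempty, since an edge has to be drawn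
   uniformly from each of them. *)
Definition uniform_hypergraph (n s : nat) (H : dynamic_hypergraph n) : Prop :=
  forall t, H t != finset.set0 /\ forall e, e \in H t -> #|e| = s.

Definition bin_in_edge_prob (R : realType) (n : nat) (H : dynamic_hypergraph n)
    (t i : 'I_n) : R :=
  \sum_(e : {set 'I_n} | i \in e) uniform_pmf R (H t) e.

Definition balanced (R : realType) (n s : nat) (beta : R)
    (H : dynamic_hypergraph n) : Prop :=
  forall t i, bin_in_edge_prob R H t i <= beta * s%:R / n%:R.

Definition viz (n : nat) (H : dynamic_hypergraph n) (i j : 'I_n) : nat :=
  #|[set t | [exists e in H t, [set i; j]%SET \subset e]]%SET|.

Definition visible (R : realType) (n s : nat) (eps : R)
    (H : dynamic_hypergraph n) : Prop :=
  forall i j, i != j -> (viz H i j)%:R <= s%:R * n%:R `^ (1 - eps).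

(* [kappa] is the constant implied by the Omega in s = Omega(log n). *)
Definition size_property (R : realType) (n s : nat) (kappa c0 : R)
    (H : dynamic_hypergraph n) : Prop :=
  kappa * ln n%:R <= s%:R /\ forall t, #|H t|%:R <= n%:R `^ c0.

(* A run of the process over all n rounds: in round t, the triple consists of
   the chosen edge, the chosen set of d bins, and the bin receiving the ball. *)
Definition trajectory (n : nat) :=
  {ffun 'I_n -> {set 'I_n} * {set 'I_n} * 'I_n}.

Definition chosen_edge n (w : trajectory n) (t : 'I_n) := (w t).1.1.
Definition chosen_bins n (w : trajectory n) (t : 'I_n) := (w t).1.2.
Definition receiving_bin n (w : trajectory n) (t : 'I_n) := (w t).2.

(* Load of bin i once the first k balls have been allocated. *)
Definition load n (w : trajectory n) (k : nat) (i : 'I_n) : nat :=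
  #|[set t : 'I_n | (t < k)%N && (receiving_bin w t == i)]%SET|.

Definition max_load n (w : trajectory n) (k : nat) : nat :=
  (\max_(i < n) load w k i)%N.

Definition least_loaded n (x : 'I_n -> nat) (D : {set 'I_n}) : {set 'I_n} :=
  [set b in D | [forall b' in D, (x b <= x b')%N]]%SET.

(* Law of the process: each factor is the conditional probability of the
   round-t triple given the previous rounds, the last one being the uniform
   breaking of ties among the least loaded bins of the chosen set. *)
Definition trajectory_pmf (R : realType) (n d : nat) (H : dynamic_hypergraph n)
    (w : trajectory n) : R :=
  \prod_(t < n)
    (uniform_pmf R (H t) (chosen_edge w t)
     * uniform_pmf R [set D : {set 'I_n} | (D \subset chosen_edge w t)
                                           && (#|D| == d)]%SET (chosen_bins w t)
     * uniform_pmf R (least_loaded (load w t) (chosen_bins w t))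
                   (receiving_bin w t)).

Definition process_prob (R : realType) (n d : nat) (H : dynamic_hypergraph n)
    (A : pred (trajectory n)) : R :=
  \sum_(w | A w) trajectory_pmf R d H w.

Definition loglog (R : realType) (d n : nat) : R := ln (ln n%:R) / ln d%:R.

(* Main.v *)
Require Import Defs.
From HB Require Import structures.
From mathcomp Require Import all_boot all_order all_algebra.
From mathcomp Require Import reals.
From mathcomp Require Import zify ring lra.
From Stdlib Require Import FunctionalExtensionality.

(* The loads form a Markov chain, and both bounds are read off the demand
probabilities F_t(f) = P(every bin i has received at least f i balls above a
base level M after t rounds).

Upper bound. If the ball of round t completes the demand of bin j, every bin of
the chosen set D already met the demand f j - 1, so F satisfies a recursion in
which bin j spawns d demands of level f j - 1; the exceptional rounds in which
D meets two demanded bins cost a factor rho = O(d^2 n^-eps) by visibility. Any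
product of one-bin weights that dominates the recursion term by term dominates
F. The weights decay doubly exponentially, 2^-(d^(k-1)), until they reach
n^-O(eps) after log_d log n levels; beyond that a conflict has to be paid for
at each level and the weight gains a factor n^-Omega(eps) per level, whence the
O(1/eps) additional levels. Demands of level one need a separate argument: a
bin below the base level is never asked for, and the d bins of D split into
those that are still at the base level, whose tie breaking gains 2/d, and at
least d/2 that already carry a ball. Batches of m balls give the statement for
gamma m.

Lower bound. Dually, F is bounded below by the number of ways to expose a tree
of rounds whose chosen bins have all reached the previous level, which keeps
the expected number of bins of load k at least n^(3/4) as long as d^k is a
small multiple of ln n. One extra ball changes the number of these bins by at
most one along the coupled process, so it is concentrated by an
exponential-moment bound. *)

Set Implicit Arguments.
Unset Strict Implicit.
Unset Printing Implicit Defensive.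

Import Order.TTheory GRing.Theory Num.Theory.

Local Open Scope ring_scope.

(** Loads of different bins are dependent and one completed demand spawns many, so demands are sets
    of joint requirements; product weights fit because [d] equal demands then weigh [phi ^+ d]. With
    [b = beta / n], a bin lies in the chosen set with probability at most [b * d] per round. Over
    [m] rounds this sums to order [d], so a plain union bound fails at level one and a factor
    [1 / d] must be won back; the slope then is [5 * b], and [m = n / q] with [q >= 4096 * beta]
    keeps its total below a small constant. Above level one the potential [\sum d ^ f i] does not
    grow under spawning, but the number of bins of level one can; hence a cutoff on that number and
    a second weight for the demands beyond it. A conflict lowers a demand without spawning, at the
    cost of a ratio of consecutive weights. Under doubly exponential decay this ratio is unbounded,
    so the decay is stopped at [xi], after which each level costs a factor [1 / xi], affordable
    against [rho]. *)

Definition add_ball n (x : 'I_n -> nat) (j : 'I_n) : 'I_n -> nat :=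
  fun i => (x i + (i == j))%N.

(** The loads depend on an edge only through the set drawn from it, so the edge is averaged out
    beforehand. *)
Definition choice_law (R : realFieldType) n d (q : {set 'I_n} -> R) :=
  [/\ forall D, 0 <= q D, \sum_D q D = 1 & forall D, q D != 0 -> #|D| = d].

Definition step (R : realFieldType) n (q : {set 'I_n} -> R)
    (g : ('I_n -> nat) -> R) (x : 'I_n -> nat) : R :=
  \sum_D q D * ((\sum_(b in least_loaded x D) g (add_ball x b))
                / #|least_loaded x D|%:R).

(* Expectation of [g] at the loads after [k] balls, from the loads [x]: the last
   ball is averaged out first. *)
Fixpoint run (R : realFieldType) n (p : nat -> {set 'I_n} -> R) k
    (g : ('I_n -> nat) -> R) (x : 'I_n -> nat) : R :=
  if k is k'.+1 then run p k' (step (p k') g) x else g x.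

(** The comparison is required only one ball away from [x]: the exponential moment uses a bound that
    is valid for small increments only. *)
Lemma step_le_at (R : realFieldType) n (q : {set 'I_n} -> R) g1 g2 x :
  (forall D, 0 <= q D) -> (forall b, g1 (add_ball x b) <= g2 (add_ball x b)) ->
  step q g1 x <= step q g2 x.
Proof.
move=> q0 g12; apply: ler_sum => D _; apply: ler_wpM2l => //.
by apply: ler_wpM2r; rewrite ?invr_ge0 ?ler0n //; apply: ler_sum.
Qed.

(** * The load chain, demands, and one round seen from above and from below *)

Section Chain.
Variables (R : realFieldType) (n d : nat).
Implicit Types (q : {set 'I_n} -> R) (g : ('I_n -> nat) -> R).
Implicit Types (p : nat -> {set 'I_n} -> R) (x f : 'I_n -> nat).

Lemma least_loaded_neq0 x (D : {set 'I_n}) :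
  D != set0 -> least_loaded x D != set0.
Proof.
case/set0Pn=> i iD; apply/set0Pn.
case: (arg_minnP x iD) => j jD jmin.
exists j; rewrite inE; apply/andP; split=> //.
by apply/forall_inP => b bD; exact: jmin.
Qed.

Lemma least_loaded_sub x (D : {set 'I_n}) : least_loaded x D \subset D.
Proof. by apply/subsetP => i; rewrite inE => /andP[]. Qed.

Lemma step_le q g1 g2 x : (forall D, 0 <= q D) ->
  (forall y, g1 y <= g2 y) -> step q g1 x <= step q g2 x.
Proof. by move=> q0 g12; apply: step_le_at. Qed.

Lemma stepD q g1 g2 x :
  step q (fun y => g1 y + g2 y) x = step q g1 x + step q g2 x.
Proof.
by rewrite /step -big_split; apply: eq_bigr => D _ /=; rewrite big_split /= mulrDl mulrDr.
Qed.

Lemma stepZ q c g x : step q (fun y => c * g y) x = c * step q g x.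
Proof.
rewrite /step mulr_sumr; apply: eq_bigr => D _.
by rewrite -mulr_sumr -mulrA mulrCA.
Qed.

Lemma step_const q c x : (0 < d)%N -> choice_law d q -> step q (fun=> c) x = c.
Proof.
move=> d0 [q0 q1 qd]; transitivity (\sum_D q D * c); last by rewrite -mulr_suml q1 mul1r.
apply: eq_bigr => D _; have [->|qD] := eqVneq (q D) 0; first by rewrite !mul0r.
congr (_ * _); rewrite sumr_const -[c *+ _]mulr_natr mulfK //.
rewrite pnatr_eq0 cards_eq0 least_loaded_neq0 // -cards_eq0 qd //.
by rewrite -lt0n.
Qed.

Lemma run_le p k g1 g2 x : (forall t D, 0 <= p t D) ->
  (forall y, g1 y <= g2 y) -> run p k g1 x <= run p k g2 x.
Proof.
move=> p0; elim: k g1 g2 => [|k IH] g1 g2 g12 //=.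
by apply: IH => y; apply: step_le.
Qed.

Lemma eq_run p k g1 g2 x : (forall t D, 0 <= p t D) ->
  (forall y, g1 y = g2 y) -> run p k g1 x = run p k g2 x.
Proof.
by move=> p0 g12; apply/le_anti/andP; split; apply: run_le => // y; rewrite g12.
Qed.

Lemma runD p k g1 g2 x : (forall t D, 0 <= p t D) ->
  run p k (fun y => g1 y + g2 y) x = run p k g1 x + run p k g2 x.
Proof.
move=> p0; elim: k g1 g2 => [|k IH] g1 g2 //=.
by rewrite -IH; apply: eq_run => // y; rewrite stepD.
Qed.

Lemma runZ p k c g x : (forall t D, 0 <= p t D) ->
  run p k (fun y => c * g y) x = c * run p k g x.
Proof.
move=> p0; elim: k g => [|k IH] g //=.
by rewrite -IH; apply: eq_run => // y; rewrite stepZ.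
Qed.

Lemma run_const p k c x : (0 < d)%N -> (forall t, choice_law d (p t)) ->
  run p k (fun=> c) x = c.
Proof.
move=> d0 pd; elim: k => [|k IH] //=; rewrite -[RHS]IH.
by apply: eq_run => [t D|y]; [case: (pd t)|apply: step_const].
Qed.

Lemma run_sum p k (I : Type) (r : seq I) (P : pred I) (g : I -> ('I_n -> nat) -> R) x :
  (forall t D, 0 <= p t D) ->
  run p k (fun y => \sum_(i <- r | P i) g i y) x = \sum_(i <- r | P i) run p k (g i) x.
Proof.
move=> p0; elim: r => [|i r IH].
  rewrite big_nil -[RHS](mul0r (run p k (fun=> 0) x)) -runZ //.
  by apply: eq_run => // y; rewrite big_nil mul0r.
rewrite big_cons -IH; case: ifP => Pi; last first.
  by apply: eq_run => // y; rewrite big_cons Pi.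
by rewrite -runD //; apply: eq_run => // y; rewrite big_cons Pi.
Qed.

Lemma run_ge0 p k g x : (forall t D, 0 <= p t D) ->
  (forall y, 0 <= g y) -> 0 <= run p k g x.
Proof.
move=> p0 g0; have <- : run p k (fun y => 0 * g y) x = 0 by rewrite runZ // mul0r.
by apply: run_le => // y; rewrite mul0r.
Qed.

Lemma run_add p a b g x :
  run p (a + b) g x = run p a (run (fun t => p (a + t)%N) b g) x.
Proof. by elim: b g => [|b IH] g; rewrite ?addn0 // addnS /= IH. Qed.

(* A demand [f] asks bin [i] for [f i] balls above level [M]; by truncation,
   [f i = 0] asks for nothing, even below that level. *)
Definition sat M f x := [forall i, (f i <= x i - M)%N].

Definition dec f (j : 'I_n) : 'I_n -> nat :=
  fun i => if i == j then (f j).-1 else f i.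
(** No maximum with the old demand is taken, because [spawn] is meant for sets [D] that meet
    [supp f] in [j] alone. *)
Definition spawn f (j : 'I_n) (D : {set 'I_n}) : 'I_n -> nat :=
  fun i => if i \in D then (f j).-1 else f i.
Definition addone f (j : 'I_n) (J : {set 'I_n}) : 'I_n -> nat :=
  fun i => if i == j then 0%N else if i \in J then 1%N else f i.
Definition supp f : {set 'I_n} := [set i | f i != 0%N].

Lemma sat_le M f1 f2 x : (forall i, (f1 i <= f2 i)%N) -> sat M f2 x -> sat M f1 x.
Proof. by move=> f12 /forallP s; apply/forallP => i; apply: leq_trans (f12 i) (s i). Qed.

(** Only coordinate [j] changes, so it carried the sole unmet demand and was exactly one short. A
    ball landing below level [M] leaves the truncated load at zero and completes nothing, whence
    [M <= x j]. *)
Lemma sat_add_ball M f x j : ~~ sat M f x -> sat M f (add_ball x j) ->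
  [/\ (M <= x j)%N, f j = (x j - M).+1 & forall i, i != j -> (f i <= x i - M)%N].
Proof.
move=> /forallPn [i0]; rewrite -ltnNge => i0f /forallP s.
have io i : i != j -> (f i <= x i - M)%N.
  by move=> ij; have := s i; rewrite /add_ball (negbTE ij) addn0.
have i0j : i0 = j by apply/eqP/contraT => /io; rewrite leqNgt i0f.
by rewrite {}i0j in i0f; have := s j; rewrite /add_ball eqxx; split => //; lia.
Qed.

(** A union bound for a second demanded bin in the chosen set; the sum over pairs is the quantity
    that visibility controls once the rounds are summed. *)
Definition conflict q f j : R :=
  \sum_(l in supp f | l != j) \sum_(D : {set 'I_n} | (j \in D) && (l \in D)) q D.

(** The completing bin is unique, so only the share of [j] survives in the average over ties. *)
Lemma step_at q M f x j : ~~ sat M f x -> sat M f (add_ball x j) ->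
  step q (fun y => (sat M f y)%:R) x =
  \sum_(D | j \in least_loaded x D) q D / #|least_loaded x D|%:R.
Proof.
move=> ns sj; rewrite /step [RHS]big_mkcond; apply: eq_bigr => D _.
have sE b : b != j -> sat M f (add_ball x b) = false.
  move=> bj; apply/negP => sb; have [_ fb _] := sat_add_ball ns sb.
  by have [_ _ /(_ _ bj)] := sat_add_ball ns sj; rewrite fb ltnn.
have [jl|jl] := boolP (j \in _).
  by rewrite (bigD1 j) //= sj big1 ?addr0 ?div1r // => b /andP[_ /sE ->].
rewrite big1 ?mul0r ?mulr0 // => b bl; rewrite sE //; by apply: contraNneq jl => <-.
Qed.

Lemma step_none q M f x : ~~ sat M f x -> (forall j, ~~ sat M f (add_ball x j)) ->
  step q (fun y => (sat M f y)%:R) x = 0.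
Proof.
move=> ns sj; rewrite /step big1 // => D _; rewrite big1 ?mul0r ?mulr0 // => b _.
by rewrite (negbTE (sj b)).
Qed.

End Chain.

Section UpperStep.
Variables (R : realFieldType) (n d : nat).
Implicit Types (q : {set 'I_n} -> R) (x f : 'I_n -> nat).

Lemma conflict_ge0 q f j : (forall D, 0 <= q D) -> 0 <= conflict q f j.
Proof. by move=> q0; apply: sumr_ge0 => l _; apply: sumr_ge0. Qed.

Lemma conflict_ge q f j (P : pred {set 'I_n}) : (forall D, 0 <= q D) -> f j != 0%N ->
  (forall D, P D -> j \in D) ->
  \sum_(D | P D && (D :&: supp f != [set j])) q D <= conflict q f j.
Proof.
move=> q0 fj Pj; rewrite /conflict (exchange_big_dep xpredT) //= [X in X <= _]big_mkcond /=.
apply: ler_sum => D _; case: ifP => [/andP[PD Dj]|_]; last by apply: sumr_ge0.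
have jD := Pj _ PD.
have [l lD lj] : exists2 l, l \in D :&: supp f & l != j.
  apply/exists_inP; rewrite -negb_forall_in; apply: contra Dj => /forall_inP Dj.
  by rewrite eqEsubset sub1set !inE jD fj !andbT; apply/subsetP => l /Dj; rewrite inE.
move: lD; rewrite inE => /andP[lD lf].
rewrite (bigD1 l) /= ?lf ?lj ?jD ?lD // lerDl; exact: sumr_ge0.
Qed.

(** As [j] is least loaded, no bin of [D] is below [M]; those not tied with [j] are above it and
    make up at least half of [D]. A subset of fixed size is extracted so that it can be summed
    over. *)
Lemma loaded_subset M f j x (D : {set 'I_n}) : #|D| = d -> f j = 1%N -> x j = M ->
  j \in least_loaded x D -> (2 * #|least_loaded x D| < d)%N ->
  (forall i, i != j -> (f i <= x i - M)%N) ->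
  exists2 J : {set 'I_n}, (J \subset D :\ j) && (#|J| == uphalf d) & sat M (addone f j J) x.
Proof.
move=> Dd fj xj jl ld fi.
pose X := [set i in D | (M < x i)%N].
have lX : least_loaded x D = D :\: X.
  move: jl; rewrite inE => /andP[jD /forall_inP jm].
  apply/setP => i; rewrite !inE; case iD: (i \in D) => //=; rewrite ?andbT -?leqNgt.
  apply/forall_inP/idP => [/(_ _ jD)|iM b bD]; first by rewrite xj.
  by apply: leq_trans iM _; rewrite -xj; apply: jm.
have XD : X \subset D by apply/subsetP => i; rewrite inE => /andP[].
have cX : (uphalf d <= #|X|)%N.
  have := cardsID X D; rewrite (setIidPr XD) -lX Dd => H.
  by rewrite uphalf_half; have := odd_double_half d; lia.
have /card_geqP [s [us ss sX]] := cX.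
have jX : j \notin X by rewrite inE xj ltnn andbF.
exists [set i in s].
  rewrite cardsE (card_uniqP us) ss eqxx andbT; apply/subsetP => i; rewrite !inE => /sX iX.
  rewrite (subsetP XD) // andbT; by apply: contraNneq jX => <-.
apply/forallP => i; rewrite /addone; case: eqP => // /eqP ij; rewrite inE.
case: ifP => [/sX|_]; [rewrite inE => /andP[_]; lia|exact: fi].
Qed.

(** The completing ball determines [j]. Sets with a second demanded bin go to the conflict term;
    otherwise minimality of [j] forces all of [D] to level [(f j).-1]. At level one this says
    nothing, and either at least [d / 2] bins are tied, so that [j] wins with probability at most
    [2 / d], or half of [D] already carries a ball. *)
Lemma step_upper q M f x : (0 < d)%N -> choice_law d q ->
  step q (fun y => (sat M f y)%:R) x <=
  (sat M f x)%:R + \sum_(j in supp f) conflict q f j * (sat M (dec f j) x)%:R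
  + \sum_(j | (1 < f j)%N) \sum_(D | D :&: supp f == [set j])
       q D * (sat M (spawn f j D) x)%:R
  + \sum_(j | f j == 1%N) \sum_(D | D :&: supp f == [set j])
       q D * (2 / d%:R * (sat M (dec f j) x)%:R
         + \sum_(J : {set 'I_n} | (J \subset D :\ j) && (#|J| == uphalf d))
             (sat M (addone f j J) x)%:R).
Proof.
move=> d0 hq; have [q0 _ qd] := hq.
set C := \sum_(j in supp f) _; set S := \sum_(j | (1 < f j)%N) _.
set L := \sum_(j | f j == 1%N) _.
have C0 j : 0 <= conflict q f j * (sat M (dec f j) x)%:R.
  by rewrite mulr_ge0 ?conflict_ge0 ?ler0n.
have S0 j : 0 <= \sum_(D | D :&: supp f == [set j]) q D * (sat M (spawn f j D) x)%:R.
  by apply: sumr_ge0 => D _; rewrite mulr_ge0 ?ler0n.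
have L00 j D : 0 <= (2 / d%:R * (sat M (dec f j) x)%:R
         + \sum_(J : {set 'I_n} | (J \subset D :\ j) && (#|J| == uphalf d))
             (sat M (addone f j J) x)%:R) :> R.
  by rewrite addr_ge0 ?mulr_ge0 ?invr_ge0 ?ler0n // sumr_ge0.
have L0 j : 0 <= \sum_(D | D :&: supp f == [set j])
       q D * (2 / d%:R * (sat M (dec f j) x)%:R
         + \sum_(J : {set 'I_n} | (J \subset D :\ j) && (#|J| == uphalf d))
             (sat M (addone f j J) x)%:R).
  by apply: sumr_ge0 => D _; rewrite mulr_ge0.
have CC : 0 <= C by apply: sumr_ge0 => j _; exact: C0.
have SS : 0 <= S by apply: sumr_ge0 => j _; exact: S0.
have LL : 0 <= L by apply: sumr_ge0 => j _; exact: L0.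
have [sx|nsx] := boolP (sat M f x).
  have : step q (fun y => (sat M f y)%:R) x <= step q (fun=> 1) x.
    by apply: step_le => // y; case: sat.
  rewrite (step_const _ _ d0 hq) => /le_trans; apply.
  by rewrite -?addrA lerDl ?addr_ge0.
have [j sj|nj] := pickP (fun j => sat M f (add_ball x j)); last first.
  rewrite step_none //; last by move=> j; have /= -> := nj j.
  by rewrite !addr_ge0.
have [Mx fj fi] := sat_add_ball nsx sj.
have fj0 : f j != 0%N by rewrite fj.
have sdec : sat M (dec f j) x.
  apply/forallP => i; rewrite /dec; case: eqP => [->|/eqP /fi //]; first by rewrite fj.
rewrite (step_at q nsx sj) (bigID (fun D => D :&: supp f == [set j])) /= add0r.
rewrite addrC.
have q1 D : q D / #|least_loaded x D|%:R <= q D.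
  have [->|qD] := eqVneq (q D) 0; first by rewrite mul0r.
  rewrite ler_piMr // invf_le1 ?ler1n ?ltr0n card_gt0 least_loaded_neq0 //;
  by rewrite -card_gt0 qd.
rewrite -addrA; apply: lerD.
  have : conflict q f j <= C.
    by rewrite /C (bigD1 j) ?inE //= sdec mulr1 lerDl; apply: sumr_ge0.
  apply: le_trans; apply: le_trans (conflict_ge q0 fj0 (P := fun D => j \in least_loaded x D) _).
    by apply: ler_sum => D _; exact: q1.
  by move=> D; apply/subsetP/least_loaded_sub.
have [f1|f1] := ltnP 1 (f j).
  apply: (@le_trans _ _ S); last by rewrite lerDl.
  rewrite /S (bigD1 j) //= ler_wpDr //; first by apply: sumr_ge0.
  rewrite big_mkcond [X in _ <= X]big_mkcond; apply: ler_sum => D _.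
  case jl: (j \in _); rewrite /=; last by case: ifP => // _; rewrite mulr_ge0 ?ler0n.
  case: ifP => // _.
  suff -> : sat M (spawn f j D) x by rewrite mulr1.
  apply/forallP => i; rewrite /spawn; case: ifP => iD.
    move: jl; rewrite inE => /andP[_ /forall_inP /(_ _ iD)]; rewrite fj /=; lia.
  apply: fi; apply: contraFneq iD => ->; by move: jl; rewrite inE => /andP[].
have {}f1 : f j = 1%N by lia.
have xj : x j = M by move: fj; rewrite f1; lia.
apply: (@le_trans _ _ L); last by rewrite lerDr.
rewrite /L (bigD1 j) ?f1 //= ler_wpDr //; first by apply: sumr_ge0.
rewrite big_mkcond [X in _ <= X]big_mkcond; apply: ler_sum => D _.
case jl: (j \in _); rewrite /=; last by case: ifP => // _; rewrite mulr_ge0.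
case: ifP => // _.
have [->|qD] := eqVneq (q D) 0; first by rewrite !mul0r.
have Dd := qd _ qD.
have lD : (0 < #|least_loaded x D|)%N.
  by rewrite card_gt0; apply/set0Pn; exists j.
have [ld|ld] := leqP d (2 * #|least_loaded x D|).
  apply: ler_wpM2l => //; rewrite sdec mulr1 ler_wpDr //; first exact: sumr_ge0.
  rewrite ler_pdivlMr ?ltr0n // mulrC ler_pdivrMr ?ltr0n //.
  by rewrite -natrM ler_nat.
have [J HJ sJ] := loaded_subset Dd f1 xj jl ld fi.
apply: le_trans (q1 D) _; rewrite ler_peMr // ler_wpDl //.
  by rewrite mulr_ge0 ?divr_ge0 ?ler0n.
by rewrite (bigD1 J) //= sJ lerDl sumr_ge0.
Qed.

Lemma step_upper_crude q M f x : (0 < d)%N -> choice_law d q ->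
  step q (fun y => (sat M f y)%:R) x <=
  (sat M f x)%:R
  + \sum_(j in supp f) (\sum_(D : {set 'I_n} | j \in D) q D) * (sat M (dec f j) x)%:R.
Proof.
move=> d0 hq; have [q0 _ qd] := hq.
set C := \sum_(j in supp f) _.
have C0 j : 0 <= (\sum_(D : {set 'I_n} | j \in D) q D) * (sat M (dec f j) x)%:R.
  by rewrite mulr_ge0 ?ler0n ?sumr_ge0.
have CC : 0 <= C by apply: sumr_ge0 => j _; exact: C0.
have [sx|nsx] := boolP (sat M f x).
  have : step q (fun y => (sat M f y)%:R) x <= step q (fun=> 1) x.
    by apply: step_le => // y; case: sat.
  rewrite (step_const _ _ d0 hq) => /le_trans; apply.
  by rewrite -?addrA lerDl ?addr_ge0.
have [j sj|nj] := pickP (fun j => sat M f (add_ball x j)); last first.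
  rewrite step_none //; last by move=> j; have /= -> := nj j.
  by rewrite !addr_ge0.
have [Mx fj fi] := sat_add_ball nsx sj.
have fj0 : f j != 0%N by rewrite fj.
have sdec : sat M (dec f j) x.
  apply/forallP => i; rewrite /dec; case: eqP => [->|/eqP /fi //]; first by rewrite fj.
rewrite (step_at q nsx sj) add0r.
rewrite /C (bigD1 j) ?inE //= sdec mulr1 ler_wpDr //; first by apply: sumr_ge0 => i _; exact: C0.
rewrite big_mkcond [X in _ <= X]big_mkcond; apply: ler_sum => D _.
case jl: (j \in least_loaded _ _); last by case: ifP.
have -> : j \in D by apply: subsetP jl; exact: least_loaded_sub.
have l0 : (0 < #|least_loaded x D|)%N by rewrite card_gt0; apply/set0Pn; exists j.
by rewrite ler_piMr // invf_le1 ?ler1n ?ltr0n.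
Qed.

End UpperStep.

(* Once [raise f j D] is met, a ball thrown at [D] that lands in [j] meets [f]. *)
Definition raise n (f : 'I_n -> nat) (j : 'I_n) (D : {set 'I_n}) : 'I_n -> nat :=
  fun i => maxn (if i == j then 0 else f i) (if i \in D then (f j).-1 else 0).

Definition load_lipschitz (R : realFieldType) n (g : ('I_n -> nat) -> R) :=
  forall x i, 0 <= g (add_ball x i) - g x <= 1.

Section LowerStep.
Variables (R : realFieldType) (n d : nat).
Implicit Types (q : {set 'I_n} -> R) (x f : 'I_n -> nat) (g : ('I_n -> nat) -> R).

(** Subtracting the indicator of [f] keeps the left side at most one where [f] is already met.
    Elsewhere a single [j] contributes, and if [raise f j D] is met then [j] is least loaded in [D],
    with at most [d] ties. *)
Lemma step_lower q f x : (0 < d)%N -> choice_law d q ->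
  (sat 0 f x)%:R + \sum_(j in supp f) \sum_(D : {set 'I_n} | j \in D)
     q D / d%:R * ((sat 0 (raise f j D) x)%:R - (sat 0 f x)%:R)
  <= step q (fun y => (sat 0 f y)%:R) x.
Proof.
move=> d0 hq; have [q0 q1 qd] := hq.
have qd0 D : 0 <= q D / d%:R by rewrite divr_ge0.
have [sx|nsx] := boolP (sat 0 f x).
  have sxb b : sat 0 f (add_ball x b).
    apply/forallP => i; have /forallP/(_ i) := sx; rewrite /add_ball; lia.
  have -> : step q (fun y => (sat 0 f y)%:R) x = 1.
    transitivity (step q (fun=> 1) x); last exact: step_const d0 hq.
    apply: eq_bigr => D _; congr (_ * (_ / _)).
    by apply: eq_bigr => b _; rewrite sxb.
  rewrite gerDl; apply: sumr_le0 => j _; apply: sumr_le0 => D _.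
  by rewrite mulr_ge0_le0 // subr_le0; case: sat.
have [j sj|nj] := pickP (fun j => sat 0 f (add_ball x j)); last first.
  rewrite step_none //; last by move=> j; have /= -> := nj j.
  rewrite add0r; apply: sumr_le0 => j jf; apply: sumr_le0 => D jD.
  rewrite subr0 (_ : sat _ _ _ = false) ?mulr0 //.
  apply/negP => /forallP sr; have /negP := nj j; apply.
  apply/forallP => i; have := sr i; rewrite /raise /add_ball !subn0; case: eqP => [->|].
    by rewrite jD max0n; lia.
  by move=> _; lia.
have [_ fj fi] := sat_add_ball nsx sj.
rewrite (step_at q nsx sj) add0r.
have jf : j \in supp f by rewrite inE fj.
rewrite (bigD1 j) //= [X in _ + X]big1 ?addr0 => [|i /andP[_ ij]]; last first.
  rewrite big1 // => D _; rewrite subr0 (_ : sat _ _ _ = false) ?mulr0 //.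
  apply/negP => /forallP /(_ j); rewrite /raise (eq_sym j) (negbTE ij) fj; lia.
rewrite big_mkcond [X in _ <= X]big_mkcond; apply: ler_sum => D _; rewrite subr0.
case: ifP => jD; last first.
  by case: ifP => // _; rewrite mulr_ge0 ?invr_ge0.
case sr: (sat 0 (raise f j D) x); last first.
  by rewrite mulr0; case: ifP => // _; rewrite mulr_ge0 ?invr_ge0.
have jl : j \in least_loaded x D.
  rewrite inE jD; apply/forall_inP => b bD.
  move/forallP/(_ b): sr; rewrite /raise bD; lia.
rewrite jl mulr1; have [->|qD] := eqVneq (q D) 0; first by rewrite !mul0r.
apply: ler_wpM2l => //; rewrite lef_pV2 ?posrE ?ltr0n //.
  by rewrite ler_nat -(qd _ qD) subset_leq_card // least_loaded_sub.
by rewrite card_gt0; apply/set0Pn; exists j.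
Qed.

Lemma add_ballC x i j : add_ball (add_ball x i) j = add_ball (add_ball x j) i.
Proof. by apply: functional_extensionality => k; rewrite /add_ball addnAC. Qed.

Lemma least_loadedP x (D : {set 'I_n}) b :
  reflect (b \in D /\ forall c, c \in D -> (x b <= x c)%N) (b \in least_loaded x D).
Proof.
rewrite inE; apply: (iffP andP) => -[bD].
  by move/forall_inP.
by move=> h; split=> //; apply/forall_inP.
Qed.

Lemma least_add_ball_out x i (D : {set 'I_n}) : D != set0 -> i \notin least_loaded x D ->
  least_loaded (add_ball x i) D = least_loaded x D.
Proof.
move=> /(least_loaded_neq0 x) /set0Pn[m ml] il.
have [mD mm] := least_loadedP _ _ _ ml.
have mi : m != i by apply: contraNneq il => <-.
apply/setP => b; apply/least_loadedP/least_loadedP => -[bD bm]; split=> // c cD.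
  have := bm m mD; have := mm c cD; rewrite /add_ball (negbTE mi); lia.
have bi : b != i.
  by apply: contraNneq il => <-; apply/least_loadedP.
have := bm c cD; rewrite /add_ball (negbTE bi); lia.
Qed.

Lemma least_add_ball_in x i (D : {set 'I_n}) : i \in least_loaded x D ->
  least_loaded x D != [set i] ->
  least_loaded (add_ball x i) D = least_loaded x D :\ i.
Proof.
move=> il li; have [iD im] := least_loadedP _ _ _ il.
have [m ml mi] : exists2 m, m \in least_loaded x D & m != i.
  apply/exists_inP; rewrite -negb_forall_in; apply: contra li => /forall_inP Dj.
  by rewrite eqEsubset sub1set il andbT; apply/subsetP => l /Dj; rewrite inE.
have [mD mm] := least_loadedP _ _ _ ml.
have xmi : x m = x i by apply/eqP; rewrite eqn_leq mm ?im.
apply/setP => b; rewrite in_setD1; apply/least_loadedP/andP => [[bD bm]|[bi /least_loadedP[bD bm]]].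
  have := bm m mD; rewrite /add_ball (negbTE mi) => h; have := im b bD => h2.
  have bi : b != i by move: h; case: (b == i) => //=; lia.
  split=> //; apply/least_loadedP; split=> // c cD; have := im c cD; lia.
by split=> // c cD; have := bm c cD; rewrite /add_ball (negbTE bi); lia.
Qed.

(** The processes with and without an extra ball in [i] are coupled through the same chosen set; the
    cases are whether [i] is outside the tie set, is all of it, or is one of several. *)
Lemma lipschitz_step q g : (0 < d)%N -> choice_law d q -> load_lipschitz g ->
  load_lipschitz (step q g).
Proof.
move=> d0 [q0 q1 qd] gl x i.
have g0 y b : g y <= g (add_ball y b) by case/andP: (gl y b); rewrite subr_ge0.
have g1 y b : g (add_ball y b) - g y <= 1 by case/andP: (gl y b).
rewrite /step -sumrB.
suff H D : 0 <= q D * ((\sum_(b in least_loaded (add_ball x i) D) g (add_ball (add_ball x i) b))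
                / #|least_loaded (add_ball x i) D|%:R) -
   q D * ((\sum_(b in least_loaded x D) g (add_ball x b)) / #|least_loaded x D|%:R) <= q D.
  apply/andP; split; first by apply: sumr_ge0 => D _; case/andP: (H D).
  by rewrite -[X in _ <= X]q1; apply: ler_sum => D _; case/andP: (H D).
rewrite -mulrBr; have [->|qD] := eqVneq (q D) 0; first by rewrite !mul0r lexx.
have D0 : D != set0 by rewrite -card_gt0 (qd _ qD).
suff : 0 <= (\sum_(b in least_loaded (add_ball x i) D) g (add_ball (add_ball x i) b))
                / #|least_loaded (add_ball x i) D|%:R -
     (\sum_(b in least_loaded x D) g (add_ball x b)) / #|least_loaded x D|%:R <= 1.
  case/andP=> h0 h1; rewrite mulr_ge0 //= -[X in _ <= X]mulr1; exact: ler_wpM2l.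
set y := add_ball x i.
have cl z : (0 : R) < #|least_loaded z D|%:R by rewrite ltr0n card_gt0 least_loaded_neq0.
have bnd (S : {set 'I_n}) (u v : 'I_n -> R) :
   (forall b, 0 <= u b - v b <= 1) -> 0 <= \sum_(b in S) u b - \sum_(b in S) v b <= #|S|%:R.
  move=> uv; rewrite -sumrB; apply/andP; split.
    by apply: sumr_ge0 => b _; case/andP: (uv b).
  by rewrite -sumr_const; apply: ler_sum => b _; case/andP: (uv b).
have [il|il] := boolP (i \in least_loaded x D); last first.
  rewrite least_add_ball_out // -mulrBl.
  have /andP[h0 h1] := bnd (least_loaded x D) (fun b => g (add_ball y b)) (fun b => g (add_ball x b))
    (fun b => ltac:(rewrite /y add_ballC; exact: gl)).
  by rewrite divr_ge0 ?ler0n //= ler_pdivrMr ?mul1r.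
(* If [i] is the only minimum, the process without the extra ball moves exactly to [y], so
   everything is compared with [g y]. *)
have [li|li] := eqVneq (least_loaded x D) [set i].
  rewrite li big_set1 cards1 divr1 -/y.
  have /andP[] := bnd (least_loaded y D) (fun b => g (add_ball y b)) (fun b => g y)
    (fun b => gl y b).
  rewrite sumr_const -[g y *+ _]mulr_natr => h0 h1.
  by rewrite subr_ge0 ler_pdivlMr // -subr_ge0 h0 /= lerBlDr ler_pdivrMr // mulrDl mul1r -lerBlDr.
rewrite least_add_ball_in // (big_setD1 i il) /= -/y (cardsD1 i (least_loaded x D)) il /=.
set L := _ :\ i.
have L0 : (0 < #|L|)%N.
  rewrite card_gt0; apply: contraNneq li => L0; apply/eqP/setP => b.
  by move/setP/(_ b): L0; rewrite !inE; case: eqP => //= ->; case/least_loadedP: il => -> im;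
    move=> _; apply/forall_inP.
have := bnd L (fun b => g (add_ball y b)) (fun b => g (add_ball x b))
    (fun b => ltac:(rewrite /y add_ballC; exact: gl)).
have := bnd L (fun b => g (add_ball y b)) (fun b => g y) (fun b => gl y b).
rewrite sumr_const -[g y *+ _]mulr_natr natrD.
have : (0 : R) < #|L|%:R by rewrite ltr0n.
set a : R := #|L|%:R; set S' := \sum_(b in L) _; set S := \sum_(b in L) _.
move=> a0 /andP[h1 h2] /andP[h3 h4].
(* A convex combination of two averaged increments: weight [a / (1 + a)] for balls sent to the same
   bin, weight [1 / (1 + a)] for the ball that went to [i]. *)
have -> : S' / a - (g y + S) / (1 + a) = (a * (S' - S) + (S' - g y * a)) / (a * (1 + a)).
  by field; rewrite !gt_eqF //; lra.
have aa : 0 < a * (1 + a) by nra.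
apply/andP; split; first by apply: divr_ge0; [rewrite addr_ge0 // mulr_ge0 // ltW|rewrite ltW].
rewrite ler_pdivrMr // mul1r.
have : a * (S' - S) <= a * a by rewrite ler_pM2l.
lra.
Qed.

End LowerStep.

(** * Product supersolutions *)

(** The conflict-free part of [step_upper] for an arbitrary functional [w]: it is applied both to
    demand probabilities and to the weights that are to dominate them. *)
Definition spawn_sum (R : realFieldType) n d (q : {set 'I_n} -> R) (f : 'I_n -> nat)
    (w : ('I_n -> nat) -> R) : R :=
  \sum_(j | (1 < f j)%N) \sum_(D | D :&: supp f == [set j]) q D * w (spawn f j D)
  + \sum_(j | f j == 1%N) \sum_(D | D :&: supp f == [set j])
       q D * (2 / d%:R * w (dec f j)
         + \sum_(J : {set 'I_n} | (J \subset D :\ j) && (#|J| == uphalf d))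
             w (addone f j J)).

(* [us_crude] forgets which bins of the chosen set were full already; it is only
   useful for demands of level one over short windows of rounds. *)
Record upper_system (R : realFieldType) n d (q : nat -> {set 'I_n} -> R)
    (F : nat -> ('I_n -> nat) -> R) : Prop := UpperSystem {
  us_law : forall t, choice_law d (q t);
  us_ge0 : forall t f, 0 <= F t f;
  us_le1 : forall t f, F t f <= 1;
  us_anti : forall t f1 f2, (forall i, (f1 i <= f2 i)%N) -> F t f2 <= F t f1;
  us_rec : forall t f, F t.+1 f <= F t f
    + \sum_(j in supp f) conflict (q t) f j * F t (dec f j)
    + spawn_sum d (q t) f (F t);
  us_crude : forall t f, F t.+1 f <= F t f
    + \sum_(j in supp f) (\sum_(D : {set 'I_n} | j \in D) q t D) * F t (dec f j)
}.

Section System.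
Variables (R : realFieldType) (n d : nat).
Implicit Types (q : {set 'I_n} -> R) (x f : 'I_n -> nat).
Implicit Types (p : nat -> {set 'I_n} -> R) (F : nat -> ('I_n -> nat) -> R).

Lemma upper_system_shift T p F : upper_system d p F ->
  upper_system d (fun t => p (T + t)%N) (fun t => F (T + t)%N).
Proof.
case=> h1 h2 h3 h4 h5 h6; split=> //; first by move=> t f1 f2; apply: h4.
  by move=> t f; rewrite addnS; apply: h5.
by move=> t f; rewrite addnS; apply: h6.
Qed.

Definition demand_prob p M x t f : R := run p t (fun y => (sat M f y)%:R) x.

Lemma demand_prob_system p M x : (0 < d)%N -> (forall t, choice_law d (p t)) ->
  upper_system d p (demand_prob p M x).
Proof.
move=> d0 hp; have p0 t D : 0 <= p t D by case: (hp t).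
split=> //.
- by move=> t f; apply: run_ge0.
- by move=> t f; rewrite -[X in _ <= X](run_const t 1 x d0 hp); apply: run_le => // y; case: sat.
- move=> t f1 f2 f12; apply: run_le => // y; rewrite ler_nat.
  by case s2: (sat M f2 y) => //; rewrite (sat_le f12 s2).
- move=> t f; rewrite /demand_prob /=.
  apply: le_trans (run_le _ _ p0 (fun y => step_upper M f y d0 (hp t))) _.
  rewrite !runD // /spawn_sum !run_sum // -addrA; apply: lerD.
    by apply: lerD => //; apply: ler_sum => j _; rewrite runZ.
  apply: lerD; apply: ler_sum => j _; rewrite run_sum //; apply: ler_sum => D _;
    rewrite runZ // runD // runZ // run_sum //.
- move=> t f; rewrite /demand_prob /=.
  apply: le_trans (run_le _ _ p0 (fun y => step_upper_crude M f y d0 (hp t))) _.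
  rewrite runD // run_sum //; apply: lerD => //.
  by apply: ler_sum => j _; rewrite runZ.
Qed.

Lemma demand_prob0 p M x f : (forall i, (x i <= M)%N) ->
  demand_prob p M x 0 f = [forall i, f i == 0%N]%:R.
Proof.
move=> xM; rewrite /demand_prob /=; congr (_%:R); congr nat_of_bool.
apply: eq_forallb => i; have := xM i; rewrite -subn_eq0 => /eqP ->.
by rewrite leqn0.
Qed.

Lemma demand_prob_lower p x t f : (0 < d)%N -> (forall t, choice_law d (p t)) ->
  demand_prob p 0 x t f + \sum_(j in supp f) \sum_(D : {set 'I_n} | j \in D)
     p t D / d%:R * (demand_prob p 0 x t (raise f j D) - demand_prob p 0 x t f)
  <= demand_prob p 0 x t.+1 f.
Proof.
move=> d0 hp; have p0 t' D : 0 <= p t' D by case: (hp t').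
rewrite /demand_prob /=.
apply: le_trans (run_le _ _ p0 (fun y => step_lower f y d0 (hp t))).
rewrite runD // run_sum //; apply: lerD => //.
apply: ler_sum => j _; rewrite run_sum //; apply: ler_sum => D _; rewrite runZ //.
rewrite runD // -[X in _ * (_ + X)](_ : - 1 * demand_prob p 0 x t f = _) ?mulN1r // -mulN1r.
by rewrite -runZ // (@eq_run _ _ p t (fun y => -1 * _) (fun y => - (sat 0 f y)%:R)) // => y; rewrite mulN1r.
Qed.

(** Expand the product and keep the terms with at most one factor [y]. In this way the growth of
    one-bin weights pays for a sum over the bin [j] that spawns. *)
Lemma prodD_ge (x y : 'I_n -> R) (P : pred 'I_n) : (forall i, 0 <= x i) ->
  (forall i, 0 <= y i) ->
  \prod_i x i + \sum_(j | P j) y j * \prod_(i | i != j) x i <= \prod_i (x i + y i).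
Proof.
move=> x0 y0.
have H (r : seq 'I_n) : uniq r ->
    \prod_(i <- r) x i + \sum_(j <- r) y j * \prod_(i <- r | i != j) x i
    <= \prod_(i <- r) (x i + y i).
  elim: r => [|a r IH] /=; first by rewrite !big_nil addr0.
  case/andP=> ar ur; rewrite !big_cons eqxx.
  have -> : \prod_(i <- r | i != a) x i = \prod_(i <- r) x i.
    rewrite big_seq_cond [RHS]big_seq; apply: eq_bigl => i.
    by case ir: (i \in r) => //=; apply: contraNneq ar => <-.
  have -> : \sum_(j <- r) y j * \prod_(i <- a :: r | i != j) x i =
            x a * \sum_(j <- r) y j * \prod_(i <- r | i != j) x i.
    rewrite mulr_sumr big_seq [RHS]big_seq; apply: eq_bigr => j jr.
    rewrite big_cons ifT; first by rewrite mulrCA.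
    by apply: contraNneq ar => ->.
  have {}IH := IH ur.
  have : x a * (\prod_(i <- r) x i + \sum_(j <- r) y j * \prod_(i <- r | i != j) x i)
     + y a * \prod_(i <- r) x i <= (x a + y a) * \prod_(i <- r) (x i + y i).
    rewrite mulrDl lerD //; apply: ler_wpM2l => //.
    by apply: ler_prod => i _; rewrite x0 lerDl y0.
  by apply: le_trans; rewrite mulrDr -!addrA [y a * _ + _]addrC.
apply: le_trans (H _ (index_enum_uniq _)); rewrite lerD2l big_mkcond.
apply: ler_sum => j _; case: ifP => // _; rewrite mulr_ge0 ?prodr_ge0 //.
Qed.

End System.

Definition prod_weight (R : realFieldType) n (phi : nat -> R) (f : 'I_n -> nat) : R :=
  \prod_i phi (f i).

Definition cnt1 n (f : 'I_n -> nat) := #|[set i | f i == 1%N]|.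
(** Spawning cannot increase this potential, as [d] demands of level [k - 1] weigh
    [d * d ^ (k - 1)]. Level one is left to [cnt1], because [addone] trades one demand of level one
    for [uphalf d] of them. *)
Definition high_mass n d (f : 'I_n -> nat) := (\sum_(i | (1 < f i)%N) d ^ f i)%N.

(* One-bin weights [phi t k] whose product over the bins is a supersolution of the
   conflict-free part of the recursion; [pd] bounds the probability that a given
   bin is chosen, and [Gam] is the price of one conflict. *)
Record level_weight (R : realFieldType) (d K T : nat) (pd Gam : R)
    (phi : nat -> nat -> R) : Prop := LevelWeight {
  lw_0 : forall t, phi t 0 = 1;
  lw_ge0 : forall t k, 0 <= phi t k;
  lw_mono : forall t k, phi t k <= phi t.+1 k;
  lw_ratio : forall t k, (k < K)%N -> (t <= T)%N -> phi t k <= Gam * phi t k.+1;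
  lw_high : forall t k, (0 < k < K)%N -> (t < T)%N ->
    2 * pd * phi t k ^+ d <= phi t.+1 k.+1 - phi t k.+1;
  lw_one : forall t, (t < T)%N ->
    2 * pd * (2 / d%:R + 'C(d.-1, uphalf d)%:R * phi t 1%N ^+ uphalf d)
      <= phi t.+1 1%N - phi t 1%N
}.

Section LevelWeight.
Variables (R : realFieldType) (n d : nat).
Hypothesis d2 : (1 < d)%N.
Implicit Types (q : {set 'I_n} -> R) (f : 'I_n -> nat).
Implicit Types (phi sig : nat -> nat -> R).

Lemma uphalf_lt_d : (uphalf d <= d.-1)%N.
Proof. by rewrite uphalf_half; have := odd_double_half d; lia. Qed.

Lemma spawn_sumD q f w1 w2 :
  spawn_sum d q f (fun g => w1 g + w2 g) = spawn_sum d q f w1 + spawn_sum d q f w2.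
Proof.
rewrite /spawn_sum addrACA -!big_split /=; congr (_ + _); apply: eq_bigr => j _;
  rewrite -big_split /=; apply: eq_bigr => D _; first by rewrite mulrDr.
by rewrite big_split /= -mulrDr; congr (_ * _); rewrite mulrDr addrACA.
Qed.

Lemma spawn_sumZ q f c w :
  spawn_sum d q f (fun g => c * w g) = c * spawn_sum d q f w.
Proof.
rewrite /spawn_sum mulrDr !mulr_sumr; congr (_ + _); apply: eq_bigr => j _;
  rewrite mulr_sumr; apply: eq_bigr => D _; first by rewrite mulrCA.
by rewrite -mulr_sumr mulrCA -mulrDr mulrCA.
Qed.

Lemma spawn_sum_le q f w1 w2 : choice_law d q ->
  (forall j D, (1 < f j)%N -> D :&: supp f = [set j] -> #|D| = d ->
     w1 (spawn f j D) <= w2 (spawn f j D)) ->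
  (forall j, f j = 1%N -> w1 (dec f j) <= w2 (dec f j)) ->
  (forall j (J : {set 'I_n}), f j = 1%N -> (#|J| <= d)%N -> w1 (addone f j J) <= w2 (addone f j J)) ->
  spawn_sum d q f w1 <= spawn_sum d q f w2.
Proof.
move=> [q0 _ qd] h1 h2 h3; apply: lerD; apply: ler_sum => j fj; apply: ler_sum => D /eqP Dj.
  have [->|qD] := eqVneq (q D) 0; first by rewrite !mul0r.
  by apply: ler_wpM2l => //; apply: h1 => //; apply: qd.
apply: ler_wpM2l => //; apply: lerD.
  by apply: ler_wpM2l; [rewrite divr_ge0 ?ler0n|apply: h2; apply/eqP].
apply: ler_sum => J /andP[_ /eqP HJ]; apply: h3; first exact/eqP.
by rewrite HJ; apply: leq_trans uphalf_lt_d _; exact: leq_pred.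
Qed.

Section Weight.
Variable phi : nat -> R.
Hypothesis phi0 : phi 0 = 1.
Hypothesis phi_ge0 : forall k, 0 <= phi k.

Let rest f j := \prod_(i | i != j) phi (f i).

(** The bins of [D] other than [j] had no demand, hence weight [phi 0 = 1], and nothing is lost when
    they receive one. *)
Lemma prod_weight_spawn f j (D : {set 'I_n}) : D :&: supp f = [set j] ->
  prod_weight phi (spawn f j D) = phi (f j).-1 ^+ #|D| * rest f j.
Proof.
move=> Dj; rewrite -prodr_const /rest [in RHS]big_mkcond [X in _ * X]big_mkcond -big_split /=.
apply: eq_bigr => i _; rewrite /spawn; case: ifP => iD; case: eqP => [ij|/eqP ij] /=;
  rewrite ?mulr1 ?mul1r //.
  have : i \notin D :&: supp f by rewrite Dj inE.
  by rewrite !inE iD /= negbK => /eqP ->; rewrite phi0 mulr1.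
have : j \in D :&: supp f by rewrite Dj inE.
by rewrite inE -ij iD.
Qed.

Lemma prod_weight_dec1 f j : f j = 1%N -> prod_weight phi (dec f j) = rest f j.
Proof.
move=> fj; rewrite /prod_weight (bigD1 j) //= /dec eqxx fj phi0 mul1r.
by apply: eq_bigr => i /negbTE ->.
Qed.

Lemma prod_weight_addone f j (J : {set 'I_n}) : j \notin J -> J :&: supp f = set0 ->
  prod_weight phi (addone f j J) = phi 1 ^+ #|J| * rest f j.
Proof.
move=> jJ Jf; rewrite -prodr_const /rest [in RHS]big_mkcond [X in _ * X]big_mkcond -big_split /=.
apply: eq_bigr => i _; rewrite /addone; case: eqP => [->|_] /=.
  by rewrite (negbTE jJ) phi0 mulr1.
case: ifP => iJ; last by rewrite mul1r.
have : i \notin J :&: supp f by rewrite Jf inE.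
by rewrite !inE iJ /= negbK => /eqP ->; rewrite phi0 mulr1.
Qed.

Lemma prod_weight_dec Gam f j : (0 < f j)%N -> phi (f j).-1 <= Gam * phi (f j) ->
  prod_weight phi (dec f j) <= Gam * prod_weight phi f.
Proof.
move=> fj h; rewrite /prod_weight (bigD1 j) //= (bigD1 (F := fun i => phi (f i)) j) //=.
rewrite /dec eqxx mulrA; have -> : \prod_(i | i != j) phi (if i == j then (f j).-1 else f i) = rest f j.
  by apply: eq_bigr => i /negbTE ->.
by apply: ler_wpM2r => //; apply: prodr_ge0 => i _.
Qed.

Lemma prod_weight_ge0 f : 0 <= prod_weight phi f.
Proof. by apply: prodr_ge0. Qed.

(** The weight of the bins other than [j] factors out of every term, which reduces the supersolution
    property to one bin. The binomial counts the subsets [J] of [D :\ j]. *)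
Lemma spawn_sum_weight q f pd : choice_law d q ->
  (forall j, \sum_(D : {set 'I_n} | j \in D) q D <= pd) ->
  spawn_sum d q f (prod_weight phi) <=
  \sum_(j | f j != 0%N) (pd * (if f j == 1%N then
      2 / d%:R + 'C(d.-1, uphalf d)%:R * phi 1 ^+ uphalf d
    else phi (f j).-1 ^+ d)) * rest f j.
Proof.
move=> [q0 _ qd] hpd.
have rest0 j : 0 <= rest f j by apply: prodr_ge0.
have sumD j (c : {set 'I_n} -> R) e : 0 <= e ->
    (forall D, D :&: supp f = [set j] -> q D != 0 -> c D <= e) ->
    \sum_(D | D :&: supp f == [set j]) q D * c D <= pd * e.
  move=> e0 ce; apply: le_trans (ler_wpM2r e0 (hpd j)).
  rewrite mulr_suml big_mkcond [X in _ <= X]big_mkcond; apply: ler_sum => D _.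
  case: ifP => [/eqP Dj|_]; last by case: ifP => // _; rewrite mulr_ge0.
  have -> : j \in D by have := set11 j; rewrite -Dj inE => /andP[].
  have [->|qD] := eqVneq (q D) 0; first by rewrite !mul0r.
  by apply: ler_wpM2l => //; exact: ce.
rewrite (bigID (fun j => f j == 1%N)) /= addrC; apply: lerD.
  rewrite [X in _ <= X](eq_bigl (fun j => 1 < f j)%N); last by move=> j; case: (f j) => [|[]].
  apply: ler_sum => j fj; rewrite ifF; last by apply/eqP; lia.
  rewrite -mulrA; apply: (sumD j (fun D => prod_weight phi (spawn f j D))).
    by rewrite mulr_ge0 ?exprn_ge0.
  by move=> D Dj qD; rewrite prod_weight_spawn // qd.
rewrite [X in _ <= X](eq_bigl (fun j => f j == 1%N)); last by move=> j; case: (f j) => [|[]].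
apply: ler_sum => j /eqP fj; rewrite fj /= -[X in _ <= X]mulrA.
apply: (sumD j (fun D => 2 / d%:R * prod_weight phi (dec f j)
         + \sum_(J : {set 'I_n} | (J \subset D :\ j) && (#|J| == uphalf d))
             prod_weight phi (addone f j J))).
  by rewrite mulr_ge0 // addr_ge0 ?mulr_ge0 ?invr_ge0 ?exprn_ge0 ?ler0n.
move=> D Dj qD; rewrite prod_weight_dec1 // [X in _ <= X]mulrDl lerD2l.
have jD : j \in D by have := set11 j; rewrite -Dj inE => /andP[].
rewrite (eq_bigr (fun=> phi 1 ^+ uphalf d * rest f j)); last first.
  move=> J /andP[JD /eqP cJ]; rewrite prod_weight_addone ?cJ //.
    by apply/negP => /(subsetP JD); rewrite !inE eqxx.
  apply/setP => i; rewrite !inE; apply/negP => /andP[/(subsetP JD)].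
  rewrite !inE => /andP[ij iD] fi; have : i \in D :&: supp f by rewrite !inE iD.
  by rewrite Dj inE (negbTE ij).
have -> : d.-1 = #|D :\ j| by rewrite -(qd _ qD) (cardsD1 j D) jD.
by rewrite sumr_const -cards_draws cardsE -[X in X <= _]mulr_natl mulrA.
Qed.

End Weight.

(** The factor 2 is reserved for the prefactor [G <= 2] of the comparison below. *)
Lemma spawn_sum_level_weight K T pd Gam phi q f t : (t < T)%N -> 0 <= pd ->
  level_weight d K T pd Gam phi -> choice_law d q ->
  (forall j, \sum_(D : {set 'I_n} | j \in D) q D <= pd) ->
  (forall i, (f i <= K)%N) ->
  2 * spawn_sum d q f (prod_weight (phi t))
    <= prod_weight (phi t.+1) f - prod_weight (phi t) f.
Proof.
move=> tT pd0 [h0 hge hmono _ hhigh hone] hq hpd fK.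
have := spawn_sum_weight (h0 t) (hge t) f hq hpd.
have := @prodD_ge R n (fun i => phi t (f i)) (fun i => phi t.+1 (f i) - phi t (f i))
  (fun j => f j != 0%N) (fun i => hge t _) (fun i => ltac:(by rewrite subr_ge0)).
have -> : \prod_i (phi t (f i) + (phi t.+1 (f i) - phi t (f i))) = prod_weight (phi t.+1) f.
  by apply: eq_bigr => i _; rewrite addrC subrK.
rewrite -/(prod_weight (phi t) f).
rewrite -lerBrDl => /(le_trans _) h h'; apply: h.
apply: le_trans (ler_wpM2l _ h') _ => //; rewrite mulr_sumr; apply: ler_sum => j fj.
rewrite !mulrA; apply: ler_wpM2r; first by apply: prodr_ge0 => i _.
case: eqP => fj1; first by rewrite fj1; exact: hone.
have -> : f j = (f j).-1.+1 by rewrite prednK // lt0n.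
by rewrite /=; apply: hhigh => //; have := fK j; move/eqP: fj; lia.
Qed.

End LevelWeight.

Section Comparison.
Variables (R : realFieldType) (n d : nat).
Hypothesis d2 : (1 < d)%N.
Implicit Types (q : {set 'I_n} -> R) (f : 'I_n -> nat).
Implicit Types (phi sig : nat -> nat -> R).

Let d0 : (0 < d)%N. Proof. exact: ltnW. Qed.

Lemma card_supp f : (#|supp f| <= cnt1 f + high_mass d f)%N.
Proof.
have -> : supp f = [set i | f i == 1%N] :|: [set i | (1 < f i)%N].
  by apply/setP => i; rewrite !inE; case: (f i) => [|[]].
apply: leq_trans (leq_card_setU _ _) _; rewrite leq_add2l -sum1_card /high_mass.
rewrite (eq_bigl (fun i => 1 < f i)%N) => [|i]; last by rewrite inE.
by apply: leq_sum => i _; rewrite expn_gt0 d0.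
Qed.

Lemma high_mass_dec f j : (high_mass d (dec f j) <= high_mass d f)%N.
Proof.
rewrite /high_mass big_mkcond [X in (_ <= X)%N]big_mkcond; apply: leq_sum => i _.
rewrite /dec; case: eqP => [->|_] //.
case: ifP => h; last by case: ifP.
by rewrite ifT ?leq_pexp2l ?leq_pred //; lia.
Qed.

Lemma cnt1_dec f j : (cnt1 (dec f j) <= cnt1 f + 1)%N.
Proof.
rewrite /cnt1 -(cards1 j); apply: leq_trans (leq_card_setU _ _).
apply: subset_leq_card; apply/subsetP => i; rewrite !inE /dec.
by case: (i =P j) => _; rewrite ?orbT ?orbF.
Qed.

Lemma high_mass_spawn f j (D : {set 'I_n}) : (1 < f j)%N -> D :&: supp f = [set j] ->
  #|D| = d -> (high_mass d (spawn f j D) <= high_mass d f)%N.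
Proof.
move=> fj Dj cD; have jD : j \in D by have := set11 j; rewrite -Dj inE => /andP[].
rewrite /high_mass [X in (_ <= X)%N](bigD1 j) //= (bigID (fun i => i \in D)) /=; apply: leq_add.
  apply: (@leq_trans (\sum_(i in D) d ^ (f j).-1)%N).
    rewrite big_mkcond [X in (_ <= X)%N]big_mkcond; apply: leq_sum => i _.
    by rewrite /spawn; case: (i \in D); rewrite ?andbF ?andbT //; case: ifP.
  by rewrite sum_nat_const cD -expnS prednK //; lia.
rewrite big_mkcond [X in (_ <= X)%N]big_mkcond; apply: leq_sum => i _.
rewrite /spawn; case iD: (i \in D); rewrite /= ?andbF ?andbT //.
by case: ifP => // fi; rewrite ifT //=; apply: contraFneq iD => ->.
Qed.

Lemma cnt1_spawn f j (D : {set 'I_n}) : (cnt1 (spawn f j D) <= cnt1 f + #|D|)%N.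
Proof.
apply: leq_trans (leq_card_setU _ _).
apply: subset_leq_card; apply/subsetP => i; rewrite !inE /spawn.
by case: (i \in D); rewrite ?orbT ?orbF.
Qed.

Lemma high_mass_addone f j (J : {set 'I_n}) :
  (high_mass d (addone f j J) <= high_mass d f)%N.
Proof.
rewrite /high_mass big_mkcond [X in (_ <= X)%N]big_mkcond; apply: leq_sum => i _.
by rewrite /addone; case: (i =P j) => //= _; case: (i \in J).
Qed.

Lemma cnt1_addone f j (J : {set 'I_n}) : (cnt1 (addone f j J) <= cnt1 f + #|J|)%N.
Proof.
apply: leq_trans (leq_card_setU _ _).
apply: subset_leq_card; apply/subsetP => i; rewrite !inE /addone.
by case: (i =P j) => // _; case: (i \in J); rewrite ?orbT ?orbF.
Qed.

(* [phi] dominates [F] initially and [sig] covers the demands with too many bins of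
   level one, at the tiny price [zeta]; conflicts are absorbed in the growing
   factor [G], which never exceeds [1 + g]. *)
Section Main.
Variables (q : nat -> {set 'I_n} -> R) (F : nat -> ('I_n -> nat) -> R).
Variables (K T B Lam : nat) (pd Gam rho g zeta : R) (phi sig : nat -> nat -> R).
Hypothesis (sysF : upper_system d q F).
Hypothesis (pd_ge0 : 0 <= pd) (Gam_ge0 : 0 <= Gam) (zeta_ge0 : 0 <= zeta) (rho_ge0 : 0 <= rho).
Hypothesis (hpd : forall t j, \sum_(D : {set 'I_n} | j \in D) q t D <= pd).
Hypothesis (hrho : forall j l, j != l ->
  \sum_(t < T) \sum_(D : {set 'I_n} | (j \in D) && (l \in D)) q t D <= rho).
Hypothesis (hg : 2 * Gam * (Lam + d + B)%:R ^+ 2 * rho <= g) (g1 : g <= 1).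
Hypothesis (hphi : level_weight d K T pd Gam phi).
Hypothesis (hsig : level_weight d K T pd Gam sig).

Let P t f := prod_weight (phi t) f + zeta * prod_weight (sig t) f.

Hypothesis start : forall f, (forall i, (f i <= K)%N) -> (high_mass d f <= B)%N ->
  (cnt1 f <= Lam + d)%N -> F 0 f <= P 0 f.
Hypothesis boundary : forall t f, (t <= T)%N -> (forall i, (f i <= K)%N) ->
  (high_mass d f <= B)%N -> (Lam < cnt1 f <= Lam + d)%N ->
  F t f <= zeta * prod_weight (sig t) f.

(** Records the conflicts of [f] alone. Derived demands are estimated with the uniform bound 2, so
    [G] is never compared between different demands. *)
Let G t f : R := 1 + 2 * Gam * \sum_(tau < t) \sum_(j in supp f) conflict (q tau) f j.

Let q0 t D : 0 <= q t D. Proof. by case: (us_law sysF t). Qed.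

Let conf0 t f j : 0 <= conflict (q t) f j.
Proof. exact: conflict_ge0. Qed.

Let G1 t f : 1 <= G t f.
Proof.
rewrite lerDl mulr_ge0 ?mulr_ge0 ?ler0n // sumr_ge0 // => tau _; exact: sumr_ge0.
Qed.

(** The support has at most [Lam + d + B] bins, and each ordered pair of them meets with total
    probability at most [rho]. *)
Let G2 t f : (t <= T)%N -> (cnt1 f <= Lam + d)%N -> (high_mass d f <= B)%N ->
  G t f <= 1 + g.
Proof.
move=> tT c1 hB; rewrite /G lerD2l; apply: le_trans hg.
rewrite -[X in _ <= X]mulrA; apply: ler_wpM2l; first by rewrite mulr_ge0 ?ler0n.
rewrite exchange_big /=.
apply: (@le_trans _ _ (\sum_(j in supp f) \sum_(l in supp f) rho)).
  apply: ler_sum => j jf; rewrite /conflict exchange_big /= big_mkcondr /=.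
  apply: ler_sum => l lf; case: ifP => // lj.
  apply: le_trans (hrho (j := j) (l := l) _); last by rewrite eq_sym.
  rewrite -(subnKC tT) big_split_ord /= lerDl.
  by apply: sumr_ge0 => tau _; apply: sumr_ge0.
rewrite !sumr_const -mulrnA -[X in X <= _]mulr_natl; apply: ler_wpM2r => //.
rewrite -natrX ler_nat -mulnn leq_mul //;
  by apply: leq_trans (card_supp f) _; rewrite leq_add.
Qed.

Let P0 t f : 0 <= P t f.
Proof. by rewrite addr_ge0 ?mulr_ge0 ?prod_weight_ge0 //; [case: hphi|case: hsig]. Qed.

Let Pmono t f : P t f <= P t.+1 f.
Proof.
have mono phi' : level_weight d K T pd Gam phi' ->
    prod_weight (phi' t) f <= prod_weight (phi' t.+1) f.
  by move=> [_ hge hm _ _ _]; apply: ler_prod => i _; rewrite hge hm.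
by apply: lerD; [exact: mono|apply: ler_wpM2l => //; exact: mono].
Qed.

Let Pdec t f j : (t <= T)%N -> (f j <= K)%N -> (0 < f j)%N -> P t (dec f j) <= Gam * P t f.
Proof.
move=> tT fK fj.
have H phi' : level_weight d K T pd Gam phi' ->
    prod_weight (phi' t) (dec f j) <= Gam * prod_weight (phi' t) f.
  move=> [_ hge _ hr _ _]; apply: prod_weight_dec => //.
  by rewrite -[in X in _ <= _ * X](prednK fj) hr // prednK.
by rewrite /P mulrDr mulrCA; apply: lerD; [exact: H|apply: ler_wpM2l => //; exact: H].
Qed.

Let comparison_aux t f : (t <= T)%N -> (forall i, (f i <= K)%N) ->
  (high_mass d f <= B)%N -> (cnt1 f <= Lam + d)%N -> F t f <= G t f * P t f.
Proof.
elim: t f => [|t IH] f tT fK fB f1.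
  by rewrite /G big_ord0 mulr0 addr0 mul1r; apply: start.
(* One round adds at most [d] demands of level one: up to the cutoff [Lam] every derived demand
   stays within [Lam + d], and beyond it [boundary] takes over. *)
have [Lf|fL] := ltnP Lam (cnt1 f).
  apply: le_trans (boundary tT fK fB _) _; first by rewrite Lf.
  apply: (@le_trans _ _ (P t.+1 f)).
    by rewrite lerDr prod_weight_ge0 //; case: hphi.
  by rewrite ler_peMl.
have tT' : (t <= T)%N by exact: ltnW.
have F2 f' : (forall i, (f' i <= K)%N) -> (high_mass d f' <= B)%N ->
    (cnt1 f' <= Lam + d)%N -> F t f' <= 2 * P t f'.
  move=> h1 h2 h3; apply: le_trans (IH _ tT' h1 h2 h3) _; apply: ler_wpM2r => //.
  by apply: le_trans (G2 tT' h3 h2) _; rewrite -[2]/(1 + 1) lerD2l.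
have decK j i : (dec f j i <= K)%N.
  by rewrite /dec; case: eqP => // _; apply: leq_trans (leq_pred _) _.
have dec1 j : (cnt1 (dec f j) <= Lam + d)%N.
  by apply: leq_trans (cnt1_dec f j) _; rewrite leq_add.
have decB j : (high_mass d (dec f j) <= B)%N := leq_trans (high_mass_dec f j) fB.
apply: le_trans (us_rec sysF t f) _.
have H1 : F t f <= G t f * P t f by apply: IH.
(* Lowering one demand costs at most [2 * Gam] times the weight of [f], exactly what the increment
   of [G] provides. *)
have H2 : \sum_(j in supp f) conflict (q t) f j * F t (dec f j) <=
    (G t.+1 f - G t f) * P t f.
  have -> : G t.+1 f - G t f = 2 * Gam * \sum_(j in supp f) conflict (q t) f j.
    by rewrite /G big_ord_recr /= mulrDr; ring.
  rewrite -mulrA mulrC !mulr_suml; apply: ler_sum => j; rewrite inE => jf.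
  rewrite -mulrA; apply: ler_wpM2l => //; apply: le_trans (F2 _ _ _ _) _ => //.
  by rewrite [P t f * _]mulrC -mulrA ler_pM2l // Pdec // lt0n.
have H3 : spawn_sum d (q t) f (F t) <= P t.+1 f - P t f.
  apply: (@le_trans _ _ (2 * spawn_sum d (q t) f (P t))).
    rewrite -spawn_sumZ; apply: (spawn_sum_le d2 (us_law sysF t)).
    - move=> j D fj Dj cD; apply: F2.
      + by move=> i; rewrite /spawn; case: ifP => // _; apply: leq_trans (leq_pred _) _.
      + exact: leq_trans (high_mass_spawn fj Dj cD) fB.
      + by apply: leq_trans (cnt1_spawn f j D) _; rewrite cD leq_add.
    - by move=> j fj; apply: F2.
    - move=> j J fj cJ; apply: F2.
      + move=> i; rewrite /addone; case: eqP => // _; case: ifP => // _.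
        by rewrite -fj.
      + exact: leq_trans (high_mass_addone f j J) fB.
      + by apply: leq_trans (cnt1_addone f j J) _; rewrite leq_add.
  rewrite /P spawn_sumD spawn_sumZ mulrDr mulrCA.
  have := spawn_sum_level_weight d2 tT pd_ge0 hphi (us_law sysF t) (hpd t) fK.
  have := spawn_sum_level_weight d2 tT pd_ge0 hsig (us_law sysF t) (hpd t) fK.
  move=> /(ler_wpM2l zeta_ge0); rewrite mulrBr; lra.
have H4 : P t.+1 f - P t f <= G t.+1 f * (P t.+1 f - P t f).
  by rewrite ler_peMl // subr_ge0.
have := lerD (lerD H1 H2) (le_trans H3 H4); move/le_trans; apply.
rewrite le_eqVlt; apply/orP; left; apply/eqP; ring.
Qed.

Lemma supersolution_bound t f : (t <= T)%N -> (forall i, (f i <= K)%N) ->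
  (high_mass d f <= B)%N -> (cnt1 f <= Lam + d)%N ->
  F t f <= (1 + g) * (prod_weight (phi t) f + zeta * prod_weight (sig t) f).
Proof.
move=> tT fK fB f1; apply: le_trans (comparison_aux tT fK fB f1) _.
by apply: ler_wpM2r; [exact: P0|exact: G2].
Qed.

End Main.
End Comparison.

(** * Demands of level one *)

Lemma exprD_ge (R : realFieldType) (x e : R) c : 0 <= x -> 0 <= e ->
  x ^+ c + c%:R * e * x ^+ c.-1 <= (x + e) ^+ c.
Proof.
move=> x0 e0; elim: c => [|c IH]; first by rewrite !mul0r addr0.
rewrite [X in _ <= X]exprS; apply: le_trans (ler_wpM2l _ IH); last exact: addr_ge0.
case: c {IH} => [|c] /=; first by rewrite expr1 !expr0 mul1r !mul0r mulr1 addr0 mulr1.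
rewrite !exprS -[in X in X <= _]natr1 -subr_ge0.
set y := x ^+ c; set k : R := c.+1%:R.
have -> : (x + e) * (x * y + k * e * y) - (x * (x * y) + (k + 1) * e * (x * y)) = k * e ^+ 2 * y.
  ring.
by rewrite mulr_ge0 ?exprn_ge0 // mulr_ge0 ?exprn_ge0 ?ler0n.
Qed.

Lemma bin_le_exp2 a k : ('C(a, k) <= 2 ^ a)%N.
Proof.
elim: a k => [|a IH] [|k]; rewrite ?bin0 ?bin0n ?expn_gt0 //.
by rewrite binS expnS mul2n -addnn leq_add.
Qed.

(** The tie term gives [4 * b]. With [h = uphalf d], [d <= 2 * h] and [y <= 1 / 16], the subset term
    is at most [b] times [2 * h * 4 ^ h / 16 ^ h <= 1]. *)
Lemma half_spawn_slope (R : realFieldType) d (b y : R) : (1 < d)%N -> 0 <= b ->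
  0 <= y <= 1 / 16 ->
  2 * (b * d%:R) * (2 / d%:R + 'C(d.-1, uphalf d)%:R * y ^+ uphalf d) <= 5 * b.
Proof.
move=> d2 b0 /andP[y0 y1]; set h := uphalf d.
have dn0 : d%:R != 0 :> R by rewrite pnatr_eq0; lia.
have h1 : (0 < h)%N by rewrite /h uphalf_half; have := odd_double_half d; lia.
have dh : (d <= 2 * h)%N by rewrite /h uphalf_half; have := odd_double_half d; lia.
have H : d%:R * 'C(d.-1, h)%:R * y ^+ h * 2 <= 1.
  have hy : y ^+ h <= (1 / 16) ^+ h by rewrite lerXn2r ?nnegrE // ler_pdivlMr // mul0r.
  apply: (@le_trans _ _ (d%:R * 'C(d.-1, h)%:R * (1 / 16) ^+ h * 2)).
    by apply: ler_wpM2r => //; apply: ler_wpM2l => //; rewrite mulr_ge0.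
  rewrite expr_div_n expr1n mul1r -mulrA [_^-1 * _]mulrC mulrA ler_pdivrMr ?exprn_gt0 // mul1r.
  rewrite -natrX -!natrM ler_nat.
  apply: (@leq_trans (2 * h * 2 ^ (2 * h - 1) * 2)).
    rewrite !leq_mul //; apply: leq_trans (bin_le_exp2 _ _) _; rewrite leq_exp2l //; lia.
  have -> : (2 * h * 2 ^ (2 * h - 1) * 2 = 2 * h * 4 ^ h)%N.
    by rewrite -mulnA -expnSr subn1 prednK ?muln_gt0 // expnM.
  rewrite (_ : 16 = 4 * 4)%N // expnMn leq_mul2r; apply/orP; right.
  by elim: (h) => // k IH; rewrite expnS; have := expn_gt0 4 k; lia.
have -> : 2 * (b * d%:R) * (2 / d%:R + 'C(d.-1, h)%:R * y ^+ h) =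
   4 * b + b * (d%:R * 'C(d.-1, h)%:R * y ^+ h * 2) by field.
have : b * (d%:R * 'C(d.-1, h)%:R * y ^+ h * 2) <= b * 1 by apply: ler_wpM2l.
lra.
Qed.

Definition lin_weight (R : realFieldType) (v b : R) (t k : nat) : R :=
  if k == 0%N then 1 else v + 5 * b * t%:R.

Section LevelOne.
Variables (R : realFieldType) (n d : nat).
Hypothesis d2 : (1 < d)%N.
Implicit Types (q : nat -> {set 'I_n} -> R) (F : nat -> ('I_n -> nat) -> R).
Implicit Types (f : 'I_n -> nat).

Lemma prod_weight01 (phi : nat -> R) f : phi 0 = 1 -> (forall i, (f i <= 1)%N) ->
  prod_weight phi f = phi 1 ^+ cnt1 f.
Proof.
move=> p0 f1; rewrite /cnt1 -prodr_const big_mkcond; apply: eq_bigr => i _.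
by rewrite inE; have := f1 i; case: (f i) => [|[]].
Qed.

Lemma supp01 f : (forall i, (f i <= 1)%N) -> supp f = [set i | f i == 1%N].
Proof. by move=> f1; apply/setP => i; rewrite !inE; have := f1 i; case: (f i) => [|[]]. Qed.

Lemma high_mass01 f : (forall i, (f i <= 1)%N) -> high_mass d f = 0%N.
Proof. by move=> f1; rewrite /high_mass big_pred0 // => i; rewrite ltnNge f1. Qed.

Lemma dec01 f j : (forall i, (f i <= 1)%N) -> (forall i, (dec f j i <= 1)%N).
Proof.
by move=> f1 i; rewrite /dec; case: eqP => // _; apply: leq_trans (leq_pred _) _.
Qed.

Lemma cnt1_dec01 f j : (forall i, (f i <= 1)%N) -> j \in supp f ->
  cnt1 (dec f j) = (cnt1 f).-1.
Proof.
move=> f1; rewrite supp01 // inE => fj; rewrite /cnt1 (cardsD1 j [set i | f i == 1%N]) inE fj /=.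
apply: eq_card => i; rewrite !inE /dec; case: (i =P j) => //= _.
by rewrite (eqP fj).
Qed.

(** By [exprD_ge] the power with exponent [c] gains at least [c * pd] times the power with exponent
    [c.-1] per round, as the crude recursion with [c] demanded bins asks for. *)
Lemma crude_growth q F (v pd : R) L w : upper_system d q F -> 0 <= v -> 0 <= pd ->
  (forall t j, \sum_(D : {set 'I_n} | j \in D) q t D <= pd) ->
  (forall f, (forall i, (f i <= 1)%N) -> (cnt1 f <= L)%N -> F 0 f <= v ^+ cnt1 f) ->
  forall t f, (t <= w)%N -> (forall i, (f i <= 1)%N) -> (cnt1 f <= L)%N ->
  F t f <= (v + pd * t%:R) ^+ cnt1 f.
Proof.
move=> sysF v0 pd0 hpd st; elim=> [|t IH] f tw f1 fL.
  by rewrite mulr0 addr0; apply: st.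
apply: le_trans (us_crude sysF t f) _.
have x0 : 0 <= v + pd * t%:R by rewrite addr_ge0 ?mulr_ge0 ?ler0n.
rewrite -natr1 mulrDr mulr1 addrA.
apply: le_trans (exprD_ge (cnt1 f) x0 pd0); apply: lerD; first exact: IH (ltnW tw) f1 fL.
have cE : cnt1 f = #|supp f| by rewrite supp01.
rewrite -mulrA {1}cE mulr_natl -sumr_const; apply: ler_sum => j jf.
apply: ler_pM => //; first by apply: sumr_ge0 => D _; case: (us_law sysF t).
  exact: us_ge0 sysF _ _.
rewrite -(cnt1_dec01 f1 jf); apply: IH; first exact: ltnW.
  exact: dec01.
by rewrite cnt1_dec01 //; apply: leq_trans (leq_pred _) _.
Qed.

Lemma lin_level_weight (v b : R) w (Gam : R) : 0 <= b -> 0 <= v -> 1 <= Gam * v ->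
  v + 5 * b * w%:R <= 1 / 16 -> level_weight d 1 w (b * d%:R) Gam (lin_weight v b).
Proof.
move=> b0 v0 Gv vw.
have x0 t : 0 <= v + 5 * b * t%:R by rewrite addr_ge0 ?mulr_ge0 ?ler0n.
have xm t t' : (t <= t')%N -> v + 5 * b * t%:R <= v + 5 * b * t'%:R.
  by move=> tt; rewrite lerD2l ler_wpM2l ?mulr_ge0 ?ler_nat.
split=> //.
- by move=> t k; rewrite /lin_weight; case: eqP.
- by move=> t k; rewrite /lin_weight; case: eqP => // _; apply: xm.
- move=> t [|k] // _ _; rewrite /lin_weight /=; apply: (le_trans Gv).
  have G0 : 0 <= Gam.
    rewrite leNgt; apply/negP => /ltW G0.
    by have := le_trans Gv (mulr_le0_ge0 G0 v0); rewrite ler10.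
  by rewrite ler_wpM2l // lerDl !mulr_ge0 ?ler0n.
- by move=> t [].
- move=> t tw; rewrite /lin_weight /=.
  have -> : v + 5 * b * t.+1%:R - (v + 5 * b * t%:R) = 5 * b by rewrite -natr1; ring.
  by apply: half_spawn_slope => //; rewrite x0 (le_trans (xm _ _ (ltnW tw))).
Qed.

End LevelOne.

(* Over a window short enough that a given bin is chosen with probability at most
   1/128, the crude recursion bounds the demands with many bins; feeding this into
   [supersolution_bound] gives the correct slope [5 b w] for those with fewer bins. *)
Lemma level_one_window (R : realFieldType) n d (q : nat -> {set 'I_n} -> R)
    (F : nat -> ('I_n -> nat) -> R) (v b rho : R) L0 L1 w (del : R) :
  (1 < d)%N -> upper_system d q F ->
  0 <= b -> (forall t j, \sum_(D : {set 'I_n} | j \in D) q t D <= b * d%:R) ->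
  0 <= rho -> (forall j l, j != l ->
  \sum_(t < w) \sum_(D : {set 'I_n} | (j \in D) && (l \in D)) q t D <= rho) ->
  (d <= L0)%N -> (L1 <= L0)%N -> 1 / 256 <= v <= 1 / 128 -> b * d%:R * w%:R <= 1 / 128 ->
  512 * L0%:R ^+ 2 * rho <= del -> del <= 1 -> 4 * 256 ^+ L1 <= del * 2 ^+ (L0 - d) ->
  (forall f, (forall i, (f i <= 1)%N) -> (cnt1 f <= L0)%N -> F 0 f <= v ^+ cnt1 f) ->
  forall t f, (t <= w)%N -> (forall i, (f i <= 1)%N) -> (cnt1 f <= L1)%N ->
  F t f <= (v + 5 * b * w%:R + del) ^+ cnt1 f.
Proof.
move=> d2 sysF b0 hpd rho0 hrho dL L10 /andP[v0 v1] bw hdel del1 hdel2 st t f tw f1 fL.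
have [c0|c0] := posnP (cnt1 f); first by rewrite c0 expr0; apply: us_le1 sysF _ _.
have d2R : 2 <= d%:R :> R by rewrite (ler_nat _ 2 d).
have w0 : 0 <= w%:R :> R by rewrite ler0n.
have bw5 : 5 * b * w%:R <= 1 / 32.
  have : b * w%:R * 2 <= b * w%:R * d%:R by rewrite ler_wpM2l ?mulr_ge0.
  by move: bw; rewrite mulrAC; clear; lra.
(* The initial weight and the crude growth contribute at most 1/128 each. *)
have crude t' f' : (t' <= w)%N -> (forall i, (f' i <= 1)%N) -> (cnt1 f' <= L0)%N ->
    F t' f' <= (1 / 64) ^+ cnt1 f'.
  move=> t'w f1' fL'.
  have v00 : 0 <= v by clear -v0; lra.
  have pd0 : 0 <= b * d%:R by rewrite mulr_ge0 ?ler0n.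
  apply: le_trans (crude_growth sysF v00 pd0 hpd st t'w f1' fL') _.
  have h : b * d%:R * t'%:R <= b * d%:R * w%:R by rewrite ler_wpM2l ?ler_nat.
  have h0 : 0 <= b * d%:R * t'%:R by rewrite mulr_ge0 ?ler0n.
  by rewrite lerXn2r ?nnegrE //; clear -h h0 v0 v1 bw; lra.
have del0 : 0 <= del by apply: le_trans hdel; rewrite !mulr_ge0 ?exprn_ge0 ?ler0n.
have lwv : level_weight d 1 w (b * d%:R) 256 (lin_weight v b).
  by apply: (lin_level_weight d2) => //; clear -v0 v1 bw5; lra.
have lws : level_weight d 1 w (b * d%:R) 256 (lin_weight (1 / 32) b).
  by apply: (lin_level_weight d2) => //; clear -bw5; lra.
have z0 : 0 <= (1 / 2) ^+ (L0 - d) :> R by rewrite exprn_ge0 // divr_ge0.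
have fB (f' : 'I_n -> nat) : (forall i, (f' i <= 1)%N) -> (high_mass d f' <= 0)%N.
  by move=> h; rewrite high_mass01.
(* Boundary demands use [1 / 64 = 1 / 2 * (1 / 32)]: with more than [L0 - d] bins the powers of
   [1 / 2] are at most [zeta]. The price 256 comes from [v >= 1 / 256]. *)
have cmp := @supersolution_bound R n d d2 q F 1 w 0 (L0 - d) (b * d%:R) 256 rho del _
  (lin_weight v b) (lin_weight (1 / 32) b) sysF _ _ z0 rho0 hpd hrho _ del1 lwv lws _ _ t f tw f1 (fB _ f1) _.
have {cmp} : F t f <= (1 + del) * (prod_weight (lin_weight v b t) f +
    (1 / 2) ^+ (L0 - d) * prod_weight (lin_weight (1 / 32) b t) f).
  apply: cmp.
  - by rewrite mulr_ge0 ?ler0n.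
  - by rewrite ler0n.
  - by rewrite addn0 subnK //; apply: le_trans hdel; rewrite -natrM.
  - move=> f' h _ hL; rewrite subnK // in hL.
    apply: le_trans (st _ h hL) _; rewrite prod_weight01 // /lin_weight /= mulr0 addr0.
    by rewrite lerDl mulr_ge0 // prod_weight_ge0 // => k; case: eqP => // _; clear; lra.
  - move=> t' f' t'w h _ /andP[hL]; rewrite subnK // => hL'.
    apply: le_trans (crude _ _ t'w h hL') _; rewrite prod_weight01 // /lin_weight /=.
    apply: (@le_trans _ _ ((1 / 2) ^+ cnt1 f' * (1 / 32) ^+ cnt1 f')).
      rewrite -exprMn le_eqVlt; apply/orP; left; apply/eqP; congr (_ ^+ _); by field.
    apply: ler_pM; rewrite ?exprn_ge0 ?divr_ge0 //.
      by apply: ler_wiXn2l (ltnW hL); clear; lra.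
    have h0 : 0 <= 5 * b * t'%:R by rewrite !mulr_ge0 ?ler0n.
    by apply: lerXn2r; rewrite ?nnegrE; clear -h0; lra.
  - by rewrite subnK //; apply: leq_trans fL _.
rewrite !prod_weight01 // /lin_weight /= => /le_trans; apply.
set y := v + 5 * b * w%:R.
have tw' : 5 * b * t%:R <= 5 * b * w%:R by rewrite ler_wpM2l ?mulr_ge0 ?ler_nat.
have t0' : 0 <= 5 * b * t%:R by rewrite !mulr_ge0 ?ler0n.
have yv : v + 5 * b * t%:R <= y by rewrite lerD2l.
have y0 : 1 / 256 <= y by rewrite /y; clear -v0 tw' t0'; lra.
have y0' : 0 <= y by clear -y0; lra.
have y1 : y <= 1 / 2 by rewrite /y; clear -v1 bw5; lra.
set c := cnt1 f in c0 fL *.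
have e1 : (v + 5 * b * t%:R) ^+ c <= y ^+ c by rewrite lerXn2r ?nnegrE //; clear -yv v0 t0' y0'; lra.
have e2 : (1 / 32 + 5 * b * t%:R) ^+ c <= 1 by rewrite exprn_ile1 //; clear -t0' tw' bw5; lra.
(* Multiplicative errors become an additive [del] per bin: the first-order term
   [c * del * y ^+ c.-1] absorbs [del * y ^+ c] and, as [y >= 1 / 256] and [c <= L1], also the
   boundary term. *)
apply: le_trans (exprD_ge c y0' del0).
set Y := y ^+ c.-1.
have Yc : y ^+ c = y * Y by rewrite /Y -exprS prednK.
have Y0 : 256 ^- L1 <= Y.
  rewrite -exprVn; apply: (@le_trans _ _ ((256^-1) ^+ c.-1)).
    apply: ler_wiXn2l; [by rewrite invr_ge0 ler0n|by rewrite invf_le1 ?ler1n ?ltr0n|].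
  exact: leq_trans (leq_pred c) fL.
  by rewrite lerXn2r ?nnegrE //; clear -y0 y0'; lra.
have E : 4 * (1 / 2) ^+ (L0 - d) <= del * Y.
  apply: le_trans (ler_wpM2l del0 Y0); rewrite expr_div_n expr1n mulrA mulr1.
  by rewrite ler_pdivrMr ?exprn_gt0 // mulrAC ler_pdivlMr ?exprn_gt0.
have c1 : 1 <= c%:R :> R by rewrite ler1n.
have h1 : (1 + del) * ((v + 5 * b * t%:R) ^+ c + (1 / 2) ^+ (L0 - d) * (1 / 32 + 5 * b * t%:R) ^+ c)
   <= (1 + del) * (y ^+ c + (1 / 2) ^+ (L0 - d)).
  by rewrite ler_wpM2l ?addr_ge0 // lerD // ler_piMr.
apply: le_trans h1 _.
have dY : 0 <= del * Y by rewrite mulr_ge0 ?exprn_ge0.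
have h2 : del * Y <= c%:R * del * Y by rewrite -mulrA ler_peMl.
have h3 : del * y ^+ c <= 1 / 2 * (del * Y).
  by rewrite Yc mulrCA ler_wpM2r.
have h4 : del * (1 / 2) ^+ (L0 - d) <= (1 / 2) ^+ (L0 - d) by rewrite ler_piMl.
clear -E dY h2 h3 h4; lra.
Qed.

Lemma sum_shift_le (R : realFieldType) (h : nat -> R) a w m : (a + w <= m)%N ->
  (forall t, 0 <= h t) -> \sum_(t < w) h (a + t)%N <= \sum_(t < m) h t.
Proof.
move=> awm h0; rewrite -(subnKC awm) -addnA big_split_ord /= big_split_ord /=.
rewrite addrCA lerDl addr_ge0 ?sumr_ge0 //.
Qed.

Lemma minn_window A w m :
  (minn A m <= minn (w + A) m)%N /\ (minn (w + A) m - minn A m <= w)%N.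
Proof. lia. Qed.

Lemma window_exponent d L : (1 < d <= L)%N ->
  (2 + 8 * L + (10 + L) <= 32 * L - d)%N.
Proof. lia. Qed.

(* The rounds are cut into about [d] windows; each of them divides the admissible
   number of demanded bins by 32, whence the factor [32 ^ d]. *)
Lemma level_one_bound (R : realFieldType) n d (q : nat -> {set 'I_n} -> R)
    (F : nat -> ('I_n -> nat) -> R) (b rho : R) L m :
  (1 < d)%N -> upper_system d q F -> 0 <= b ->
  (forall t j, \sum_(D : {set 'I_n} | j \in D) q t D <= b * d%:R) ->
  0 <= rho -> (forall j l, j != l ->
    \sum_(t < m) \sum_(D : {set 'I_n} | (j \in D) && (l \in D)) q t D <= rho) ->
  (d <= L)%N -> 4096 * b * m%:R <= 1 -> 4096 * b * d%:R <= 1 ->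
  512 * (32 ^ d * L)%:R ^+ 2 * rho <= (1024 * d%:R)^-1 ->
  (forall f, F 0 f = [forall i, f i == 0%N]%:R) ->
  forall t f, (t <= m)%N -> (forall i, (f i <= 1)%N) -> (cnt1 f <= L)%N ->
  F t f <= (1 / 128) ^+ cnt1 f.
Proof.
move=> d2 sysF b0 hpd rho0 hrho dL bm bd hL F0.
(* The window length has to keep [b * d * w] below 1/128 while only [b * m] is bounded, whence the
   division by [d]. *)
pose w := (m %/ d).+1; pose del : R := (1024 * d%:R)^-1.
(* Starting at 1/256 instead of 0 keeps the price of a conflict bounded. The [d] increments sum to
   at most [10 / 4096 + 1 / 1024 < 1 / 256], so [v] stays below 1/128. *)
pose e := 5 * b * w%:R + del; pose v l : R := 1 / 256 + l%:R * e.
pose T l := minn (l * w) m.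
have dR : 2 <= d%:R :> R by rewrite (ler_nat _ 2 d).
have del0 : 0 <= del by rewrite invr_ge0 mulr_ge0 ?ler0n.
have w0 : 0 <= w%:R :> R by rewrite ler0n.
have e0 : 0 <= e by rewrite addr_ge0 // !mulr_ge0 ?ler0n.
have dw : d%:R * w%:R <= m%:R + d%:R :> R.
  by rewrite -natrM -natrD ler_nat /w mulnS addnC leq_add2r mulnC leq_trunc_div.
have mdw : (m <= d * w)%N by rewrite /w mulnC ltnW // ltn_ceil // ltnW.
have bdw : b * (d%:R * w%:R) <= b * (m%:R + d%:R) by rewrite ler_wpM2l.
have bmd : b * (m%:R + d%:R) <= 2 / 4096.
  clear - bm bd; lra.
have deld : d%:R * del = 1 / 1024.
  by rewrite /del invfM mulrCA divff ?mulr1 ?div1r //; apply/eqP; clear -dR; lra.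
have de : d%:R * e <= 1 / 256.
  have -> : d%:R * e = 5 * (b * (d%:R * w%:R)) + d%:R * del by rewrite /e; ring.
  rewrite deld; clear -bdw bmd; lra.
have vmono l l' : (l <= l')%N -> v l <= v l'.
  by move=> ll; rewrite lerD2l ler_wpM2r // ler_nat.
have v0 l : 1 / 256 <= v l by rewrite lerDl mulr_ge0 ?ler0n.
have v1 l : (l <= d)%N -> v l <= 1 / 128.
  move=> /vmono /le_trans; apply; rewrite /v; clear -de; lra.
have v00 l : 0 <= v l by apply: le_trans (v0 l); clear; lra.
have claim l : (l <= d)%N -> forall t f, (t <= T l)%N -> (forall i, (f i <= 1)%N) ->
    (cnt1 f <= 32 ^ (d - l) * L)%N -> F t f <= v l ^+ cnt1 f.
  elim: l => [|l IH] ld t f.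
    rewrite /T mul0n min0n leqn0 => /eqP -> f1 fL; rewrite F0.
    case: forallP => [fi|_]; last by rewrite exprn_ge0.
    rewrite (_ : cnt1 f = 0%N) //; apply/eqP; rewrite cards_eq0; apply/eqP/setP => i.
    by rewrite !inE (eqP (fi i)).
  have ld' : (l <= d)%N by exact: ltnW.
  have Ll : (32 ^ (d - l) = 32 * 32 ^ (d - l.+1))%N by rewrite -expnS -subSn.
  move=> tT f1 fL.
  have [tl|tl] := leqP t (T l).
    apply: le_trans (IH ld' t f tl f1 _) _.
      by apply: leq_trans fL _; rewrite Ll -mulnA leq_pmull.
    by rewrite lerXn2r ?nnegrE // vmono.
  have [TT Tw] : (T l <= T l.+1)%N /\ (T l.+1 - T l <= w)%N.
    by rewrite /T mulSn; apply: minn_window.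
  have Tm : (T l.+1 <= m)%N by rewrite /T geq_minr.
  set L1 := (32 ^ (d - l.+1) * L)%N in fL *.
  have dL1 : (d <= L1)%N by apply: leq_trans dL _; rewrite leq_pmull // expn_gt0.
  have L0E : (32 ^ (d - l) * L = 32 * L1)%N by rewrite Ll mulnA.
  have L0d : (32 * L1 <= 32 ^ d * L)%N.
    by rewrite -L0E leq_mul2r leq_exp2l // leq_subr orbT.
  have := @level_one_window R n d (fun s => q (T l + s)%N) (fun s => F (T l + s)%N) (v l) b rho
    (32 * L1) L1 (T l.+1 - T l) del d2 (upper_system_shift (T l) sysF) b0
    (fun s => hpd (T l + s)%N) rho0 _ _ _ _ _ _ _ _ _ (t - T l)%N f _ f1 fL.
  rewrite subnKC ?(ltnW tl) // => H.
  apply: (@le_trans _ _ ((v l + 5 * b * (T l.+1 - T l)%:R + del) ^+ cnt1 f)).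
    apply: H.
    - move=> j i ji; apply: le_trans (hrho j i ji).
      apply: (sum_shift_le (h := fun t => \sum_(D : {set 'I_n} | (j \in D) && (i \in D)) q t D)).
        by rewrite subnKC.
      by move=> s; apply: sumr_ge0 => D _; case: (us_law sysF s).
    - by apply: leq_trans dL1 _; rewrite leq_pmull.
    - by rewrite leq_pmull.
    - by rewrite v0 v1.
    - apply: (@le_trans _ _ (b * (d%:R * w%:R))).
        by rewrite mulrA ler_wpM2l ?mulr_ge0 ?ler_nat ?ler0n.
      apply: (le_trans bdw); apply: (le_trans bmd); clear; lra.
    - apply: le_trans hL; apply: ler_wpM2r => //; apply: ler_wpM2l; first by rewrite ler0n.
      by rewrite lerXn2r ?nnegrE ?ler0n // ler_nat.
    - rewrite /del invf_le1; first by rewrite -natrM ler1n muln_gt0 /= (ltnW d2).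
      by rewrite mulr_gt0 // ltr0n ltnW.
    - rewrite /del [X in _ <= X]mulrC ler_pdivlMr; last by rewrite mulr_gt0 // ltr0n ltnW.
      rewrite -!natrX -!natrM ler_nat.
      (* Everything is compared as powers of two, with [1024 * d <= 2 ^ (10 + L1)]; the factor 32
         between consecutive windows leaves room for all the exponents. *)
      have d2L : (d <= 2 ^ L1)%N by apply: leq_trans dL1 _; apply: ltnW; apply: ltn_expl.
      apply: (@leq_trans (2 ^ 2 * (2 ^ 8) ^ L1 * (2 ^ 10 * 2 ^ L1))%N).
        by rewrite leq_mul // leq_mul.
      by rewrite -expnM -!expnD leq_exp2l // window_exponent // d2.
    - by move=> f' h h'; rewrite addn0; apply: IH => //; rewrite L0E.
    - by rewrite leq_sub2r.
  have x0 : 0 <= 5 * b * (T l.+1 - T l)%:R by rewrite !mulr_ge0 ?ler0n.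
  apply: lerXn2r; rewrite ?nnegrE //; first by rewrite addr_ge0 // addr_ge0.
  have -> : v l.+1 = v l + 5 * b * w%:R + del by rewrite /v /e -natr1; ring.
  rewrite lerD2r lerD2l.
  by rewrite ler_wpM2l ?mulr_ge0 ?ler_nat.
move=> t f tm f1 fL; apply: le_trans (claim d (leqnn d) t f _ f1 _) _.
- by rewrite /T leq_min tm andbT (leq_trans tm mdw).
- by rewrite subnn mul1n.
- by rewrite lerXn2r ?nnegrE ?v1 //; clear; lra.
Qed.

(* Doubly exponential decay down to [xi], then geometric decay with ratio [xi],
   which makes a conflict affordable at every level. *)
Definition level_base (R : realFieldType) d ks (xi : R) k : R :=
  if (k < ks)%N then 2 ^- (d ^ k.-1 + 2) else xi ^+ (k - ks).+1.

(** From level two on the weight doubles over [m] rounds, and its increment [base k / m] pays for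
    the spawned demands; level one has the slope of [half_spawn_slope] instead. *)
Definition graded_weight (R : realFieldType) (v b : R) (m : nat) (base : nat -> R)
    (t k : nat) : R :=
  if k is k'.+1 then
    if k' is _.+1 then base k * (1 + t%:R / m%:R) else v + 5 * b * t%:R
  else 1.

Lemma graded_level_weight (R : realFieldType) d K m (v b Gam : R) (base : nat -> R) :
  (1 < d)%N -> (0 < m)%N -> 0 <= b -> 4096 * b * m%:R <= 1 -> 0 <= v <= 1 / 32 ->
  (forall k, 0 <= base k) -> 0 <= Gam -> 1 <= Gam * v ->
  v + 1 / 512 <= Gam * base 2 ->
  (forall k, (1 < k < K)%N -> base k <= Gam * base k.+1) ->
  d%:R * (v + 1 / 512) ^+ d <= 2048 * base 2 ->
  (forall k, (1 < k < K)%N -> d%:R * (2 * base k) ^+ d <= 2048 * base k.+1) ->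
  level_weight d K m (b * d%:R) Gam (graded_weight v b m base).
Proof.
move=> d2 m0 b0 bm /andP[v0 v1] base0 G0 Gv Gv2 Gb h1 hk.
have mR : 0 < m%:R :> R by rewrite ltr0n.
have tm0 t : 0 <= t%:R / m%:R :> R by rewrite divr_ge0.
have bt t : 0 <= 5 * b * t%:R by rewrite !mulr_ge0 ?ler0n.
have tm1 t : (t <= m)%N -> t%:R / m%:R <= 1 :> R.
  by move=> tm; rewrite ler_pdivrMr // mul1r ler_nat.
have btm t : (t <= m)%N -> 5 * b * t%:R <= 1 / 512.
  move=> tm; apply: (@le_trans _ _ (5 * b * m%:R)).
    by rewrite ler_wpM2l ?mulr_ge0 ?ler_nat.
  clear -bm; lra.
have inc t : (t < m)%N -> t.+1%:R / m%:R = t%:R / m%:R + m%:R^-1 :> R.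
  by move=> _; rewrite -natr1 mulrDl mul1r.
(* The budget 2048 is half of the 4096 in [4096 * b * m <= 1], the other factor 2 being that of
   [lw_high]. *)
have key (x y : R) : 0 <= x -> 0 <= y -> d%:R * x ^+ d <= 2048 * y ->
    2 * (b * d%:R) * x ^+ d <= y / m%:R.
  move=> x0 y0 xy; rewrite ler_pdivlMr //.
  have -> : 2 * (b * d%:R) * x ^+ d * m%:R = 2 * (b * m%:R) * (d%:R * x ^+ d) by ring.
  have h : 0 <= d%:R * x ^+ d by rewrite mulr_ge0 ?exprn_ge0.
  have h' : 4096 * b * m%:R * (d%:R * x ^+ d) <= 1 * (d%:R * x ^+ d) by rewrite ler_wpM2r.
  clear -h' xy; lra.
split=> //.
- move=> t [|[|k]] //=; first by rewrite addr_ge0.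
  by rewrite mulr_ge0 // addr_ge0.
- move=> t [|[|k]] //=; first by rewrite lerD2l ler_wpM2l ?mulr_ge0 ?ler_nat ?ler0n.
  by rewrite ler_wpM2l // lerD2l ler_wpM2r ?ler_nat // invr_ge0 ltW.
- move=> t [|[|k]] kK tm /=.
  + by apply: (le_trans Gv); rewrite ler_wpM2l // lerDl.
  + apply: (@le_trans _ _ (v + 1 / 512)); first by rewrite lerD2l btm.
    apply: (le_trans Gv2); rewrite mulrA ler_peMr ?mulr_ge0 // lerDl //.
  + rewrite mulrA ler_wpM2r ?addr_ge0 //; exact: Gb.
- move=> t [|[|k]] // kK tm /=.
  + have -> : base 2%N * (1 + t.+1%:R / m%:R) - base 2%N * (1 + t%:R / m%:R) = base 2%N / m%:R.
      by rewrite (inc _ tm); ring.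
    apply: key; rewrite ?addr_ge0 //; apply: le_trans h1; rewrite ler_wpM2l //.
    by apply: lerXn2r; rewrite ?nnegrE ?addr_ge0 ?divr_ge0 // lerD2l btm // ltnW.
  + have -> : base k.+3 * (1 + t.+1%:R / m%:R) - base k.+3 * (1 + t%:R / m%:R) = base k.+3 / m%:R.
      by rewrite (inc _ tm); ring.
    apply: key; rewrite ?mulr_ge0 ?addr_ge0 //; apply: le_trans (hk k.+2 kK); rewrite ler_wpM2l //.
    apply: lerXn2r; rewrite ?nnegrE ?mulr_ge0 ?addr_ge0 // mulrC ler_wpM2r //.
    by rewrite -[2]/(1 + 1) lerD2l tm1 // ltnW.
- move=> t tm /=.
  have -> : v + 5 * b * t.+1%:R - (v + 5 * b * t%:R) = 5 * b by rewrite -natr1; ring.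
  apply: half_spawn_slope => //; rewrite addr_ge0 //=.
  have := btm t (ltnW tm); clear -v1; lra.
Qed.

Lemma natr_le_exp2 (R : realFieldType) d : d%:R <= 2 ^+ d :> R.
Proof. by rewrite -natrX ler_nat; apply: ltnW; apply: ltn_expl. Qed.

(** At [ks] the doubly exponential value would be at most [xi] and is raised to [xi]. Hence no two
    consecutive levels differ by a factor above [1 / xi], and the 256 covers the step from level
    zero to level one. *)
Lemma level_base_weight (R : realFieldType) d ks K m (b xi : R) :
  (1 < d)%N -> (0 < m)%N -> 0 <= b -> 4096 * b * m%:R <= 1 ->
  (1 < ks)%N -> 0 < xi <= 1 / 4 -> 2 ^- (d ^ ks.-1 + 2) <= xi ->
  (forall k, (1 < k < ks)%N -> xi <= 2 ^- (d ^ k.-1 + 2)) ->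
  level_weight d K m (b * d%:R) (256 / xi)
    (graded_weight (1 / 256) b m (level_base d ks xi)).
Proof.
move=> d2 m0 b0 bm ks2 /andP[xi0 xi1] hks hlt.
have p2 k : 0 < 2 ^- k :> R by rewrite invr_gt0 exprn_gt0.
have d4 : d%:R * 2 ^- d <= 1 :> R.
  by rewrite ler_pdivrMr ?exprn_gt0 // mul1r natr_le_exp2.
have base0 k : 0 <= level_base d ks xi k.
  by rewrite /level_base; case: ifP => _; rewrite ?exprn_ge0 ?(ltW (p2 _)) // ltW.
have xiV : xi / xi = 1 by rewrite divff // gt_eqF.
have base_ge k : (k < ks)%N -> 2 ^- (d ^ k + 2) <= level_base d ks xi k.+1.
  rewrite /level_base leq_eqVlt => /orP[/eqP kk|-> //].
  by rewrite kk ltnn subnn expr1 -kk in hks *.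
have base_xi k : (1 < k <= ks)%N -> xi <= level_base d ks xi k.
  case/andP=> k1; rewrite /level_base leq_eqVlt => /orP[/eqP ->|kk].
    by rewrite ltnn subnn expr1.
  by rewrite kk hlt // k1.
have Gxi y c : 0 <= c -> xi * c <= y -> 256 * c <= 256 / xi * y.
  move=> c0 xy; rewrite mulrAC ler_pdivlMr // -mulrA [c * _]mulrC ler_wpM2l //.
have base_le1 k : level_base d ks xi k <= 1.
  rewrite /level_base; case: ifP => _; last by rewrite exprn_ile1 ?ltW // (le_lt_trans xi1) //; clear; lra.
  by rewrite invf_le1 ?exprn_gt0 // exprn_ege1 // ler1n.
apply: graded_level_weight => //.
- clear; lra.
- by rewrite divr_ge0 // ltW.
- rewrite mulrC mulrA; have := xi1; rewrite -[X in _ <= X]mul1r.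
  rewrite ler_pdivlMr // mul1r; clear; lra.
- have := Gxi (level_base d ks xi 2) 1 ler01.
  rewrite !mulr1 => /(_ (base_xi 2 _)); rewrite ks2 => /(_ isT); clear; lra.
- move=> k /andP[k1 _]; have [kk|kk] := ltnP k ks.
    apply: le_trans (base_le1 k) _.
    have hk : (1 < k.+1 <= ks)%N by rewrite ltnS (ltnW k1).
    have := Gxi (level_base d ks xi k.+1) 1 ler01.
    rewrite !mulr1 => /(_ (base_xi _ hk)).
    by apply: le_trans; rewrite ler1n.
  have -> : level_base d ks xi k.+1 = xi * level_base d ks xi k.
    by rewrite /level_base !ltnNge kk leqW //= -exprS subSn.
  rewrite mulrA [256 / xi * xi]mulrAC -mulrA xiV mulr1.
  by rewrite ler_peMl // ler1n.
- have := base_ge 1 ks2; rewrite expn1 => h.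
  apply: (@le_trans _ _ (2048 * 2 ^- (d + 2))); last by rewrite ler_wpM2l.
  apply: (@le_trans _ _ (d%:R * 4 ^- d)).
    rewrite ler_wpM2l // -exprVn; apply: lerXn2r; rewrite ?nnegrE ?invr_ge0 ?ler0n //; clear; lra.
  have -> : 4 ^- d = 2 ^- d * 2 ^- d :> R.
    by rewrite -invfM -exprMn -natrM.
  rewrite mulrA exprD invfM mulrCA.
  have h' : d%:R * 2 ^- d * 2 ^- d <= 1 * 2 ^- d :> R by rewrite ler_wpM2r // ltW.
  apply: (le_trans h'); rewrite mulrC; apply: ler_wpM2l; first exact: ltW.
  clear; lra.
- move=> k /andP[k1 _]; have [kk|kk] := ltnP k ks.
    apply: (@le_trans _ _ (2048 * 2 ^- (d ^ k + 2))); last first.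
      by rewrite ler_wpM2l // base_ge.
    rewrite {1}/level_base kk.
    (* Of the [+ 2] in the exponent a [+ 1] survives the doubling, and its [d]-th power is a spare
       [2 ^- d] that beats the factor [d]. *)
    have -> : 2 * 2 ^- (d ^ k.-1 + 2) = 2 ^- (d ^ k.-1 + 1) :> R.
      by rewrite addnS exprS invfM mulrA divff ?mul1r // pnatr_eq0.
    rewrite -exprVn -exprM mulnDl mul1n -expnSr prednK ?(ltnW k1) // exprVn.
    rewrite !exprD !invfM mulrCA [X in _ <= X]mulrCA ler_wpM2l //; first exact: ltW.
    apply: (le_trans d4); clear; lra.
  have -> : level_base d ks xi k.+1 = xi * level_base d ks xi k.
    by rewrite /level_base !ltnNge kk leqW //= -exprS subSn.
  set x := level_base d ks xi k.
  have x0 : 0 <= x by exact: base0.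
  have xx : x <= xi.
    have xi0' := ltW xi0; have xile1 : xi <= 1 by clear -xi1; lra.
    by rewrite /x /level_base ltnNge kk /= exprS; apply: ler_piMr => //; exact: exprn_ile1.
  (* Of the [d] factors one is kept as [x], one supplies the decay [xi] to the next level, and the
     other [e] supply [2 ^- e] against the factor [d]. *)
  have [e de] : exists e, d = e.+2 by exists d.-2; case: (d) d2 => [|[|]].
  have xe : (2 * x) ^+ e <= 2 ^- e.
    by rewrite -exprVn; apply: lerXn2r; rewrite ?nnegrE ?mulr_ge0 ?invr_ge0 //; clear -xx xi1; lra.
  have h : (2 * x) ^+ d <= 2 * x * (2 * xi) * 2 ^- e.
    rewrite [in X in _ ^+ X]de !exprS mulrA; apply: ler_pM => //.
    - by rewrite !mulr_ge0.
    - by rewrite exprn_ge0 // mulr_ge0.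
    - by rewrite ler_wpM2l ?mulr_ge0 // ler_wpM2l.
  apply: (le_trans (ler_wpM2l (ler0n _ d) h)).
  have -> : d%:R * (2 * x * (2 * xi) * 2 ^- e) = (d%:R * 2 ^- d) * (16 * (xi * x)).
    have -> : 2 ^+ d = 4 * 2 ^+ e :> R by rewrite de !exprS; ring.
    by field; rewrite expf_neq0 // pnatr_eq0.
  have xx0 : 0 <= xi * x by rewrite mulr_ge0 // ltW.
  apply: (@le_trans _ _ (1 * (16 * (xi * x)))); first by rewrite ler_wpM2r // mulr_ge0.
  clear -xx0; lra.
Qed.

(* Grows so fast in [k] that the recursion is trivially satisfied: it carries the
   boundary term of [supersolution_bound]. *)
Definition big_base (R : realFieldType) d k : R := (2 * d)%:R ^+ (k * d ^ k).

Lemma big_base_weight (R : realFieldType) d K m (b Gam : R) :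
  (1 < d)%N -> (0 < m)%N -> 0 <= b -> 4096 * b * m%:R <= 1 -> 32 <= Gam ->
  level_weight d K m (b * d%:R) Gam (graded_weight (1 / 32) b m (@big_base R d)).
Proof.
move=> d2 m0 b0 bm G32.
have G0 : 0 <= Gam by apply: le_trans G32; rewrite ler0n.
have D1 k : 1 <= big_base R d k.
  by rewrite exprn_ege1 // ler1n muln_gt0 /= (ltnW d2).
have D0 k : 0 <= big_base R d k by apply: le_trans (D1 k).
have dd : d%:R <= (2 ^ d)%:R :> R by rewrite natrX natr_le_exp2.
apply: graded_level_weight => //.
- by rewrite lexx andbT divr_ge0.
- by rewrite mulrA mulr1 ler_pdivlMr // mul1r.
- apply: (@le_trans _ _ (Gam * 1)); last by rewrite ler_wpM2l.
  clear -G32; lra.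
- move=> k _; apply: (@le_trans _ _ (1 * big_base R d k.+1)); last first.
    by rewrite ler_wpM2r // (le_trans _ G32) // ler1n.
  rewrite mul1r; apply: ler_weXn2l; first by rewrite ler1n muln_gt0 /= (ltnW d2).
  by rewrite leq_mul // leq_exp2l.
- apply: (@le_trans _ _ (2048 * 1)); last by rewrite ler_wpM2l.
  apply: (@le_trans _ _ (d%:R * 2 ^- d)).
    rewrite ler_wpM2l // -exprVn; apply: lerXn2r; rewrite ?nnegrE ?invr_ge0 //; clear; lra.
  apply: (@le_trans _ _ 1); last by clear; lra.
  by rewrite ler_pdivrMr ?exprn_gt0 // mul1r natr_le_exp2.
- move=> k _; apply: (@le_trans _ _ (big_base R d k.+1)); last by rewrite ler_peMl // ler1n.
  rewrite /big_base exprMn -exprM mulrA -!natrX -!natrM ler_nat mulSn expnD -mulnA.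
  have -> : (k * d ^ k * d = k * d ^ k.+1)%N by rewrite -mulnA -expnSr.
  rewrite mulnA leq_mul2r; apply/orP; right.
  apply: (@leq_trans ((2 * d) ^ d)).
    rewrite expnMn mulnC leq_mul2l; apply/orP; right.
    by rewrite -[X in (X <= _)%N]expn1 leq_exp2l // ltnW.
  by rewrite leq_exp2l ?expnS ?leq_pmulr ?expn_gt0 ?(ltnW d2) //; lia.
Qed.

(** The demand is a single bin of level [ks + J], whose [J] geometric levels beyond [ks] give
    [xi ^+ J.+1]; the second term is the price of the cutoff at [L - d] bins of level one. Each 4 is
    [1 + g = 2] times the growth [1 + m / m = 2]. *)
Lemma upper_tail (R : realFieldType) n d (q : nat -> {set 'I_n} -> R)
    (F : nat -> ('I_n -> nat) -> R) (b rho xi : R) L m ks J (i0 : 'I_n) :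
  (1 < d)%N -> upper_system d q F -> 0 <= b ->
  (forall t j, \sum_(D : {set 'I_n} | j \in D) q t D <= b * d%:R) ->
  0 <= rho -> (forall j l, j != l ->
    \sum_(t < m) \sum_(D : {set 'I_n} | (j \in D) && (l \in D)) q t D <= rho) ->
  (d <= L)%N -> (0 < m)%N -> 4096 * b * m%:R <= 1 -> 4096 * b * d%:R <= 1 ->
  512 * (32 ^ d * L)%:R ^+ 2 * rho <= (1024 * d%:R)^-1 ->
  (1 < ks)%N -> 0 < xi <= 1 / 4 -> 2 ^- (d ^ ks.-1 + 2) <= xi ->
  (forall k, (1 < k < ks)%N -> xi <= 2 ^- (d ^ k.-1 + 2)) ->
  512 * (L + d ^ (ks + J))%:R ^+ 2 * rho <= xi ->
  (forall f, F 0 f = [forall i, f i == 0%N]%:R) ->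
  F m (fun i => if i == i0 then ks + J else 0)%N <=
  4 * xi ^+ J.+1 + 4 * ((2 * d)%:R ^+ ((ks + J) * d ^ (ks + J)) / 2 ^+ (L - d)).
Proof.
move=> d2 sysF b0 hpd rho0 hrho dL m0 bm bd hL ks2 hxi hks hlt hxi2 F0.
have [xi0 xi1] := andP hxi.
set K := (ks + J)%N; set f := fun i => _.
have G256 : 256 <= 256 / xi by rewrite ler_peMr // invf_ge1 // (le_trans xi1) //; clear; lra.
have lwphi := level_base_weight (ks + J) d2 m0 b0 bm ks2 hxi hks hlt.
have G32 : 32 <= 256 / xi by apply: le_trans G256; rewrite ler_nat.
have lwsig := @big_base_weight R d (ks + J) m b (256 / xi) d2 m0 b0 bm G32.
have K2 : (1 < K)%N by apply: leq_trans ks2 _; rewrite leq_addr.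
have fK i : (f i <= K)%N by rewrite /f; case: eqP.
have f1 : cnt1 f = 0%N.
  apply/eqP; rewrite cards_eq0; apply/eqP/setP => i; rewrite !inE /f; case: (i =P i0) => // _.
  by rewrite gtn_eqF.
have fB : high_mass d f = (d ^ K)%N.
  rewrite /high_mass (big_pred1 i0) => [|i]; rewrite /f ?eqxx //.
  by rewrite /pred1 /=; case: (i == i0); [exact: K2|].
have z0 : 0 <= (1 / 2) ^+ (L - d) :> R by rewrite exprn_ge0 // divr_ge0.
have cmp := @supersolution_bound R n d d2 q F K m (d ^ K) (L - d) (b * d%:R) (256 / xi) rho 1 _
  _ _ sysF _ _ z0 rho0 hpd hrho _ (lexx 1) lwphi lwsig _ _ m f (leqnn m) fK _ _.
have {cmp} : F m f <= (1 + 1) * (prod_weight (graded_weight (1 / 256) b m (level_base d ks xi) m) f +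
    (1 / 2) ^+ (L - d) * prod_weight (graded_weight (1 / 32) b m (@big_base R d) m) f).
  apply: cmp.
  - by rewrite mulr_ge0.
  - by rewrite divr_ge0 // ltW.
  - rewrite subnK // -mulrA mulrA [2 * _]mulrA -natrM -mulrA mulrAC.
    rewrite ler_pdivrMr // mul1r mulrA; exact: hxi2.
  - move=> f' _ _ _; rewrite F0; case: forallP => [f'0|_].
      rewrite (_ : prod_weight _ f' = 1) ?lerDl; last first.
        by apply: big1 => i _; rewrite (eqP (f'0 i)).
      rewrite mulr_ge0 // prod_weight_ge0 // => k; exact: lw_ge0 lwsig _ _.
    rewrite addr_ge0 ?mulr_ge0 ?prod_weight_ge0 // => k; first exact: lw_ge0 lwphi _ _.
    exact: lw_ge0 lwsig _ _.
  - move=> t f' tm f'K _; rewrite subnK // => /andP[Lf fL].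
    (* Beyond the cutoff the demands above level one are dropped by monotonicity; the boundary
       weight allows it, as [big_base] is at least one. *)
    pose f1' i := (f' i == 1%N : nat).
    have f1'E : cnt1 f1' = cnt1 f'.
      by apply: eq_card => i; rewrite !inE /f1'; case: (f' i == 1%N).
    have f1'1 i : (f1' i <= 1)%N by rewrite /f1'; case: eqP.
    apply: (@le_trans _ _ (F t f1')).
      by apply: (us_anti sysF) => i; rewrite /f1'; case: eqP => // ->.
    apply: le_trans (level_one_bound d2 sysF b0 hpd rho0 hrho dL bm bd hL F0 tm f1'1 _) _.
      by rewrite f1'E.
    apply: (@le_trans _ _ ((1 / 2) ^+ cnt1 f' * (1 / 32) ^+ cnt1 f')).
      rewrite f1'E -exprMn; apply: lerXn2r; rewrite ?nnegrE; clear; lra.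
    apply: ler_pM; rewrite ?exprn_ge0 ?divr_ge0 //.
      by apply: ler_wiXn2l (ltnW Lf); clear; lra.
    rewrite /cnt1 -prodr_const big_mkcond; apply: ler_prod => i _.
    rewrite inE; case: eqP => [->|fi1] /=.
      by rewrite divr_ge0 //= lerDl !mulr_ge0 ?ler0n.
    case: (f' i) fi1 => [|[|k]] //= _; first by rewrite ler01 lexx.
    rewrite ler01 mulr_ege1 ?lerDl ?divr_ge0 //.
    by rewrite exprn_ege1 // ler1n muln_gt0 /= (ltnW d2).
  - by rewrite fB.
  - by rewrite f1.
have pwE (phi : nat -> R) : phi 0 = 1 -> prod_weight phi f = phi K.
  move=> p0; rewrite /prod_weight (bigD1 i0) //= big1 ?mulr1; first by rewrite /f eqxx.
  by move=> i /negbTE; rewrite /f => ->.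
rewrite !pwE // => /le_trans; apply.
have [k KE] : exists k, K = k.+2 by exists K.-2; case: (K) K2 => [|[|]].
have KE2 v base : graded_weight v b m base m K = base K * (1 + 1) :> R.
  by rewrite KE /= divff // gt_eqF // ltr0n.
rewrite !KE2 {1}/level_base ltnNge leq_addr /= (_ : K - ks = J)%N; last by rewrite /K addKn.
rewrite expr_div_n expr1n /big_base le_eqVlt; apply/orP; left; apply/eqP.
by ring.
Qed.

(** * Lower bound for the mean *)

Definition upd n (f : 'I_n -> nat) (i : 'I_n) k : 'I_n -> nat :=
  fun j => if j == i then k else f j.

(* Lower bound for the ratio between the demand probability of level [k] and the
   mass of the exposure trees rooted at that level. *)
Fixpoint lower_coef (R : realFieldType) d (delta : nat -> R) k : R :=
  if k is k'.+1 then
    if k' is _.+1 then (lower_coef d delta k' * delta k' / 2) ^+ d else 1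
  else 1.

Section Lower.
Variables (R : realFieldType) (n d : nat) (p : nat -> {set 'I_n} -> R).
Variables (b : R) (delta : nat -> R).
Hypothesis d2 : (1 < d)%N.
Hypothesis hp : forall t, choice_law d (p t).
Hypothesis b0 : 0 <= b.
Hypothesis hpd : forall t j, \sum_(D : {set 'I_n} | j \in D) p t D <= b * d%:R.
Hypothesis delta01 : forall k, 0 < delta k <= 1.
Implicit Types f g : 'I_n -> nat.

(* Bin [i] is good for level [k] at time [t] when, up to then, it was expected to
   receive enough balls from chosen sets all of whose bins are good for [k - 1]. *)
Fixpoint good k (t : nat) (i : 'I_n) : bool :=
  if k is k'.+1 then
    delta k <= \sum_(tau < t) \sum_(D : {set 'I_n} | (i \in D) && [forall j in D, good k' tau j])
       p tau D / d%:R
  else true.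

(** [p t D / d] bounds from below the chance that [D] is drawn and its ball lands in [i], provided
    [i] is least loaded. All of [D] has to be good, since every bin of it inherits a demand of level
    [k - 1]. *)
Definition incr k (t : nat) (i : 'I_n) : R :=
  \sum_(D : {set 'I_n} | (i \in D) && [forall j in D, good k.-1 t j]) p t D / d%:R.

Definition expo k t i : R := \sum_(tau < t) incr k tau i.

(* Total mass of the ways to assign distinct rounds to the demanded bins, the round
   of bin [i] being weighted by [incr (f i)]. *)
Fixpoint inj_mass t f : R :=
  if t is t'.+1 then
    inj_mass t' f + \sum_(i in supp f) incr (f i) t' i * inj_mass t' (upd f i 0)
  else [forall i, f i == 0%N]%:R.

Let p0 t D : 0 <= p t D. Proof. by case: (hp t). Qed.
Let dR : 0 < d%:R :> R. Proof. by rewrite ltr0n ltnW. Qed.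

Lemma goodS k t i : (0 < k)%N -> good k t i = (delta k <= expo k t i).
Proof. by case: k. Qed.

Lemma incr_ge0 k t i : 0 <= incr k t i.
Proof. by apply: sumr_ge0 => D _; rewrite divr_ge0 // ltW. Qed.

Lemma incr_le k t i : incr k t i <= b.
Proof.
rewrite /incr -mulr_suml ler_pdivrMr //; apply: le_trans (hpd t i).
rewrite [X in _ <= X](bigID (fun D : {set 'I_n} => [forall j in D, good k.-1 t j])) /=.
by rewrite lerDl sumr_ge0.
Qed.

Lemma expoS k t i : expo k t.+1 i = expo k t i + incr k t i.
Proof. by rewrite /expo big_ord_recr. Qed.

Lemma expo_ge0 k t i : 0 <= expo k t i.
Proof. by apply: sumr_ge0 => tau _; apply: incr_ge0. Qed.

Lemma expo_le k t i : expo k t i <= t%:R * b.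
Proof.
elim: t => [|t IH]; first by rewrite /expo big_ord0 mul0r.
by rewrite expoS -natr1 mulrDl mul1r lerD // incr_le.
Qed.

Lemma inj_mass_ge0 t f : 0 <= inj_mass t f.
Proof.
elim: t f => [|t IH] f /=; first by rewrite ler0n.
by rewrite addr_ge0 // sumr_ge0 // => i _; rewrite mulr_ge0 // incr_ge0.
Qed.

Lemma supp_upd f i k : (0 < k)%N -> supp (upd f i k) = i |: supp f.
Proof.
move=> k0; apply/setP => j; rewrite !inE /upd; case: (j =P i) => //= _.
by rewrite -lt0n k0.
Qed.

Lemma supp_upd0 f i : supp (upd f i 0) = supp f :\ i.
Proof. by apply/setP => j; rewrite !inE /upd; case: (j =P i). Qed.

Lemma upd_upd f i k k' : upd (upd f i k) i k' = upd f i k'.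
Proof. by apply: functional_extensionality => j; rewrite /upd; case: eqP. Qed.

Lemma upd_id f i k : f i = k -> upd f i k = f.
Proof. by move=> fi; apply: functional_extensionality => j; rewrite /upd; case: eqP => [->|]. Qed.

Lemma updC f i j k k' : i != j -> upd (upd f i k) j k' = upd (upd f j k') i k.
Proof.
move=> ij; apply: functional_extensionality => l; rewrite /upd.
by case: (l =P j) => [->|//]; rewrite eq_sym (negbTE ij).
Qed.

Lemma inj_mass_updS t f i k : (0 < k)%N -> f i = 0%N ->
  inj_mass t.+1 (upd f i k) = inj_mass t (upd f i k) + incr k t i * inj_mass t f
   + \sum_(j in supp f) incr (f j) t j * inj_mass t (upd (upd f j 0) i k).
Proof.
move=> k0 fi /=; rewrite -addrA supp_upd // big_setU1 ?inE ?fi //=.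
congr (_ + (_ + _)); first by rewrite upd_upd (upd_id fi) {1}/upd eqxx.
apply: eq_bigr => j jf; have ij : i != j by apply: contraTneq jf => <-; rewrite inE fi.
by rewrite updC // {1}/upd eq_sym (negbTE ij).
Qed.

(** Forgetting that the round of [i] must differ from the other rounds makes the mass factor. *)
Lemma inj_mass_upper t f i k : (0 < k)%N -> f i = 0%N ->
  inj_mass t (upd f i k) <= expo k t i * inj_mass t f.
Proof.
move=> k0; elim: t f => [|t IH] f fi.
  rewrite /expo big_ord0 mul0r /=; case: forallP => // /(_ i).
  by rewrite /upd eqxx -leqn0 leqNgt k0.
rewrite inj_mass_updS // expoS.
have H1 := IH f fi.
have H2 : \sum_(j in supp f) incr (f j) t j * inj_mass t (upd (upd f j 0) i k)
   <= expo k t i * \sum_(j in supp f) incr (f j) t j * inj_mass t (upd f j 0).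
  rewrite mulr_sumr; apply: ler_sum => j _; rewrite mulrCA ler_wpM2l ?incr_ge0 //.
  by apply: IH; rewrite /upd; case: eqP.
rewrite mulrDl /= mulrDr.
have H3 : incr k t i * inj_mass t f <= incr k t i * (inj_mass t f + \sum_(j in supp f)
    incr (f j) t j * inj_mass t (upd f j 0)).
  rewrite ler_wpM2l ?incr_ge0 // lerDl sumr_ge0 // => j _.
  by rewrite mulr_ge0 ?incr_ge0 ?inj_mass_ge0.
by rewrite addrAC; apply: lerD => //; apply: lerD.
Qed.

(** Each other demanded bin blocks one round for [i], and a round weighs at most [b]. *)
Lemma inj_mass_lower t f i k : (0 < k)%N -> f i = 0%N ->
  (expo k t i - #|supp f|%:R * b) * inj_mass t f <= inj_mass t (upd f i k).
Proof.
move=> k0; elim: t f => [|t IH] f fi.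
  rewrite /expo big_ord0 sub0r mulNr; apply: le_trans (inj_mass_ge0 0 _).
  by rewrite oppr_le0 !mulr_ge0 ?ler0n.
rewrite inj_mass_updS // expoS /=.
set S := \sum_(j in supp f) incr (f j) t j * inj_mass t (upd f j 0).
have H1 := IH f fi.
have H2 : (expo k t i - #|supp f|%:R * b + incr k t i) * S <=
   \sum_(j in supp f) incr (f j) t j * inj_mass t (upd (upd f j 0) i k).
  rewrite mulr_sumr; apply: ler_sum => j jf; rewrite mulrCA ler_wpM2l ?incr_ge0 //.
  apply: le_trans (IH (upd f j 0) _); last by rewrite /upd; case: eqP.
  apply: ler_wpM2r; first exact: inj_mass_ge0.
  rewrite supp_upd0 (cardsD1 j (supp f)) jf natrD mulrDl mul1r.
  by have := incr_le k t i; lra.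
apply: le_trans (lerD (lerD H1 (lexx (incr k t i * inj_mass t f))) H2).
rewrite le_eqVlt; apply/orP; left; apply/eqP; ring.
Qed.

Local Notation c := (lower_coef d delta).

Lemma lower_coef01 k : 0 < c k <= 1.
Proof.
elim: k => [|[|k] IH]; rewrite ?ltr01 ?lexx //.
rewrite /= -/(c k.+1).
have /andP[d0' d1'] := delta01 k.+1; have /andP[c0 c1] := IH.
have h0 : 0 < c k.+1 * delta k.+1 / 2 by rewrite divr_gt0 ?mulr_gt0.
have h1 : c k.+1 * delta k.+1 <= 1 by rewrite mulr_ile1 // ltW.
have h2 : c k.+1 * delta k.+1 / 2 <= 1 by lra.
by rewrite exprn_gt0 //= exprn_ile1 // ltW.
Qed.

Definition coef f : R := \prod_i c (f i).

Lemma coef_gt0 f : 0 < coef f.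
Proof. by apply: prodr_gt0 => i _; case/andP: (lower_coef01 (f i)). Qed.

Lemma coef_upd f i k : c (f i) * coef (upd f i k) = c k * coef f.
Proof.
rewrite /coef (bigD1 i) //= [in RHS](bigD1 i) //= /upd eqxx mulrCA; congr (_ * (_ * _)).
by apply: eq_bigr => j /negbTE ->.
Qed.

Variables (m B : nat).
Hypothesis mb : m%:R * b <= 1.

Definition lift_to g (i : 'I_n) l := upd g i (maxn (g i) l).

(** Removing the old round of [i] loses no mass, since [expo <= m * b <= 1]. Inserting a round for
    level [l] gains [expo >= delta l] by goodness, of which at most [2 * B] blocked rounds take no
    more than half. *)
Lemma lift_step t g i l : (t <= m)%N -> (0 < l)%N -> 4 * B%:R * b <= delta l ->
  good l t i -> (#|supp g| <= 2 * B)%N ->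
  c l * delta l / 2 * (coef g * inj_mass t g)
    <= coef (lift_to g i l) * inj_mass t (lift_to g i l).
Proof.
move=> tm l0 hB; rewrite goodS // => gi sg.
have /andP[c0 c1] := lower_coef01 l; have /andP[d0' d1'] := delta01 l.
have cg := coef_gt0 g; have jg := inj_mass_ge0 t g.
have th1 : c l * delta l / 2 <= 1.
  have : c l * delta l <= 1 by rewrite mulr_ile1 // ltW.
  by lra.
have th0 : 0 <= c l * delta l / 2 by rewrite divr_ge0 // mulr_ge0 // ltW.
have [gl|gl] := leqP l (g i).
  by rewrite /lift_to (maxn_idPl gl) upd_id // ler_piMl // mulr_ge0 // ltW.
rewrite /lift_to (maxn_idPr (ltnW gl)).
pose g0 := upd g i 0.
have jg0 : inj_mass t g <= inj_mass t g0.
  have [gi0|gi0] := posnP (g i); first by rewrite /g0 upd_id.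
  have {1}-> : g = upd g0 i (g i) by rewrite /g0 upd_upd upd_id.
  apply: le_trans (inj_mass_upper _ _ _) _ => //; first by rewrite /g0 /upd eqxx.
  rewrite ler_piMl ?inj_mass_ge0 //; apply: le_trans (expo_le _ _ _) _.
  by apply: le_trans mb; rewrite ler_wpM2r // ler_nat.
have jl : delta l / 2 * inj_mass t g0 <= inj_mass t (upd g i l).
  have -> : upd g i l = upd g0 i l by rewrite /g0 upd_upd.
  apply: le_trans (inj_mass_lower t l0 _); last by rewrite /g0 /upd eqxx.
  apply: ler_wpM2r; first exact: inj_mass_ge0.
  have : #|supp g0|%:R * b <= 2 * B%:R * b.
    rewrite ler_wpM2r // -natrM ler_nat; apply: leq_trans sg; apply: subset_leq_card.
    by rewrite /g0 supp_upd0 subsetDl.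
  by lra.
have cl : c l * coef g <= coef (upd g i l).
  rewrite -(coef_upd g i l) ler_piMl //; first exact/ltW/coef_gt0.
  by case/andP: (lower_coef01 (g i)).
have -> : c l * delta l / 2 * (coef g * inj_mass t g) =
   (c l * coef g) * (delta l / 2 * inj_mass t g) by ring.
apply: ler_pM => //.
- by rewrite mulr_ge0 // ltW.
- by rewrite mulr_ge0 // divr_ge0 // ltW.
- by apply: le_trans jl; rewrite ler_wpM2l // divr_ge0 // ltW.
Qed.

Lemma lift_steps t l (s : seq 'I_n) g : (t <= m)%N -> (0 < l)%N ->
  4 * B%:R * b <= delta l ->
  {in s, forall i, good l t i} -> (#|supp g| + size s <= 2 * B)%N ->
  (c l * delta l / 2) ^+ size s * (coef g * inj_mass t g)
    <= coef (foldr (fun i g' => lift_to g' i l) g s) *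
       inj_mass t (foldr (fun i g' => lift_to g' i l) g s).
Proof.
move=> tm l0 hB.
have /andP[c0 c1] := lower_coef01 l; have /andP[d0' d1'] := delta01 l.
have th0 : 0 <= c l * delta l / 2 by rewrite divr_ge0 // mulr_ge0 // ltW.
have sup s' : (#|supp (foldr (fun i g' => lift_to g' i l) g s')| <= #|supp g| + size s')%N.
  elim: s' => [|i s' IH] /=; first by rewrite addn0.
  rewrite /lift_to supp_upd; last by rewrite (leq_trans l0) // leq_maxr.
  rewrite addnS; apply: leq_trans (leq_card_setU _ _) _; rewrite cards1 add1n ltnS.
  exact: IH.
elim: s => [|i s IH] gs sg; first by rewrite expr0 mul1r.
rewrite /= exprS -mulrA.
have sg' : (#|supp g| + size s <= 2 * B)%N by apply: leq_trans sg; rewrite leq_add2l /=.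
apply: le_trans (lift_step tm l0 hB _ _); last 2 first.
- by apply: gs; rewrite mem_head.
- exact: leq_trans (sup s) sg'.
by rewrite ler_wpM2l // IH // => j js; apply: gs; rewrite in_cons js orbT.
Qed.

Lemma foldr_lift s g l j : foldr (fun i g' => lift_to g' i l) g s j =
  if j \in s then maxn (g j) l else g j.
Proof.
elim: s j => //= i s IH j; rewrite {1}/lift_to {1}/upd in_cons.
case: (j =P i) => [->|_]; rewrite IH //=.
by case: (i \in s) => //; rewrite -maxnA maxnn.
Qed.

(** Unlike [high_mass] this includes level one: [raise] turns a demand of level one into no demand
    at all, so the potential still cannot grow. *)
Definition mass f := (\sum_(i in supp f) d ^ f i)%N.

Lemma card_supp_mass f : (#|supp f| <= mass f)%N.
Proof.
by rewrite -sum1_card; apply: leq_sum => i _; rewrite expn_gt0 ltnW.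
Qed.

Lemma mass_raise f j (D : {set 'I_n}) : j \in supp f -> #|D| = d ->
  (mass (raise f j D) <= mass f)%N.
Proof.
rewrite inE => fj cD.
rewrite /mass [X in (_ <= X)%N](bigD1 j) ?inE //=.
apply: (@leq_trans (\sum_(i in D) d ^ (f j).-1 + \sum_(i in supp f | i != j) d ^ f i)%N).
  rewrite big_mkcond [X in (_ <= X + _)%N]big_mkcond [X in (_ <= _ + X)%N]big_mkcond.
  rewrite -big_split /=; apply: leq_sum => i _.
  rewrite !inE /raise; case: (i =P j) => [->|ij]; rewrite ?max0n /=.
    by rewrite andbF addn0; case: (j \in D) => //=; case: eqP.
  case: (i \in D) => /=; last by rewrite maxn0; case: eqP.
  case: (f i =P 0%N) => [->|_]; first by rewrite max0n addn0; case: eqP.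
  case: (leqP (f i) (f j).-1) => h; case: eqP => //= _; rewrite ?leq_addr ?leq_addl //.
by rewrite sum_nat_const cD leq_add2r -expnS prednK // lt0n.
Qed.

(** [raise f j D] consists of [d] successive lifts to level [(f j).-1], and [lower_coef] at [f j] is
    by definition the product of their [d] losses. *)
Lemma raise_bound t f j (D : {set 'I_n}) : (t <= m)%N -> j \in supp f ->
  (mass f <= B)%N -> #|D| = d -> j \in D -> [forall i in D, good (f j).-1 t i] ->
  (0 < (f j).-1)%N -> 4 * B%:R * b <= delta (f j).-1 ->
  coef f * inj_mass t (upd f j 0) <= coef (raise f j D) * inj_mass t (raise f j D).
Proof.
move=> tm jf fB cD jD /forall_inP gD fj1 hB; have fj : (0 < f j)%N by move: jf; rewrite inE lt0n.
have dB : (d <= B)%N.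
  apply: leq_trans fB; rewrite /mass (bigD1 j) //=; apply: leq_trans (leq_addr _ _).
  by rewrite -{1}(expn1 d) leq_exp2l.
have cE : coef f = c (f j) * coef (upd f j 0).
  by rewrite coef_upd mul1r.
have -> : raise f j D = foldr (fun i g' => lift_to g' i (f j).-1) (upd f j 0) (enum D).
  apply: functional_extensionality => i; rewrite foldr_lift mem_enum /raise /upd.
  by case: (i \in D); rewrite ?maxn0.
have := @lift_steps t (f j).-1 (enum D) (upd f j 0) tm fj1 hB.
rewrite -cardE cD => H.
have {H} := H (fun i => ltac:(rewrite mem_enum; exact: gD)).
have -> : (#|supp (upd f j 0)| + d <= 2 * B)%N.
  rewrite mul2n -addnn leq_add //; apply: leq_trans (leq_trans (card_supp_mass f) fB).
  by rewrite supp_upd0; apply: subset_leq_card; apply: subsetDl.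
move=> /(_ isT); apply: le_trans; rewrite cE mulrA.
have -> : f j = (f j).-1.-1.+2 by rewrite !prednK.
exact: lexx.
Qed.

Variable F : nat -> ('I_n -> nat) -> R.
Hypothesis F_ge0 : forall t f, 0 <= F t f.
Hypothesis F0 : forall f, F 0 f = [forall i, f i == 0%N]%:R.
Hypothesis F_rec : forall t f, F t f + \sum_(j in supp f) \sum_(D : {set 'I_n} | j \in D)
     p t D / d%:R * (F t (raise f j D) - F t f) <= F t.+1 f.
Hypothesis Bb : B%:R * b <= 1.

(** The negative terms of the recursion cost at most a share [B * b] per round, as [mass] bounds the
    support. The positive terms, restricted to good sets, reproduce the recursion of [inj_mass]. *)
Lemma demand_lower K t f : (t <= m)%N -> (forall i, (f i <= K)%N) -> (mass f <= B)%N ->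
  (forall l, (0 < l < K)%N -> 4 * B%:R * b <= delta l) ->
  (1 - B%:R * b) ^+ t * (coef f * inj_mass t f) <= F t f.
Proof.
move=> + + + hB; elim: t f => [|t IH] f tm fK fB.
  rewrite expr0 mul1r /= F0; case: forallP => [f0|_]; last by rewrite mulr0.
  rewrite mulr1 /coef big1 // => i _; by rewrite (eqP (f0 i)).
apply: le_trans (F_rec t f).
have tm' : (t <= m)%N := ltnW tm.
set y := 1 - B%:R * b; have y0 : 0 <= y by rewrite subr_ge0.
have y1 : y <= 1 by rewrite gerBl mulr_ge0.
have IHf := IH f tm' fK fB.
have main : F t f * y + \sum_(j in supp f) \sum_(D : {set 'I_n} | j \in D)
     p t D / d%:R * F t (raise f j D) <= F t f + \sum_(j in supp f) \sum_(D : {set 'I_n} | j \in D)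
     p t D / d%:R * (F t (raise f j D) - F t f).
  have -> : \sum_(j in supp f) \sum_(D : {set 'I_n} | j \in D)
     p t D / d%:R * (F t (raise f j D) - F t f) =
     \sum_(j in supp f) \sum_(D : {set 'I_n} | j \in D) p t D / d%:R * F t (raise f j D)
     - (\sum_(j in supp f) \sum_(D : {set 'I_n} | j \in D) p t D / d%:R) * F t f.
    rewrite mulr_suml -sumrB; apply: eq_bigr => j _.
    by rewrite mulr_suml -sumrB; apply: eq_bigr => D _; rewrite mulrBr.
  have h : \sum_(j in supp f) \sum_(D : {set 'I_n} | j \in D) p t D / d%:R <= B%:R * b.
    apply: (@le_trans _ _ (\sum_(j in supp f) b)).
      by apply: ler_sum => j _; rewrite -mulr_suml ler_pdivrMr.
    rewrite sumr_const -[X in X <= _]mulr_natl ler_wpM2r // ler_nat.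
    exact: leq_trans (card_supp_mass f) fB.
  have := ler_wpM2r (F_ge0 t f) h; rewrite /y; lra.
apply: le_trans main; rewrite /= exprS mulrDr mulrDr.
apply: lerD.
  by rewrite -mulrA mulrC ler_wpM2r.
rewrite !mulr_sumr; apply: ler_sum => j jf.
rewrite /incr mulr_suml !mulr_sumr.
rewrite [X in _ <= X](bigID (fun D : {set 'I_n} => [forall i in D, good (f j).-1 t i])) /=.
apply: ler_wpDr; first by apply: sumr_ge0 => D _; rewrite mulr_ge0 // divr_ge0 // ltW.
apply: ler_sum => D /andP[jD gD].
have [->|qD] := eqVneq (p t D) 0; first by rewrite !mul0r !mulr0.
have cD : #|D| = d by case: (hp t) => _ _; apply.
have fj : (0 < f j)%N by move: jf; rewrite inE lt0n.
have raiseK i : (raise f j D i <= K)%N.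
  rewrite /raise geq_max; apply/andP; split; first by case: eqP.
  by case: ifP => // _; apply: leq_trans (leq_pred _) _.
have key : coef f * inj_mass t (upd f j 0) <= coef (raise f j D) * inj_mass t (raise f j D).
  have [f1|f1] := posnP (f j).-1.
    have -> : raise f j D = upd f j 0.
      apply: functional_extensionality => i; rewrite /raise /upd f1.
      by case: (i \in D); rewrite maxn0; case: eqP.
    rewrite ler_wpM2r ?inj_mass_ge0 //.
    have := coef_upd f j 0; have -> : c 0 = 1 by [].
    rewrite mul1r => <-; rewrite ler_piMl //; first exact/ltW/coef_gt0.
    by case/andP: (lower_coef01 (f j)).
  apply: (raise_bound tm' jf fB cD jD gD f1); apply: hB.
  by rewrite f1 /=; have := fK j; rewrite -{1}(prednK fj).
have IHr := IH _ tm' raiseK (leq_trans (mass_raise jf cD) fB).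
rewrite [X in X <= _](_ : _ = p t D / d%:R * (y * (y ^+ t * (coef f * inj_mass t (upd f j 0))))); last by ring.
apply: ler_wpM2l; first by rewrite divr_ge0 // ltW.
apply: le_trans IHr; apply: (@le_trans _ _ (y ^+ t * (coef f * inj_mass t (upd f j 0)))).
  rewrite ler_piMl // mulr_ge0 ?exprn_ge0 // mulr_ge0 ?inj_mass_ge0 //.
  exact/ltW/coef_gt0.
by rewrite ler_wpM2l // exprn_ge0.
Qed.

End Lower.

Section LowerMean.
Variables (R : realFieldType) (n d : nat) (p : nat -> {set 'I_n} -> R).
Variables (b : R) (delta : nat -> R).
Hypothesis d2 : (1 < d)%N.
Hypothesis hp : forall t, choice_law d (p t).
Hypothesis b0 : 0 <= b.
Hypothesis hpd : forall t j, \sum_(D : {set 'I_n} | j \in D) p t D <= b * d%:R.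
Hypothesis delta01 : forall k, 0 < delta k <= 1.

Local Notation good := (good d p delta).
Local Notation incr := (incr d p delta).
Local Notation expo := (expo d p delta).
Local Notation inj_mass := (inj_mass d p delta).

Let p0 t D : 0 <= p t D. Proof. by case: (hp t). Qed.
Let dR : 0 < d%:R :> R. Proof. by rewrite ltr0n ltnW. Qed.

Definition good_mass k t : R :=
  \sum_(D : {set 'I_n} | [forall j in D, good k t j]) p t D.

Lemma inj_mass_zero t : inj_mass t (fun=> 0%N) = 1.
Proof.
elim: t => [|t IH] /=; first by case: forallP => // -[].
by rewrite IH big_pred0 ?addr0 // => i; rewrite inE.
Qed.

(** Double counting: each good set appears once for each of its [d] bins, with weight [1 / d]. *)
Lemma sum_expo k m : \sum_(i < n) expo k.+1 m i = \sum_(t < m) good_mass k t.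
Proof.
rewrite exchange_big /=; apply: eq_bigr => t _.
rewrite /incr /good_mass /= (exchange_big_dep (fun D : {set 'I_n} => [forall j in D, good k t j])) /=;
  last by move=> i D _ /andP[].
apply: eq_bigr => D gD; have [->|qD] := eqVneq (p t D) 0.
  by rewrite big1 // => i _; rewrite mul0r.
rewrite (eq_bigl (mem D)) => [|i]; last by rewrite gD andbT.
rewrite sumr_const; case: (hp t) => _ _ /(_ _ qD) ->.
by rewrite -[LHS]mulr_natr divfK // gt_eqF.
Qed.

Lemma good_mass0 t : good_mass 0 t = 1.
Proof.
case: (hp t) => _ <- _; apply: eq_bigl => D; by apply/forall_inP.
Qed.

(** A set that is good for [k] but not for [k.+1] contains a bin still below its threshold, and its
    probability is charged to that bin. *)
Lemma good_mass_loss k t : good_mass k t <= good_mass k.+1 t +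
  \sum_(i < n) d%:R * (if expo k.+1 t i < delta k.+1 then incr k.+1 t i else 0).
Proof.
rewrite /good_mass [X in X <= _](bigID (fun D : {set 'I_n} => [forall j in D, good k.+1 t j])) /=.
apply: lerD.
  rewrite big_mkcond [X in _ <= X]big_mkcond; apply: ler_sum => D _.
  by case: [forall j in D, good k t j] => //=; case: ifP.
apply: (@le_trans _ _ (\sum_(i < n) \sum_(D : {set 'I_n} | (i \in D) && [forall j in D, good k t j])
   if expo k.+1 t i < delta k.+1 then p t D else 0)); last first.
  apply: ler_sum => i _; case: ifP => _; last by rewrite big1 // mulr0.
  by rewrite /incr -mulr_suml mulrC divfK // gt_eqF.
rewrite (exchange_big_dep (fun D : {set 'I_n} => [forall j in D, good k t j])) /=;
  last by move=> i D _ /andP[].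
rewrite big_mkcondr /=; apply: ler_sum => D gD.
have H i : 0 <= if expo k.+1 t i < delta k.+1 then p t D else 0 by case: ifP.
case: ifP => [/forall_inPn [i iD ngi]|_]; last by apply: sumr_ge0.
rewrite (bigD1 i) /=; last by rewrite iD gD.
rewrite ifT; first by rewrite lerDl sumr_ge0.
by rewrite ltNge -(goodS d p delta).
Qed.

(** The exposure collected before the threshold can overshoot it only by the last increment, which
    is at most [b]. *)
Lemma exposed_before_good k m i :
  \sum_(t < m) (if expo k t i < delta k then incr k t i else 0) <= delta k + b.
Proof.
have /andP[/ltW d0 _] := delta01 k.
suff H : \sum_(t < m) (if expo k t i < delta k then incr k t i else 0) <= delta k + b
   /\ \sum_(t < m) (if expo k t i < delta k then incr k t i else 0) <= expo k m i by case: H.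
elim: m => [|m [IH1 IH2]]; first by rewrite !big_ord0 addr_ge0 // expo_ge0.
rewrite !big_ord_recr /= expoS; case: ifP => h; last first.
  by rewrite !addr0; split=> //; apply: le_trans IH2 _; rewrite lerDl incr_ge0.
split; last by rewrite lerD2r.
by apply: lerD; [apply: le_trans IH2 (ltW h)|apply: incr_le].
Qed.

Lemma good_mass_sum k m :
  m%:R - n%:R * d%:R * \sum_(l < k) (delta l.+1 + b) <= \sum_(t < m) good_mass k t.
Proof.
elim: k => [|k IH].
  rewrite big_ord0 mulr0 subr0 (eq_bigr (fun=> 1)) ?sumr_const ?card_ord //.
  by move=> t _; rewrite good_mass0.
have H : \sum_(t < m) good_mass k t <=
    \sum_(t < m) good_mass k.+1 t + n%:R * d%:R * (delta k.+1 + b).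
  apply: (@le_trans _ _ (\sum_(t < m) (good_mass k.+1 t +
      \sum_(i < n) d%:R * (if expo k.+1 t i < delta k.+1 then incr k.+1 t i else 0)))).
    by apply: ler_sum => t _; exact: good_mass_loss.
  rewrite big_split /= lerD2l exchange_big /=.
  apply: (@le_trans _ _ (\sum_(i < n) d%:R * (delta k.+1 + b))).
    by apply: ler_sum => i _; rewrite -mulr_sumr ler_wpM2l // exposed_before_good.
  by rewrite sumr_const card_ord -[X in X <= _]mulr_natl mulrA.
rewrite big_ord_recr /= mulrDr; lra.
Qed.

Variable F : nat -> ('I_n -> nat) -> R.
Hypothesis F_ge0 : forall t f, 0 <= F t f.
Hypothesis F0 : forall f, F 0 f = [forall i, f i == 0%N]%:R.
Hypothesis F_rec : forall t f, F t f + \sum_(j in supp f) \sum_(D : {set 'I_n} | j \in D)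
     p t D / d%:R * (F t (raise f j D) - F t f) <= F t.+1 f.

Lemma mean_lower K m : m%:R * b <= 1 -> (d ^ K.+1)%:R * b <= 1 ->
  (forall l, (0 < l <= K)%N -> 4 * (d ^ K.+1)%:R * b <= delta l) ->
  (1 - (d ^ K.+1)%:R * b) ^+ m * lower_coef d delta K.+1 *
   (m%:R - n%:R * d%:R * \sum_(l < K) (delta l.+1 + b))
  <= \sum_(i < n) F m (upd (fun=> 0%N) i K.+1).
Proof.
move=> mb Bb hB.
have c0 : 0 <= lower_coef d delta K.+1 by apply: ltW; case/andP: (lower_coef01 d delta01 K.+1).
have y0 : 0 <= (1 - (d ^ K.+1)%:R * b) ^+ m by rewrite exprn_ge0 // subr_ge0.
apply: le_trans (ler_wpM2l _ (good_mass_sum K m)) _; first by rewrite mulr_ge0.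
rewrite -sum_expo mulr_sumr; apply: ler_sum => i _.
have sE : supp (upd (fun=> 0%N) i K.+1) = [set i].
  by rewrite supp_upd //; apply/setP => j; rewrite !inE /= orbF.
have := @demand_lower R n d p b delta d2 hp b0 hpd delta01 m (d ^ K.+1) mb F F_ge0 F0 F_rec Bb
  K.+1 m (upd (fun=> 0%N) i K.+1) (leqnn m) _ _ hB.
move=> H; apply: le_trans (H _ _).
- rewrite -mulrA ler_wpM2l //.
  have -> : coef d delta (upd (fun=> 0%N) i K.+1) = lower_coef d delta K.+1.
    rewrite /coef (bigD1 i) //= /upd eqxx big1 ?mulr1 // => j /negbTE ->; by [].
  rewrite ler_wpM2l //.
  apply: le_trans (inj_mass_lower delta d2 hp b0 hpd m (k := K.+1) (f := fun=> 0%N) (i := i) _ _) => //.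
  have -> : @supp n (fun=> 0%N) = set0 by apply/setP => j; rewrite !inE.
  by rewrite inj_mass_zero mulr1 cards0 mul0r subr0.
- by move=> j; rewrite /upd; case: eqP.
- by rewrite /mass sE big_set1 /upd eqxx.
Qed.

End LowerMean.

(** * The law of the process *)

Definition draws n d (e : {set 'I_n}) : {set {set 'I_n}} :=
  [set D : {set 'I_n} | (D \subset e) && (#|D| == d)].

Definition edge_law (R : realType) n d (E : {set {set 'I_n}}) (D : {set 'I_n}) : R :=
  \sum_(e : {set 'I_n}) uniform_pmf R E e * uniform_pmf R (draws d e) D.

Section EdgeLaw.
Variables (R : realType) (n d s : nat).
Implicit Types (e D : {set 'I_n}) (E : {set {set 'I_n}}).

Lemma uniform_pmf_ge0 (T : finType) (A : {set T}) x : 0 <= uniform_pmf R A x.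
Proof. by rewrite /uniform_pmf; case: ifP => // _; rewrite invr_ge0 ler0n. Qed.

Lemma uniform_pmf_sum (T : finType) (A : {set T}) (P : pred T) :
  \sum_(x | P x) uniform_pmf R A x = #|[set x in A | P x]|%:R / #|A|%:R.
Proof.
rewrite /uniform_pmf -big_mkcondr /= sumr_const -[LHS]mulr_natl; congr (_%:R * _).
by apply: eq_card => x; rewrite inE andbC.
Qed.

Lemma uniform_pmf_total (T : finType) (A : {set T}) :
  A != set0 -> \sum_x uniform_pmf R A x = 1.
Proof.
move=> A0; rewrite uniform_pmf_sum (_ : [set x in A | predT x] = A).
  by rewrite divff // pnatr_eq0 cards_eq0.
by apply/setP => x; rewrite inE andbT.
Qed.

Lemma card_draws_in e : #|draws d e| = 'C(#|e|, d).
Proof. exact: cards_draws. Qed.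

Lemma card_draws_mem e i : (0 < d)%N -> i \in e ->
  #|[set D : {set 'I_n} in draws d e | i \in D]| = 'C(#|e|.-1, d.-1).
Proof.
move=> d0 ie; have := cardsID [set D : {set 'I_n} | i \in D] (draws d e).
have -> : draws d e :\: [set D : {set 'I_n} | i \in D] = draws d (e :\ i).
  by apply/setP => D; rewrite !inE subsetD1; case: (i \in D); rewrite ?andbF ?andbT.
rewrite !card_draws_in; have -> : #|e :\ i| = #|e|.-1 by rewrite (cardsD1 i e) ie.
have e0 : (0 < #|e|)%N by rewrite card_gt0; apply/set0Pn; exists i.
have -> : 'C(#|e|, d) = ('C(#|e|.-1, d) + 'C(#|e|.-1, d.-1))%N.
  by rewrite -{1}(prednK e0) -{1}(prednK d0) binS prednK.
rewrite addnC => /addnI <-; apply: eq_card => D; by rewrite !inE.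
Qed.

Lemma card_draws_mem2 e i j : (1 < d)%N -> i != j -> i \in e -> j \in e ->
  #|[set D : {set 'I_n} in draws d e | (i \in D) && (j \in D)]| = 'C(#|e|.-2, d.-2).
Proof.
move=> d1 ij ie je.
have := cardsID [set D : {set 'I_n} | j \in D] [set D : {set 'I_n} in draws d e | i \in D].
have -> : [set D : {set 'I_n} in draws d e | i \in D] :\: [set D : {set 'I_n} | j \in D]
   = [set D : {set 'I_n} in draws d (e :\ j) | i \in D].
  apply/setP => D; rewrite !inE subsetD1.
  by case: (j \in D); rewrite ?andbF ?andbT.
rewrite !card_draws_mem ?(ltnW d1) //; last by rewrite !inE ij.
have -> : #|e :\ j| = #|e|.-1 by rewrite (cardsD1 j e) je.
have e1 : (1 < #|e|)%N.
  have : (#|[set i; j]| <= #|e|)%N.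
    by apply: subset_leq_card; apply/subsetP => k; rewrite !inE => /orP[/eqP->|/eqP->].
  by rewrite cards2 ij.
have -> : 'C(#|e|.-1, d.-1) = ('C(#|e|.-2, d.-1) + 'C(#|e|.-2, d.-2))%N.
  have e2 : (0 < #|e|.-1)%N by lia.
  have d3 : (0 < d.-1)%N by lia.
  by rewrite -{1}(prednK e2) -{1}(prednK d3) binS prednK.
rewrite addnC => /addnI <-; apply: eq_card => D; by rewrite !inE andbA.
Qed.

Lemma draw_mem_prob e i : (0 < d)%N -> (d <= #|e|)%N ->
  \sum_(D : {set 'I_n} | i \in D) uniform_pmf R (draws d e) D = (i \in e)%:R * (d%:R / #|e|%:R).
Proof.
move=> d0 de; rewrite uniform_pmf_sum card_draws_in.
have [ie|ie] := boolP (i \in e); last first.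
  rewrite (_ : [set D : {set 'I_n} in draws d e | i \in D] = set0) ?cards0 ?mul0r //.
  apply/setP => D; rewrite !inE; apply: contraNF ie => /andP[/andP[De _]]; exact: (subsetP De).
rewrite card_draws_mem // mul1r; apply/eqP.
rewrite eqr_div ?pnatr_eq0 -?lt0n ?bin_gt0 //; last exact: leq_trans de.
by rewrite -!natrM eqr_nat mulnC -[in X in _ == X](prednK d0) -mul_bin_diag.
Qed.

(** With [z = #|e|] the exact value is [d * (d - 1) / (z * (z - 1))], and
    [(d - 1) / (z - 1) <= d / z] because [d <= z]. *)
Lemma draw_mem2_prob e i j : (1 < d)%N -> (d <= #|e|)%N -> i != j ->
  \sum_(D : {set 'I_n} | (i \in D) && (j \in D)) uniform_pmf R (draws d e) D
  <= ((i \in e) && (j \in e))%:R * (d%:R / #|e|%:R) ^+ 2.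
Proof.
move=> d1 de ij; rewrite uniform_pmf_sum card_draws_in.
have [/andP[ie je]|ie] := boolP ((i \in e) && (j \in e)); last first.
  rewrite (_ : [set D : {set 'I_n} in draws d e | _] = set0) ?cards0 ?mul0r //.
  apply/setP => D; rewrite !inE; apply: contraNF ie => /andP[/andP[De _] /andP[iD jD]].
  by rewrite !(subsetP De).
rewrite card_draws_mem2 // mul1r.
move: de; set z := #|e| => de.
have z1 : (1 < z)%N by apply: leq_trans de.
have E : (z * z.-1 * 'C(z.-2, d.-2) = d * d.-1 * 'C(z, d))%N.
  case: (d) d1 => [|[|k]] //= _; case: (z) z1 => [|[|y]] //= _.
  rewrite -mulnA (mul_bin_diag y.+1 k) mulnCA (mul_bin_diag y.+2 k.+1).
  by rewrite mulnCA mulnA.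
rewrite expr_div_n ler_pdivrMr ?ltr0n ?bin_gt0 // mulrAC ler_pdivlMr ?exprn_gt0 ?ltr0n ?(ltnW z1) //.
rewrite -!natrX -!natrM ler_nat.
have zz : (0 < z * z.-1)%N by rewrite muln_gt0; lia.
rewrite -(leq_pmul2l zz).
have -> : (z * z.-1 * ('C(z.-2, d.-2) * z ^ 2) = d * d.-1 * 'C(z, d) * z ^ 2)%N by rewrite mulnA E.
have -> : (d * d.-1 * 'C(z, d) * z ^ 2 = 'C(z, d) * (d * z) * (d.-1 * z))%N by ring.
have -> : (z * z.-1 * (d ^ 2 * 'C(z, d)) = 'C(z, d) * (d * z) * (d * z.-1))%N by ring.
rewrite leq_mul2l; apply/orP; right; case: (d) d1 de => // k _; case: (z) => // y kz /=; nia.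
Qed.

Variable E : {set {set 'I_n}}.
Hypothesis E0 : E != set0.
Hypothesis Es : forall e, e \in E -> #|e| = s.
Hypothesis d1 : (1 < d)%N.
Hypothesis ds : (d <= s)%N.

Lemma edge_law_choice : choice_law d (edge_law R d E).
Proof.
have term0 e D : 0 <= uniform_pmf R E e * uniform_pmf R (draws d e) D.
  by rewrite mulr_ge0 ?uniform_pmf_ge0.
split.
- by move=> D; apply: sumr_ge0.
- rewrite /edge_law exchange_big /= -(uniform_pmf_total E0); apply: eq_bigr => e _.
  rewrite -mulr_sumr /uniform_pmf; case: ifP => eE; last by rewrite mul0r.
  rewrite uniform_pmf_total ?mulr1 // -card_gt0 card_draws_in bin_gt0 Es //.
- move=> D; apply: contraNeq => Dd; rewrite /edge_law big1 // => e _.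
  by rewrite {2}/uniform_pmf inE (negbTE Dd) andbF mulr0.
Qed.

Lemma edge_law_mem i : \sum_(D : {set 'I_n} | i \in D) edge_law R d E D =
  (\sum_(e : {set 'I_n} | i \in e) uniform_pmf R E e) * (d%:R / s%:R).
Proof.
rewrite exchange_big /= mulr_suml [RHS]big_mkcond /=; apply: eq_bigr => e _.
rewrite -mulr_sumr {1 3}/uniform_pmf; case: ifP => eE; last by rewrite !mul0r; case: ifP.
rewrite draw_mem_prob ?Es ?(ltnW d1) //; case: ifP => _; first by rewrite mul1r.
by rewrite mul0r mulr0.
Qed.

(** Balance is applied to [i] only; [j] enters through the indicator that some edge contains both
    bins and through the second factor [d / s] of the draw. *)
Lemma edge_law_mem2 i j : i != j ->
  \sum_(D : {set 'I_n} | (i \in D) && (j \in D)) edge_law R d E D <=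
  [exists e in E, [set i; j] \subset e]%:R *
  (\sum_(e : {set 'I_n} | i \in e) uniform_pmf R E e) * (d%:R / s%:R) ^+ 2.
Proof.
move=> ij; rewrite exchange_big /= -mulrA mulr_suml mulr_sumr [X in _ <= X]big_mkcond /=.
apply: ler_sum => e _; rewrite -mulr_sumr.
have t0 : 0 <= (d%:R / s%:R) ^+ 2 :> R by rewrite exprn_ge0 // divr_ge0.
have [eE|eE] := boolP (e \in E); last first.
  by rewrite /uniform_pmf (negbTE eE) !mul0r mulr0; case: ifP.
apply: (@le_trans _ _ (uniform_pmf R E e * (((i \in e) && (j \in e))%:R * (d%:R / s%:R) ^+ 2))).
  by rewrite ler_wpM2l ?uniform_pmf_ge0 // -(Es eE) draw_mem2_prob ?Es.
case: ifP => ie; last by rewrite mul0r mulr0.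
case je: (j \in e); last by rewrite mul0r mulr0 mulr_ge0 // mulr_ge0 ?uniform_pmf_ge0.
rewrite (_ : [exists e in E, _] = true) ?mul1r //; apply/exists_inP; exists e => //.
by apply/subsetP => k; rewrite !inE => /orP[/eqP->|/eqP->].
Qed.

End EdgeLaw.

Section Process.
Variables (R : realType) (n d : nat) (H : dynamic_hypergraph n) (i0 : 'I_n).

(** Indices outside the range get the hypergraph of the default round [i0], so that the chain has a
    law at every natural number; for [t < n] the default is not read. *)
Definition round_law (t : nat) (D : {set 'I_n}) : R :=
  edge_law R d (H (odflt i0 (insub t))) D.

Hypothesis d0 : (0 < d)%N.
Hypothesis hlaw : forall t, choice_law d (round_law t).

Local Notation choice := ({set 'I_n} * {set 'I_n} * 'I_n)%type.

Definition play (w : trajectory n) (j : 'I_n) (y : choice) : trajectory n :=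
  [ffun t => if t == j then y else w t].

Definition round_pmf (w : trajectory n) (t : 'I_n) (y : choice) : R :=
  uniform_pmf R (H t) y.1.1 * uniform_pmf R (draws d y.1.1) y.1.2 *
  uniform_pmf R (least_loaded (load w t) y.1.2) y.2.

Definition partial_pmf k (w : trajectory n) : R :=
  \prod_(t < n | (t < k)%N) round_pmf w t (w t).

(* The first [k] rounds determine [partial_pmf k]; the remaining [n - k] entries of
   the trajectory are averaged out uniformly. *)
Definition partial_mean k (psi : trajectory n -> R) : R :=
  (\sum_w partial_pmf k w * psi w) / #|{: choice}|%:R ^+ (n - k).

Lemma load_play w (j : 'I_n) y k : (k <= j)%N -> load (play w j y) k = load w k.
Proof.
move=> kj; apply: functional_extensionality => i; apply: eq_card => t; rewrite !inE.
case tk: (t < k)%N => //=; rewrite /receiving_bin ffunE.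
by case: (t =P j) => // tj; move: tk; rewrite tj ltnNge kj.
Qed.

Lemma load_playS w (j : 'I_n) y : load (play w j y) j.+1 = add_ball (load w j) y.2.
Proof.
apply: functional_extensionality => i; rewrite /add_ball -(load_play w y (leqnn j)) /load.
rewrite (cardsD1 j) addnC; congr (_ + _)%N.
  apply: eq_card => t; rewrite !inE ltnS; case: (t =P j) => [->|/eqP tj] /=; first by rewrite ltnn.
  by rewrite leq_eqVlt (negbTE (_ : nat_of_ord t != j)) //.
by rewrite inE ltnSn /= /receiving_bin ffunE eqxx eq_sym.
Qed.

Lemma round_pmf_play w (j t : 'I_n) y z : (t <= j)%N ->
  round_pmf (play w j y) t z = round_pmf w t z.
Proof. by move=> tj; rewrite /round_pmf load_play. Qed.

Lemma partial_pmf_play w (j : 'I_n) y :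
  partial_pmf j.+1 (play w j y) = partial_pmf j w * round_pmf w j y.
Proof.
rewrite /partial_pmf (bigD1 j) //= mulrC; congr (_ * _); last first.
  by rewrite round_pmf_play // ffunE eqxx.
rewrite (eq_bigl (fun t : 'I_n => t < j)%N) => [|t]; last first.
  by rewrite ltnS [(t < j)%N]ltn_neqAle andbC.
apply: eq_bigr => t tj; rewrite round_pmf_play ?(ltnW tj) // ffunE ifF //.
by apply/eqP => tj'; move: tj; rewrite tj' ltnn.
Qed.

(** Exchanging [y] with the entry of round [j] is an involution, so each trajectory is met once for
    every value of the replaced entry. *)
Lemma sum_play (j : 'I_n) (h : trajectory n -> R) :
  \sum_w \sum_y h (play w j y) = #|{: choice}|%:R * \sum_w h w.
Proof.
pose sw (u : trajectory n * choice) := (play u.1 j u.2, u.1 j).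
have swK : involutive sw.
  move=> [w y]; rewrite /sw /= ffunE eqxx; congr (_, _).
  by apply/ffunP => t; rewrite !ffunE; case: eqP => // ->.
rewrite pair_big /= (reindex_inj (inv_inj swK)) /=.
rewrite -(pair_big xpredT xpredT (fun w y => h (play (play w j y) j (w j)))) /=.
rewrite mulr_sumr; apply: eq_bigr => w _.
rewrite mulr_natl -sumr_const; apply: eq_bigr => y _; congr h.
by apply/ffunP => t; rewrite !ffunE; case: eqP => // ->.
Qed.

Let N0 : #|{: choice}|%:R != 0 :> R.
Proof. by rewrite pnatr_eq0 -lt0n; apply/card_gt0P; exists (set0, set0, i0). Qed.

Lemma partial_meanS (j : 'I_n) psi :
  partial_mean j.+1 psi =
  partial_mean j (fun w => \sum_y round_pmf w j y * psi (play w j y)).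
Proof.
rewrite /partial_mean.
have -> : \sum_w partial_pmf j w * (\sum_y round_pmf w j y * psi (play w j y)) =
   #|{: choice}|%:R * \sum_w partial_pmf j.+1 w * psi w.
  rewrite -(sum_play j (fun w => partial_pmf j.+1 w * psi w)).
  apply: eq_bigr => w _; rewrite mulr_sumr; apply: eq_bigr => y _.
  by rewrite partial_pmf_play mulrA.
have -> : (n - j = (n - j.+1).+1)%N by rewrite subnSK.
by rewrite exprS invfM mulrACA divff // mul1r.
Qed.

Lemma round_step w (j : 'I_n) (g : ('I_n -> nat) -> R) :
  \sum_y round_pmf w j y * g (add_ball (load w j) y.2) =
  step (round_law j) g (load w j).
Proof.
rewrite -(pair_big xpredT xpredT (fun y z => round_pmf w j (y, z) * g (add_ball (load w j) z))) /=.
rewrite -(pair_big xpredT xpredT (fun e D => \sum_z round_pmf w j (e, D, z) * g (add_ball (load w j) z))) /=.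
rewrite exchange_big /=; apply: eq_bigr => D _.
rewrite /round_law /edge_law valK /= mulr_suml; apply: eq_bigr => e _.
rewrite mulr_suml mulr_sumr [in RHS]big_mkcond /=; apply: eq_bigr => z _.
rewrite /round_pmf /= {3}/uniform_pmf; case: ifP => _; last by rewrite mulr0 mul0r.
by rewrite -!mulrA [_^-1 * _]mulrC.
Qed.

Lemma partial_mean_load k g : (k <= n)%N ->
  partial_mean k (fun w => g (load w k)) = run round_law k g (fun=> 0%N).
Proof.
elim: k g => [|k IH] g kn.
  rewrite /partial_mean subn0 /= (eq_bigr (fun=> g (fun=> 0%N))) => [|w _].
    rewrite sumr_const card_ffun card_ord -[X in X / _ = _]mulr_natr natrX mulfK //.
    by rewrite expf_neq0.
  rewrite /partial_pmf big_pred0 ?mul1r => [|t]; last by rewrite ltn0.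
  congr g; apply: functional_extensionality => i; apply/eqP; rewrite cards_eq0.
  by apply/eqP/setP => t; rewrite !inE ltn0.
rewrite -[k.+1]/((Ordinal kn : nat).+1) partial_meanS /= -IH ?(ltnW kn) //.
congr (_ / _); apply: eq_bigr => w _; congr (_ * _).
rewrite -(round_step w (Ordinal kn)) /=; apply: eq_bigr => y _.
by rewrite load_playS.
Qed.

(** A later round leaves the first [k] loads untouched and has total mass one. *)
Lemma partial_mean_forget j k g : (k <= j <= n)%N ->
  partial_mean j (fun w => g (load w k)) = partial_mean k (fun w => g (load w k)).
Proof.
elim: j => [|j IH] /andP[kj jn]; first by move: kj; rewrite leqn0 => /eqP ->.
move: kj; rewrite leq_eqVlt => /orP[/eqP -> //|kj]; rewrite ltnS in kj.
rewrite -IH ?kj ?(ltnW jn) // -[j.+1]/((Ordinal jn : nat).+1) partial_meanS /=.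
congr (_ / _); apply: eq_bigr => w _; congr (_ * _).
rewrite (eq_bigr (fun y => round_pmf w (Ordinal jn) y * g (load w k))) => [|y _]; last first.
  by rewrite load_play.
rewrite (round_step w (Ordinal jn) (fun=> g (load w k))).
exact: step_const d0 (hlaw _).
Qed.

Lemma process_prob_load k (P : pred ('I_n -> nat)) : (k <= n)%N ->
  process_prob R d H [pred w | P (load w k)] =
  run round_law k (fun x => (P x)%:R) (fun=> 0%N).
Proof.
move=> kn; pose g x : R := (P x)%:R.
rewrite -(partial_mean_load g kn) -(@partial_mean_forget n k g) ?kn ?leqnn // /g.
rewrite /partial_mean subnn divr1 /process_prob big_mkcond /=; apply: eq_bigr => w _.
rewrite /partial_pmf (eq_bigl xpredT) => [|t]; last by rewrite ltn_ord.
by case: ifP => _; rewrite ?mulr1 ?mulr0.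
Qed.

End Process.

(** If all loads are at most [a * K.-1], this value is the base level of the next batch, whose tail
    bound holds from every such state. Missing the demand [K] means gaining at most [K.-1] above
    that level. *)
Lemma batches_bound (R : realFieldType) n d (p : nat -> {set 'I_n} -> R) m K N (tail : R) :
  (0 < d)%N -> (forall t, choice_law d (p t)) -> (0 < K)%N -> 0 <= tail ->
  (forall T x M i, (T + m <= N)%N -> (forall j, (x j <= M)%N) ->
    run (fun t => p (T + t)%N) m (fun y => (K <= y i - M)%N%:R) x <= tail) ->
  forall a, (a * m <= N)%N ->
  run p (a * m) (fun y => [exists i, (a * K.-1 < y i)%N]%:R) (fun=> 0%N) <=
    a%:R * (n%:R * tail).
Proof.
move=> d0 hp K0 tail0 hb; have p0 t D : 0 <= p t D by case: (hp t).
elim=> [|a IH] aN.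
  by rewrite !mul0n mul0r /=; case: existsP => // -[].
have aN' : (a * m <= N)%N by apply: leq_trans aN; rewrite leq_mul2r leqnSn orbT.
rewrite mulSnr run_add -natr1 mulrDl mul1r.
pose M := (a * K.-1)%N.
apply: (@le_trans _ _ (run p (a * m)
   (fun y => [exists i, (M < y i)%N]%:R + n%:R * tail) (fun=> 0%N))); last first.
  by rewrite runD // (run_const _ _ _ d0 hp) lerD2r; exact: IH.
apply: run_le => // y.
have hshift t : choice_law d (p (a * m + t)%N) by [].
have pS0 t D : 0 <= p (a * m + t)%N D by [].
have [ey|ny] := boolP [exists i, (M < y i)%N].
  apply: (@le_trans _ _ 1); last by rewrite lerDl mulr_ge0.
  rewrite -[X in _ <= X](run_const m 1 y d0 hshift); apply: run_le => // z.
  by case: [exists i, _].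
rewrite add0r; have yM j : (y j <= M)%N.
  by rewrite leqNgt; apply: contra ny => yj; apply/existsP; exists j.
apply: (@le_trans _ _ (\sum_(i < n) tail)); last by rewrite sumr_const card_ord mulr_natl.
apply: (@le_trans _ _ (run (fun t => p (a * m + t)%N) m
    (fun z => \sum_(i < n) (K <= z i - M)%N%:R) y)); last first.
  by rewrite run_sum //; apply: ler_sum => i _; apply: hb yM; rewrite -mulSnr.
apply: run_le => // z; case: existsP => [[i zi]|_]; last exact: sumr_ge0.
rewrite (bigD1 i) //= (_ : (K <= z i - M)%N) ?lerDl ?sumr_ge0 //.
by move: zi; rewrite mulSn /M; lia.
Qed.

(** * Both bounds for a fixed number of bins *)

Section PerN.
Variables (R : realType) (n d s : nat) (H : dynamic_hypergraph n) (i0 : 'I_n).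
Variables (beta : R).
Hypothesis d2 : (1 < d)%N.
Hypothesis ds : (d <= s)%N.
Hypothesis hunif : uniform_hypergraph s H.
Hypothesis hbal : balanced s beta H.
Hypothesis beta0 : 0 <= beta.

Local Notation b := (beta / n%:R).
Local Notation law := (round_law R d H i0).

Let d0 : (0 < d)%N. Proof. exact: ltnW. Qed.
Let s0 : (0 < s)%N. Proof. exact: leq_trans ds. Qed.
Let n0 : (0 < n)%N. Proof. by apply: leq_trans (ltn_ord i0). Qed.

Let b0 : 0 <= b. Proof. by rewrite divr_ge0. Qed.

Lemma round_law_choice t : choice_law d (law t).
Proof. by have [h1 h2] := hunif (odflt i0 (insub t)); apply: (edge_law_choice R h1 h2 ds). Qed.

Lemma round_law_mem t j : \sum_(D : {set 'I_n} | j \in D) law t D <= b * d%:R.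
Proof.
have [h1 h2] := hunif (odflt i0 (insub t)); rewrite (edge_law_mem R h2 d2 ds).
apply: (le_trans (ler_wpM2r _ (hbal (odflt i0 (insub t)) j))); first by rewrite divr_ge0.
rewrite le_eqVlt; apply/orP; left; apply/eqP; field.
by rewrite !pnatr_eq0 -!lt0n s0 n0.
Qed.

Lemma round_law_mem2 j l : j != l ->
  \sum_(t < n) \sum_(D : {set 'I_n} | (j \in D) && (l \in D)) law t D <=
  (viz H j l)%:R * (beta * s%:R / n%:R * (d%:R / s%:R) ^+ 2).
Proof.
move=> jl; rewrite /viz -sum1_card natr_sum mulr_suml [X in _ <= X]big_mkcond /=.
apply: ler_sum => t _; rewrite mul1r inE /round_law valK /=.
have [h1 h2] := hunif t; apply: (le_trans (edge_law_mem2 R h2 d2 ds jl)).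
case: ifP => _; last by rewrite !mul0r.
rewrite mul1r; apply: ler_wpM2r; last exact: hbal.
by rewrite exprn_ge0 // divr_ge0.
Qed.

Lemma process_prob_ge k (P : pred ('I_n -> nat)) (c : R) : (k <= n)%N ->
  run law k (fun x => (~~ P x)%:R) (fun=> 0%N) <= c ->
  1 - c <= process_prob R d H [pred w | P (load w k)].
Proof.
move=> kn hc; rewrite (process_prob_load d0 round_law_choice P kn).
have p0 t D : 0 <= law t D by case: (round_law_choice t).
rewrite lerBlDr; apply: le_trans (_ : run law k (fun x => (P x)%:R) (fun=> 0%N) +
    run law k (fun x => (~~ P x)%:R) (fun=> 0%N) <= _); last by rewrite lerD2l.
rewrite -runD // -[X in X <= _](run_const k 1 (fun=> 0%N) d0 round_law_choice).
by apply: run_le => // y; case: (P y); rewrite ?addr0 ?add0r.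
Qed.

Lemma upper_run (rho xi : R) L m ks J a :
  0 <= rho -> (forall j l, j != l ->
    (viz H j l)%:R * (beta * s%:R / n%:R * (d%:R / s%:R) ^+ 2) <= rho) ->
  (d <= L)%N -> (0 < m)%N -> 4096 * b * m%:R <= 1 -> 4096 * b * d%:R <= 1 ->
  512 * (32 ^ d * L)%:R ^+ 2 * rho <= (1024 * d%:R)^-1 ->
  (1 < ks)%N -> 0 < xi <= 1 / 4 -> 2 ^- (d ^ ks.-1 + 2) <= xi ->
  (forall k, (1 < k < ks)%N -> xi <= 2 ^- (d ^ k.-1 + 2)) ->
  512 * (L + d ^ (ks + J))%:R ^+ 2 * rho <= xi -> (a * m <= n)%N ->
  run law (a * m) (fun y => (~~ [forall i, (y i <= a * (ks + J).-1)%N])%:R) (fun=> 0%N) <=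
  a%:R * (n%:R * (4 * xi ^+ J.+1 +
    4 * ((2 * d)%:R ^+ ((ks + J) * d ^ (ks + J)) / 2 ^+ (L - d)))).
Proof.
move=> rho0 hrho dL m0 bm bd hL ks2 hxi hks hlt hxi2 am.
set tail := _ + _.
have tail0 : 0 <= tail.
  by rewrite addr_ge0 ?mulr_ge0 ?exprn_ge0 ?invr_ge0 ?exprn_ge0 //; case/andP: hxi => /ltW.
have p0 t D : 0 <= law t D by case: (round_law_choice t).
have K0 : (0 < ks + J)%N by apply: leq_trans (ltnW ks2) _; rewrite leq_addr.
apply: le_trans (batches_bound d0 round_law_choice K0 tail0 _ am).
  apply: run_le => // y; rewrite ler_nat negb_forall.
  rewrite (eq_existsb (P2 := fun i => a * (ks + J).-1 < y i)%N) // => i.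
  by rewrite -ltnNge.
move=> T x M i Tm xM.
have sys := @demand_prob_system R n d (fun t => law (T + t)%N) M x d0
  (fun t => round_law_choice (T + t)).
have hrho' j l : j != l -> \sum_(t < m) \sum_(D : {set 'I_n} | (j \in D) && (l \in D)) law (T + t)%N D <= rho.
  move=> jl; apply: le_trans (hrho j l jl); apply: le_trans (round_law_mem2 jl).
  apply: (sum_shift_le (h := fun t => \sum_(D : {set 'I_n} | (j \in D) && (l \in D)) law t D)) => //.
  by move=> t; apply: sumr_ge0.
have := upper_tail i d2 sys b0 (fun t => round_law_mem (T + t)) rho0 hrho' dL m0 bm bd hL ks2 hxi
  hks hlt hxi2 (fun f => demand_prob0 _ f xM).
apply: le_trans; rewrite /demand_prob; apply: run_le => // y; rewrite ler_nat.
case Ky: (ks + J <= y i - M)%N => //; rewrite (_ : sat _ _ _) //; apply/forallP => j.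
by case: (j =P i) => [->|].
Qed.

Lemma lower_mean (delta : nat -> R) K m : (forall k, 0 < delta k <= 1) ->
  m%:R * b <= 1 -> (d ^ K.+1)%:R * b <= 1 ->
  (forall l, (0 < l <= K)%N -> 4 * (d ^ K.+1)%:R * b <= delta l) ->
  (1 - (d ^ K.+1)%:R * b) ^+ m * lower_coef d delta K.+1 *
   (m%:R - n%:R * d%:R * \sum_(l < K) (delta l.+1 + b))
  <= run law m (fun y => #|[set i | (K < y i)%N]|%:R) (fun=> 0%N).
Proof.
move=> hdel mb Bb hB.
have p0 t D : 0 <= law t D by case: (round_law_choice t).
have hF0 : forall f, demand_prob law 0 (fun=> 0%N) 0 f = [forall i, f i == 0%N]%:R.
  by move=> f; apply: demand_prob0.
have hFge t f : 0 <= demand_prob law 0 (fun=> 0%N) t f by apply: run_ge0.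
apply: le_trans (mean_lower d2 round_law_choice b0 round_law_mem hdel hFge hF0
  (fun t f => demand_prob_lower (fun=> 0%N) t f d0 round_law_choice) mb Bb hB) _.
rewrite -run_sum //; apply: run_le => // y.
rewrite -sum1_card natr_sum [X in _ <= X]big_mkcond /=; apply: ler_sum => i _.
rewrite inE; case sy: (sat _ _ _); last by case: ifP.
by move/forallP/(_ i): sy; rewrite /upd eqxx subn0 => ->.
Qed.

End PerN.

Lemma lipschitz_count (R : realFieldType) n K :
  load_lipschitz (fun y : 'I_n -> nat => #|[set i | (K < y i)%N]|%:R : R).
Proof.
move=> x i; have sub : [set j | (K < x j)%N] \subset [set j | (K < add_ball x i j)%N].
  by apply/subsetP => j; rewrite !inE /add_ball; lia.
rewrite subr_ge0 ler_nat subset_leq_card //= lerBlDr -(natrD _ 1%N) ler_nat -(cards1 i).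
apply: leq_trans (leq_card_setU _ _); apply: subset_leq_card; apply/subsetP => j.
by rewrite !inE /add_ball; case: (j =P i) => //= _; rewrite addn0.
Qed.

From mathcomp Require Import all_classical all_reals all_analysis.

Import numFieldNormedType.Exports.

Local Open Scope classical_set_scope.
Local Open Scope ring_scope.

(** * Concentration and asymptotics *)

(** Each round costs a factor [expR (lam ^+ 2)]: near the current state the exponential is bounded
    by an affine function of [g], which [step] averages exactly. The averaged [g] is again
    Lipschitz, so the bound iterates. *)
Lemma run_expR (R : realType) n d (p : nat -> {set 'I_n} -> R) k g x (lam : R) :
  (0 < d)%N -> (forall t, choice_law d (p t)) -> load_lipschitz g -> 0 <= lam <= 1 ->
  run p k (fun y => expR (- lam * g y)) x <= expR (k%:R * lam ^+ 2 - lam * run p k g x).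
Proof.
move=> d0 hp + /andP[l0 l1]; elim: k g => [|k IH] g gl /=.
  by rewrite mul0r add0r mulNr.
have p0 t D : 0 <= p t D by case: (hp t).
have H y : step (p k) (fun z => expR (- lam * g z)) y <=
    expR (lam ^+ 2) * expR (- lam * step (p k) g y).
  set a := g y.
  apply: (@le_trans _ _ (step (p k) (fun z => expR (- lam * a) * (1 + lam * a + lam ^+ 2) +
     expR (- lam * a) * - lam * g z) y)).
    apply: step_le_at => // b.
    have /andP[z0 z1] := gl y b; set z := g (add_ball y b) - g y in z0 z1.
    have -> : g (add_ball y b) = a + z by rewrite /a /z addrC subrK.
    have -> : - lam * (a + z) = - lam * a + - (lam * z) by ring.
    rewrite expRD.
    have -> : expR (- lam * a) * (1 + lam * a + lam ^+ 2) + expR (- lam * a) * - lam * (a + z)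
      = expR (- lam * a) * (1 - lam * z + lam ^+ 2) by ring.
    rewrite ler_wpM2l ?expR_ge0 // expRN.
    (* The claim is [expR (- u) <= 1 - u + lam ^+ 2], which follows from [expR u >= 1 + u] and
       [(1 + u) * (1 - u + lam ^+ 2) >= 1] for [u <= lam <= 1]. *)
    set u := lam * z; have u0 : 0 <= u by rewrite mulr_ge0.
    have ul : u <= lam by rewrite ler_piMr.
    have eu := expR_ge1Dx u.
    rewrite invf_ple ?posrE ?expR_gt0 //; last by nra.
    apply: le_trans eu; rewrite -[X in X <= _]mul1r ler_pdivrMr; last by nra.
    by nra.
  rewrite stepD (step_const _ _ d0 (hp k)) stepZ.
  have -> : expR (- lam * a) * (1 + lam * a + lam ^+ 2) + expR (- lam * a) * - lam * step (p k) g y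
     = expR (- lam * a) * (1 + (lam * a + lam ^+ 2 - lam * step (p k) g y)) by ring.
  rewrite -expRD.
  apply: le_trans (ler_wpM2l (expR_ge0 _) (expR_ge1Dx _)) _; rewrite -expRD.
  by rewrite le_eqVlt; apply/orP; left; apply/eqP; congr expR; ring.
apply: le_trans (run_le k x p0 H) _; rewrite runZ //.
apply: le_trans (ler_wpM2l (expR_ge0 _) (IH _ (lipschitz_step d0 (hp k) gl))) _.
rewrite -expRD le_eqVlt; apply/orP; left; apply/eqP; congr expR.
by rewrite -natr1; ring.
Qed.

Lemma ln_near (R : realType) (M : R) : \forall n \near \oo, M <= ln n%:R.
Proof.
near=> n; have hn : expR M <= n%:R by near: n; exact: nbhs_infty_ger.
by rewrite -[M]expRK ler_ln ?posrE ?expR_gt0 // (lt_le_trans (expR_gt0 M)).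
Unshelve. all: by end_near. Qed.

Lemma powR_expR (R : realType) (n : nat) (e : R) : (0 < n)%N ->
  n%:R `^ e = expR (e * ln n%:R).
Proof. by move=> n0; rewrite /powR pnatr_eq0 -leqn0 leqNgt n0. Qed.

Lemma polylog_near (R : realType) (A e : R) p : 0 < e ->
  \forall n \near \oo, A * ln n%:R ^+ p <= n%:R `^ e.
Proof.
move=> e0; near=> n.
have n0 : (0 < n)%N by near: n; exact: nbhs_infty_gt.
have y0 : 0 <= ln n%:R :> R by near: n; exact: ln_near.
have yA : A * (p.+1)`!%:R / e ^+ p.+1 <= ln n%:R by near: n; exact: ln_near.
rewrite powR_expR //; set y : R := ln n%:R in y0 yA *.
have f0 : 0 < (p.+1)`!%:R :> R by rewrite ltr0n fact_gt0.
have ey : 0 <= e * y by rewrite mulr_ge0 // ltW.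
have := expR_ge1Dxn p ey; apply: le_trans.
apply: (@le_trans _ _ ((e * y) ^+ p.+1 / (p.+1)`!%:R)); last by rewrite lerDr.
rewrite ler_pdivlMr // exprMn [y ^+ p.+1]exprS.
rewrite ler_pdivrMr ?exprn_gt0 // in yA.
have : A * (p.+1)`!%:R * y ^+ p <= y * e ^+ p.+1 * y ^+ p by rewrite ler_wpM2r // exprn_ge0.
by rewrite mulrAC [e ^+ _ * _]mulrA [y * e ^+ _]mulrC.
Unshelve. all: by end_near. Qed.

Lemma half_le_ln2 (R : realType) : 1 / 2 <= ln 2 :> R.
Proof.
have h : -1 < - (1 / 2) :> R by lra.
have := le_ln1Dx h; have -> : 1 - 1 / 2 = 2^-1 :> R by lra.
by rewrite lnV ?posrE //; lra.
Qed.

Lemma ln2_le1 (R : realType) : ln 2 <= 1 :> R.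
Proof. by have := @le_ln1Dx R 1; apply; lra. Qed.

Lemma natr_expR (R : realType) (a : nat) k : (0 < a)%N ->
  a%:R ^+ k = expR (k%:R * ln a%:R) :> R.
Proof. by move=> a0; rewrite expRM_natl lnK // posrE ltr0n. Qed.

Lemma least_level (R : realType) d (Z : R) : (1 < d)%N ->
  exists ks, [/\ (1 < ks)%N, Z <= 2 ^+ (d ^ ks.-1 + 2) &
    forall k, (1 < k < ks)%N -> 2 ^+ (d ^ k.-1 + 2) < Z].
Proof.
move=> d2; pose P k := (1 < k)%N && (Z <= 2 ^+ (d ^ k.-1 + 2)).
have exP : exists k, P k.
  exists (Num.truncn Z).+2; rewrite /P /=.
  apply: (@le_trans _ _ (Num.truncn Z).+1%:R); first exact/ltW/truncnS_gt.
  rewrite -natrX ler_nat; apply: (@leq_trans (2 ^ (d ^ (Num.truncn Z).+1))); last first.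
    by rewrite leq_exp2l // leq_addr.
  apply: leq_trans (ltnW (ltn_expl _ (ltnSn 1))); exact: ltnW (ltn_expl _ d2).
case: (ex_minnP exP) => ks /andP[k2 Zk] kmin; exists ks; split=> // k /andP[k1 kk].
rewrite ltNge; apply/negP => h; have := kmin k; rewrite /P k1 h => /(_ isT).
by rewrite leqNgt kk.
Qed.

Lemma power_bracket (R : realType) d (y : R) : (1 < d)%N -> d%:R <= y ->
  exists K, d%:R ^+ K.+1 <= y < d%:R ^+ K.+2.
Proof.
move=> d2 dy; pose P k := y < d%:R ^+ k.
have exP : exists k, P k.
  exists (Num.truncn y).+1; apply: lt_le_trans (truncnS_gt _) _.
  by rewrite -natrX ler_nat ltnW // ltn_expl.
case: (ex_minnP exP) => -[|[|K]] Pk kmin.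
- by move: Pk; rewrite /P expr0 ltNge (le_trans _ dy) // ler1n ltnW.
- by move: Pk; rewrite /P expr1 ltNge dy.
exists K; rewrite (Pk : y < _) andbT leNgt; apply/negP => h.
by have := kmin _ h; rewrite ltnn.
Qed.

Lemma double_le_exp2 d : (1 < d)%N -> (2 * d <= 2 ^ d)%N.
Proof.
case: d => [|[|d]] // _; elim: d => // d IH.
by rewrite expnS; have := expn_gt0 2 d.+2; lia.
Qed.

(** [X ^- 32] stands for the visibility factor; the polylogarithmic part takes one power of [X] and
    the squared support four, far less than 32. *)
Lemma conflict_small_inv (R : realFieldType) (k1 k2 b e W2 X : R) :
  0 <= k1 -> 0 < k2 -> 0 <= b -> 0 < e -> 1 <= X -> W2 <= X ^+ 4 ->
  k1 * k2 * (b * e ^+ 3) <= X -> k1 * W2 * (b * e ^+ 2 * X ^- 32) <= (k2 * e)^-1.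
Proof.
move=> k10 k20 b0 e0 X1 hW hX; have X0 : 0 < X := lt_le_trans ltr01 X1.
have be0 : 0 <= b * e ^+ 2 * X ^- 32.
  by rewrite mulr_ge0 ?invr_ge0 ?exprn_ge0 ?(ltW X0) // mulr_ge0 ?exprn_ge0 ?(ltW e0).
apply: (le_trans (ler_wpM2r be0 (ler_wpM2l k10 hW))).
rewrite -[X in _ <= X]mul1r ler_pdivlMr ?mulr_gt0 //.
have -> : k1 * X ^+ 4 * (b * e ^+ 2 * X ^- 32) * (k2 * e) =
  k1 * k2 * (b * e ^+ 3) * X ^+ 4 / X ^+ 32 by ring.
rewrite ler_pdivrMr ?exprn_gt0 // mul1r.
apply: (@le_trans _ _ (X * X ^+ 4)); first by rewrite ler_wpM2r // exprn_ge0 // ltW.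
by rewrite -exprS; apply: ler_weXn2l.
Qed.

Lemma conflict_small_pow (R : realFieldType) (k1 k4 b e W2 X : R) :
  0 <= k1 -> 0 <= b -> 0 <= e -> 1 <= X -> W2 <= k4 * X ^+ 2 ->
  k1 * k4 * (b * e ^+ 2) <= X -> k1 * W2 * (b * e ^+ 2 * X ^- 32) <= X ^- 10.
Proof.
move=> k10 b0 e0 X1 hW hX; have X0 : 0 < X := lt_le_trans ltr01 X1.
have be0 : 0 <= b * e ^+ 2 * X ^- 32.
  by rewrite mulr_ge0 ?invr_ge0 ?exprn_ge0 ?(ltW X0) // mulr_ge0 ?exprn_ge0.
apply: (le_trans (ler_wpM2r be0 (ler_wpM2l k10 hW))).
rewrite -[X in _ <= X]mul1r ler_pdivlMr ?exprn_gt0 //.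
have -> : k1 * (k4 * X ^+ 2) * (b * e ^+ 2 * X ^- 32) * X ^+ 10 =
  k1 * k4 * (b * e ^+ 2) * X ^+ 12 / X ^+ 32 by ring.
rewrite ler_pdivrMr ?exprn_gt0 // mul1r.
apply: (@le_trans _ _ (X * X ^+ 12)); first by rewrite ler_wpM2r // exprn_ge0 // ltW.
by rewrite -exprS; apply: ler_weXn2l.
Qed.

(* [L] is ln n, [X = n^(eps/32)], and [rho = beta d^2 n^-eps] bounds the total
   probability that a given pair of bins is drawn together. *)
Lemma upper_parameters (R : realType) (n d J : nat) (beta eps c : R) :
  let L := ln n%:R in let X := n%:R `^ (eps / 32) in
  let rho := beta * d%:R ^+ 2 * X ^- 32 in
  (0 < n)%N -> 1 <= beta -> 0 < eps < 1 -> 0 < c -> (1 < d)%N -> d%:R <= L ->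
  5 * d%:R <= eps / 32 * L ->
  (512 * 1024 * beta + 4 * c + 40) * L ^+ (2 * J + 7) <= X ->
  4 * (c + 3) / eps <= J.+1%:R ->
  exists ks W, [/\ (1 < ks)%N, ks%:R <= loglog R d n + 2, (d <= W)%N,
    512 * (32 ^ d * W)%:R ^+ 2 * rho <= (1024 * d%:R)^-1
   & [/\ 0 < X ^- 10 <= 1 / 4, 2 ^- (d ^ ks.-1 + 2) <= X ^- 10,
    (forall k, (1 < k < ks)%N -> X ^- 10 <= 2 ^- (d ^ k.-1 + 2)),
    512 * (W + d ^ (ks + J))%:R ^+ 2 * rho <= X ^- 10
   & 4 * (X ^- 10) ^+ J.+1 + 4 * ((2 * d)%:R ^+ ((ks + J) * d ^ (ks + J)) / 2 ^+ (W - d))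
     <= 8 * expR (- (c + 3) * L)]].
Proof.
move=> L X rho n0 beta1 /andP[eps0 eps1] c0 d2 dL d5 hX hJ.
have d2R : 2 <= d%:R :> R by rewrite (ler_nat _ 2 d).
have L2 : 2 <= L by apply: le_trans dL.
have L1 : 1 <= L by apply: le_trans L2; rewrite ler1n.
have L0 : 0 <= L by apply: le_trans L1.
set P := L ^+ (2 * J + 7) in hX.
have LP k : (k <= 2 * J + 7)%N -> L ^+ k <= P by move=> kk; apply: ler_weXn2l.
have P1 : 1 <= P by rewrite exprn_ege1.
have P0 : 0 <= P by apply: le_trans P1.
have bP0 : 0 <= beta * P by rewrite mulr_ge0 // (le_trans _ beta1).
have cP0 : 0 <= c * P by rewrite mulr_ge0 // ltW.
have hX' : 512 * 1024 * (beta * P) + 4 * (c * P) + 40 * P <= X.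
  by apply: le_trans hX; rewrite le_eqVlt; apply/orP; left; apply/eqP; ring.
have XP : 40 * P <= X by clear -bP0 cP0 hX'; lra.
have X40 : 40 <= X by clear -XP P1; lra.
have X0 : 0 < X by clear -X40; lra.
have X1 : 1 <= X by clear -X40; lra.
have XE k : X ^+ k = expR (k%:R * (eps / 32 * L)).
  by rewrite /X powR_expR // expRM_natl.
have [ks [ks2 hks hlt]] := @least_level R d (X ^+ 10) d2.
(* The cutoff is a power of [n], so [2 ^- (W - d)] beats the power of [2 * d], whose exponent is
   polylogarithmic. *)
pose W := Num.truncn X.
have WX : W%:R <= X by case/andP: (truncn_itv (ltW X0)).
have X10 : 0 < X ^+ 10 by rewrite exprn_gt0.
have inv10 k : (X ^- 10 <= 2 ^- k) = (2 ^+ k <= X ^+ 10).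
  by rewrite lef_pV2 // posrE exprn_gt0.
have inv10' k : (2 ^- k <= X ^- 10) = (X ^+ 10 <= 2 ^+ k).
  by rewrite lef_pV2 // posrE exprn_gt0.
(* Minimality of [ks], read at level [ks - 1], bounds [d ^ (ks - 2)] by [ln n]; for [ks = 2] there
   is no such level and the bound is trivial. *)
have dks : d%:R ^+ (ks - 2) <= L.
  have [->|ks3] := eqVneq ks 2; first by rewrite subnn expr0.
  have kk : (1 < ks.-1 < ks)%N by clear -ks2 ks3; lia.
  have := hlt _ kk; rewrite XE natr_expR // => h.
  have {}h : (d ^ ks.-2 + 2)%:R * ln 2 < 10 * (eps / 32 * L) by move: h; rewrite ltr_expR.
  have ln2 := half_le_ln2 R.
  have e1 : eps * L <= L by rewrite ler_piMl // ltW.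
  have e2 : (d ^ ks.-2 + 2)%:R * (1 / 2) <= (d ^ ks.-2 + 2)%:R * ln 2 :> R by rewrite ler_wpM2l.
  rewrite (_ : (ks - 2)%N = ks.-2); last by clear; lia.
  rewrite -natrX; have : (d ^ ks.-2)%:R <= (d ^ ks.-2 + 2)%:R :> R by rewrite ler_nat leq_addr.
  by clear -h e1 e2 L0; lra.
have dK : (d ^ (ks + J))%:R <= L ^+ (J + 3).
  have -> : (ks + J = (ks - 2) + (J + 2))%N by clear -ks2; lia.
  rewrite expnD natrM !natrX (addnS J 2) exprS.
  rewrite ler_pM ?exprn_ge0 // lerXn2r ?nnegrE //.
exists ks, W.
have LdK : 0 <= (d ^ (ks + J))%:R :> R by [].
have dKX : (d ^ (ks + J))%:R <= X.
  apply: (le_trans dK); apply: le_trans (LP _ _) _; first by clear; lia.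
  by clear -XP P0; lra.
have b0 : 0 <= beta by apply: le_trans beta1.
have bdP k : (k <= 2 * J + 7)%N -> 512 * 1024 * (beta * d%:R ^+ k) <= X.
  move=> kk; apply: le_trans hX'.
  have : beta * d%:R ^+ k <= beta * P.
    by rewrite ler_wpM2l // (le_trans _ (LP k kk)) // lerXn2r ?nnegrE.
  by clear -cP0 P0; lra.
have d32 : (32 ^ d)%:R <= X.
  rewrite natrX natr_expR // /X powR_expR // ler_expR.
  have -> : ln 32 = 5 * ln 2 :> R.
    by rewrite (_ : 32 = 2 ^+ 5) -?natrX // natrX lnXn // mulr_natl.
  have h : d%:R * (5 * ln 2) <= 5 * d%:R :> R.
    by rewrite [5 * d%:R]mulrC ler_wpM2l // ler_piMr // ln2_le1.
  exact: le_trans h d5.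
have Xpow j k : (j <= k)%N -> X ^+ j <= X ^+ k by move=> jk; apply: ler_weXn2l.
split=> //.
- rewrite /loglog -lerBlDr.
  have -> : ks%:R - 2 = (ks - 2)%:R :> R by rewrite natrB.
  have lnd : 0 < ln d%:R :> R by rewrite ln_gt0 // ltr1n.
  rewrite ler_pdivlMr // mulr_natl -lnXn; last by rewrite ltr0n ltnW.
  by rewrite ler_ln ?posrE ?exprn_gt0 ?ltr0n ?(ltnW d2) // (lt_le_trans ltr01).
- rewrite truncn_ge_nat ?(ltW X0) // (le_trans dL) //.
  have : L <= P by rewrite -[X in X <= _]expr1 LP //; clear; lia.
  by clear -XP P0; lra.
- have W2 : (32 ^ d * W)%:R ^+ 2 <= X ^+ 4.
    rewrite (_ : 4 = 2 * 2)%N // exprM; apply: lerXn2r; rewrite ?nnegrE ?exprn_ge0 ?(ltW X0) //.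
    by rewrite natrM expr2 ler_pM.
  apply: conflict_small_inv; [exact: ler0n|exact: ltr0Sn|exact: b0|by rewrite ltr0n ltnW|exact: X1|exact: W2|].
  by apply: bdP; clear; lia.
split.
- rewrite invr_gt0 X10 /= mul1r lef_pV2 ?posrE //.
  apply: (@le_trans _ _ (X ^+ 1)); last exact: Xpow.
  by rewrite expr1; apply: le_trans X40; rewrite ler_nat.
- by rewrite inv10'.
- by move=> k kk; rewrite inv10 ltW // hlt.
- have W2 : (W + d ^ (ks + J))%:R ^+ 2 <= 4 * X ^+ 2.
    have -> : 4 * X ^+ 2 = (2 * X) ^+ 2 by ring.
    apply: lerXn2r; rewrite ?nnegrE ?mulr_ge0 ?(ltW X0) // natrD.
    by clear -WX dKX; lra.
  apply: (conflict_small_pow _ _ _ _ W2); [exact: ler0n|exact: b0|exact: ler0n|exact: X1|].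
  have := bdP 2 (ltac:(clear; lia)).
  have : 0 <= beta * d%:R ^+ 2 by rewrite mulr_ge0 ?exprn_ge0.
  by clear; lra.
(* In powers of [n] the exponent is [10 / 32 * eps * J.+1], at least [40 / 32 * (c + 3)] by the
   choice of [J]. *)
- have t1 : (X ^- 10) ^+ J.+1 <= expR (- (c + 3) * L).
    rewrite exprVn -exprM XE -expRN ler_expR mulNr lerN2.
    rewrite ler_pdivrMr // in hJ.
    have -> : (10 * J.+1)%:R * (eps / 32 * L) = (10 / 32) * (J.+1%:R * eps) * L.
      by rewrite natrM; ring.
    rewrite ler_wpM2r //; clear -hJ c0; lra.
  have t2 : (2 * d)%:R ^+ ((ks + J) * d ^ (ks + J)) / 2 ^+ (W - d) <= expR (- (c + 3) * L).
    (* Chosen so that [2 ^+ a] exceeds [n ^ (c + 3)], using [ln 2 >= 1 / 2]. *)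
    pose a := (Num.truncn (2 * (c + 3) * L)).+1.
    have cL0 : 0 <= 2 * (c + 3) * L.
      by rewrite mulr_ge0 // mulr_ge0 //; clear -c0; lra.
    have aL : 2 * (c + 3) * L <= a%:R by apply/ltW/truncnS_gt.
    have aU : a%:R <= 2 * (c + 3) * L + 1.
      by rewrite /a -natr1 lerD2r; case/andP: (truncn_itv cL0).
    have ea : expR ((c + 3) * L) <= 2 ^+ a.
      rewrite natr_expR // ler_expR.
      have : a%:R * (1 / 2) <= a%:R * ln 2 :> R by rewrite ler_wpM2l // half_le_ln2.
      by clear -aL; lra.
    have aW : (d * ((ks + J) * d ^ (ks + J)) + a + d <= W)%N.
      rewrite truncn_ge_nat ?(ltW X0) // !natrD.
      have e1 : (d * ((ks + J) * d ^ (ks + J)))%:R <= P.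
        rewrite !natrM /P (_ : 2 * J + 7 = (J + 3 + (J + 3)).+1)%N; last by clear; lia.
        rewrite exprS exprD; apply: ler_pM; [by []|by rewrite mulr_ge0|by []|].
        apply: ler_pM; [by []|by []| |exact: dK]; apply: le_trans dK.
        by rewrite ler_nat ltnW // ltn_expl.
      have LP1 : L <= P by rewrite -[X in X <= _]expr1 LP //; clear; lia.
      have cLP : c * L <= c * P by rewrite ler_wpM2l // ltW.
      by clear -e1 aU LP1 cLP dL P1 hX' bP0 cP0; lra.
    rewrite mulNr expRN ler_pdivrMr ?exprn_gt0 // mulrC ler_pdivlMr ?expR_gt0 //.
    apply: (@le_trans _ _ ((2 ^ d)%:R ^+ ((ks + J) * d ^ (ks + J)) * 2 ^+ a)).
      apply: ler_pM => //; rewrite ?exprn_ge0 ?expR_ge0 //.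
      by apply: lerXn2r; rewrite ?nnegrE // ler_nat double_le_exp2.
    rewrite natrX -exprM -exprD; apply: ler_weXn2l; first by rewrite ler1n.
    by clear -aW; lia.
  have E (u v w : R) : u <= w -> v <= w -> 4 * u + 4 * v <= 8 * w by clear; lra.
  exact: E t1 t2.
Qed.

(** The [s] of visibility and the [s] of balance cancel against the two factors [1 / s] of the draw,
    so the bound is free of [s]. *)
Lemma visible_conflict (R : realType) n d s (H : dynamic_hypergraph n) (beta eps : R) j l :
  (0 < n)%N -> (0 < s)%N -> 0 <= beta -> visible s eps H -> j != l ->
  (viz H j l)%:R * (beta * s%:R / n%:R * (d%:R / s%:R) ^+ 2) <=
  beta * d%:R ^+ 2 * (n%:R `^ (eps / 32)) ^- 32.
Proof.
move=> n0 s0 beta0 hviz jl.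
have sR : s%:R != 0 :> R by rewrite pnatr_eq0 -lt0n.
have nR : n%:R = expR (ln n%:R) :> R by rewrite lnK // posrE ltr0n.
have E0 : 0 <= beta * s%:R / n%:R * (d%:R / s%:R) ^+ 2.
  by apply: mulr_ge0; [apply: divr_ge0 => //; apply: mulr_ge0|apply/exprn_ge0/divr_ge0].
apply: (le_trans (ler_wpM2r E0 (hviz _ _ jl))).
have -> : (n%:R `^ (eps / 32)) ^- 32 = n%:R `^ (1 - eps) / n%:R :> R.
  rewrite !powR_expR // -expRM_natl -expRN [X in _ = _ / X]nR -expRN -expRD; congr expR.
  have -> : 32%:R * (eps / 32 * ln n%:R) = eps * ln n%:R :> R.
    by field.
  by ring.
have nR0 : n%:R != 0 :> R by rewrite pnatr_eq0 -lt0n.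
rewrite le_eqVlt; apply/orP; left; apply/eqP.
by move: (n%:R `^ _) => p; field; rewrite nR0 sR.
Qed.

Lemma upper_failure (R : realType) n d s (H : dynamic_hypergraph n) (i0 : 'I_n)
    (beta eps c : R) (J q a : nat) :
  let L := ln n%:R in
  uniform_hypergraph s H -> balanced s beta H -> visible s eps H ->
  1 <= beta -> 4096 * beta <= q%:R -> 0 < eps < 1 -> 0 < c ->
  (1 < d)%N -> (d <= s)%N -> d%:R <= L -> 5 * d%:R <= eps / 32 * L ->
  (512 * 1024 * beta + 4 * c + 40) * L ^+ (2 * J + 7) <= n%:R `^ (eps / 32) ->
  4 * (c + 3) / eps <= J.+1%:R -> 4096 * beta * L <= n%:R ->
  (q <= n)%N -> (a * (n %/ q) <= n)%N ->
  run (round_law R d H i0) (a * (n %/ q))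
    (fun y => (~~ ((\max_(i < n) y i)%:R <= a%:R * (loglog R d n + J.+1%:R)))%:R) (fun=> 0%N)
  <= a%:R * (n%:R * (8 * expR (- (c + 3) * L))).
Proof.
move=> L hunif hbal hviz beta1 hq heps c0 d2 ds dL d5 hX hJ hn qn am.
have n0 : (0 < n)%N by apply: leq_trans (ltn_ord i0).
have nR0 : 0 < n%:R :> R by rewrite ltr0n.
have beta0 : 0 <= beta by apply: le_trans beta1.
have bn : 0 <= beta / n%:R by rewrite divr_ge0.
have [ks [W [ks2 hks dW hW [hxi hxi1 hlt hxi2 htail]]]] :=
  upper_parameters n0 beta1 heps c0 d2 dL d5 hX hJ.
have q0 : (0 < q)%N.
  rewrite -(ltr0n R); apply: lt_le_trans hq; apply: mulr_gt0; first exact: ltr0Sn.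
  exact: lt_le_trans beta1.
have m0 : (0 < n %/ q)%N by rewrite divn_gt0.
have mq : (n %/ q)%:R * q%:R <= n%:R :> R by rewrite -natrM ler_nat leq_trunc_div.
have bm : 4096 * (beta / n%:R) * (n %/ q)%:R <= 1.
  have -> : 4096 * (beta / n%:R) * (n %/ q)%:R = (n %/ q)%:R * (4096 * beta) / n%:R by ring.
  rewrite ler_pdivrMr; last exact: nR0.
  rewrite mul1r; apply: le_trans mq; exact: (ler_wpM2l (ler0n R _) hq).
have bd : 4096 * (beta / n%:R) * d%:R <= 1.
  have -> : 4096 * (beta / n%:R) * d%:R = 4096 * beta * d%:R / n%:R by ring.
  rewrite ler_pdivrMr; last exact: nR0.
  rewrite mul1r; apply: le_trans hn; apply: ler_wpM2l; last exact: dL.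
  by apply: mulr_ge0; [exact: ler0n|exact: beta0].
have rho0 : 0 <= beta * d%:R ^+ 2 * (n%:R `^ (eps / 32)) ^- 32.
  apply: mulr_ge0; first by apply: mulr_ge0 => //; apply: exprn_ge0.
  by rewrite invr_ge0 exprn_ge0 // powR_ge0.
have hrho j l (jl : j != l) :=
  visible_conflict d n0 (leq_trans (ltnW d2) ds) beta0 hviz jl.
have p0 t D : 0 <= round_law R d H i0 t D by case: (round_law_choice R i0 ds hunif t).
apply: le_trans (le_trans (upper_run i0 d2 ds hunif hbal beta0 rho0 hrho dW m0 bm bd hW ks2 hxi
  hxi1 hlt hxi2 am) _).
  apply: run_le => // y; rewrite ler_nat.
  suff h : [forall i, (y i <= a * (ks + J).-1)%N] ->
      (\max_(i < n) y i)%:R <= a%:R * (loglog R d n + J.+1%:R).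
    by case: [forall i, _] h => [->//|_]; exact: leq_b1.
  move=> /forallP hy; apply: (@le_trans _ _ (a * (ks + J).-1)%:R).
    by rewrite ler_nat; apply/bigmax_leqP => i _; exact: hy.
  rewrite natrM; apply: ler_wpM2l => //.
  rewrite -subn1 natrB ?natrD -?natr1; last by clear -ks2; lia.
  by clear -hks; lra.
by apply: ler_wpM2l => //; apply: ler_wpM2l.
Qed.

(* The linear term in the exponent on the left only serves the induction. *)
Lemma lower_coef_ge (R : realFieldType) d (A : R) (delta : nat -> R) k :
  (1 < d)%N -> 1 <= A -> (forall l, 1 <= delta l / 2 * A ^+ (l + d)) ->
  A ^+ (3 * (k.+1 + d)) <= lower_coef d delta k.+1 * A ^+ (5 * d ^ k.+1).
Proof.
move=> d2 A1 hdel; have A0 : 0 < A := lt_le_trans ltr01 A1.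
elim: k => [|k IH].
  by rewrite /= mul1r expn1; apply: ler_weXn2l => //; clear -d2; lia.
rewrite [lower_coef d delta k.+2]/= -/(lower_coef d delta k.+1).
set u := lower_coef d delta k.+1 in IH *.
have -> : (5 * d ^ k.+2 = 5 * d ^ k.+1 * d)%N by rewrite [(d ^ k.+2)%N]expnSr mulnA.
rewrite [A ^+ (_ * d)]exprM -exprMn.
apply: (@le_trans _ _ ((A ^+ (2 * (k.+1 + d))) ^+ d)).
  rewrite -exprM; apply: ler_weXn2l => //.
  have : (2 * (k.+1 + d) * 2 <= 2 * (k.+1 + d) * d)%N by rewrite leq_mul2l d2 orbT.
  by clear -d2; lia.
apply: lerXn2r; rewrite ?nnegrE ?exprn_ge0 ?(ltW A0) //.
  have d0 : 0 <= delta k.+1 / 2.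
    by have := le_trans ler01 (hdel k.+1); rewrite pmulr_lge0 // exprn_gt0.
  have : 0 <= u * A ^+ (5 * d ^ k.+1).
    by apply: le_trans IH; rewrite exprn_ge0 // ltW.
  move=> h; have -> : u * delta k.+1 / 2 * A ^+ (5 * d ^ k.+1) =
    u * A ^+ (5 * d ^ k.+1) * (delta k.+1 / 2) by ring.
  exact: mulr_ge0.
rewrite -(ler_pM2r (exprn_gt0 (k.+1 + d) A0)) -exprD.
have -> : (2 * (k.+1 + d) + (k.+1 + d) = 3 * (k.+1 + d))%N by clear; lia.
have -> : u * delta k.+1 / 2 * A ^+ (5 * d ^ k.+1) * A ^+ (k.+1 + d) =
  u * A ^+ (5 * d ^ k.+1) * (delta k.+1 / 2 * A ^+ (k.+1 + d)) by ring.
apply: (le_trans IH); rewrite ler_peMr //.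
by apply: le_trans IH; rewrite exprn_ge0 // ltW.
Qed.

Lemma sum_half_pow (R : realFieldType) K : \sum_(l < K) 2 ^- l.+1 <= 1 :> R.
Proof.
suff -> : \sum_(l < K) 2 ^- l.+1 = 1 - 2 ^- K :> R.
  by rewrite lerBlDr lerDl invr_ge0 exprn_ge0.
elim: K => [|K IH]; first by rewrite big_ord0 expr0 invr1 subrr.
by rewrite big_ord_recr /= IH exprS; field; rewrite expf_neq0 // pnatr_eq0.
Qed.

Lemma pow_onem_ge (R : realType) (x : R) m : 0 <= x <= 1 / 2 ->
  expR (- (2 * (m%:R * x))) <= (1 - x) ^+ m.
Proof.
move=> /andP[x0 x1].
have -> : - (2 * (m%:R * x)) = m%:R * (- (2 * x)) by ring.
rewrite expRM_natl; apply: lerXn2r; rewrite ?nnegrE ?expR_ge0 //; first by lra.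
rewrite expRN; have h := expR_ge1Dx (2 * x).
rewrite invf_ple ?posrE ?expR_gt0 //; last by lra.
apply: le_trans h; rewrite -[X in X <= _]mul1r ler_pdivrMr; last by lra.
by nra.
Qed.

(** On the failure event no bin exceeds [K], so the count of such bins vanishes and
    [expR (- lam * g)] equals one; the exponential moment therefore bounds the probability. *)
Lemma lower_failure (R : realType) n d s (H : dynamic_hypergraph n) (i0 : 'I_n)
    (beta c : R) (q : nat) :
  let L := ln n%:R in let eta := (40 * ln (16 * q)%:R)^-1 in
  uniform_hypergraph s H -> balanced s beta H ->
  1 <= beta -> beta <= q%:R -> 0 < c ->
  (1 < d)%N -> (d <= s)%N -> d%:R <= eta * L ->
  32 * q%:R * beta * L ^+ 3 <= n%:R -> 32 * q%:R * (c + 1) * L <= expR (L / 2) ->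
  (q <= n)%N -> 
  run (round_law R d H i0) (n %/ q)
    (fun y => (~~ (loglog R d n - (1 - 2 * ln eta) <= (\max_(i < n) y i)%:R))%:R) (fun=> 0%N)
  <= expR (- (c + 1) * L).
Proof.
move=> L eta hunif hbal beta1 hq c0 d2 ds dL hn hn2 qn.
have d0 : (0 < d)%N := ltnW d2.
have d0R : 0 < d%:R :> R by rewrite ltr0n.
have d2R : 2 <= d%:R :> R by rewrite (ler_nat _ 2 d).
have q0R : 0 < q%:R :> R by apply: lt_le_trans hq; apply: lt_le_trans beta1.
have q0 : (0 < q)%N by rewrite -(ltr0n R).
have n0 : (0 < n)%N by apply: leq_trans (ltn_ord i0).
have n0R : 0 < n%:R :> R by rewrite ltr0n.
have nE : n%:R = expR L :> R by rewrite lnK.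
have beta0 : 0 < beta by apply: lt_le_trans beta1.
pose A : R := (16 * q)%:R.
have q1R : 1 <= q%:R :> R by rewrite ler1n.
have A16 : A = 16 * q%:R by rewrite /A natrM.
have A2 : 2 <= A by rewrite A16; clear -q1R; lra.
have A1 : 1 <= A by clear -A2; lra.
have A0 : 0 < A by clear -A2; lra.
have lnA : 1 / 2 <= ln A.
  by apply: le_trans (half_le_ln2 R) _; rewrite ler_ln ?posrE.
have lnA0 : 0 < 40 * ln A by clear -lnA; lra.
have eta0 : 0 < eta by rewrite invr_gt0.
have etaA : eta * (40 * ln A) = 1 by rewrite mulVf // gt_eqF.
have eta1 : 20 * eta <= 1.
  have := ler_wpM2l (ltW eta0) lnA; clear -etaA; lra.
have etaL : 0 < eta * L by apply: lt_le_trans dL.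
have L0 : 0 < L by rewrite -(pmulr_rgt0 _ eta0).
have L2 : 2 <= L.
  apply: le_trans d2R _; apply: (le_trans dL); rewrite ler_piMl ?(ltW L0) //.
  by clear -eta1 eta0; lra.
have [K /andP[hK hK2]] := power_bracket d2 dL.
set B := (d ^ K.+1)%N; have BE : B%:R = d%:R ^+ K.+1 :> R by rewrite natrX.
have BL : B%:R <= eta * L by rewrite BE.
have BL1 : B%:R <= L.
  by apply: (le_trans BL); rewrite ler_piMl ?(ltW L0) //; clear -eta1 eta0; lra.
have dL1 : d%:R <= L.
  by apply: (le_trans dL); rewrite ler_piMl ?(ltW L0) //; clear -eta1 eta0; lra.
(* The thresholds of all levels together cost [n * d * \sum delta <= n / (8 * q)], at most a quarter
   of [m]; the factor [2 ^- l] makes them summable. *)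
pose delta l : R := 2 ^- l / (8 * q%:R * d%:R).
have qd1 : 1 <= 8 * q%:R * d%:R :> R.
  by clear -q1R d2R; nra.
have delta01 l : 0 < delta l <= 1.
  have h : 0 < 2 ^- l :> R by rewrite invr_gt0 exprn_gt0.
  rewrite /delta divr_gt0 //=; last by clear -qd1; lra.
  rewrite ler_pdivrMr; last by clear -qd1; lra.
  rewrite mul1r; apply: le_trans qd1.
  by rewrite invf_le1 ?exprn_gt0 // exprn_ege1 // ler1n.
have hcoef : expR (- (L / 8)) <= lower_coef d delta K.+1.
  have hd l : 1 <= delta l / 2 * A ^+ (l + d).
    have -> : delta l / 2 = (2 ^+ l * d%:R * A)^-1.
      by rewrite /delta A16; field; rewrite expf_neq0 ?pnatr_eq0 -?lt0n ?d0 ?q0.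
    rewrite mulrC ler_pdivlMr ?mulr_gt0 ?exprn_gt0 // mul1r.
    have -> : (l + d = l + d.-1 + 1)%N by clear -d0; lia.
    rewrite exprD expr1 ler_pM2r // exprD; apply: ler_pM => //; rewrite ?exprn_ge0 //.
      by apply: lerXn2r => //; rewrite nnegrE ltW.
    apply: (@le_trans _ _ (2 ^+ d.-1)).
      rewrite -natrX ler_nat; have := ltn_expl d.-1 (ltnSn 1).
      by rewrite prednK.
    by apply: lerXn2r => //; rewrite nnegrE ltW.
  have hcoef := lower_coef_ge K d2 A1 hd.
  (* This fixes [eta]: [5 * B * ln A <= 5 * eta * L * ln A = L / 8]. *)
  have AB : A ^+ (5 * B) <= expR (L / 8).
    rewrite natr_expR ?muln_gt0 // ler_expR natrM -/A.
    have := ler_wpM2r (ltW lnA0) BL; rewrite [eta * L * _]mulrAC etaA mul1r.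
    by clear; lra.
  have A3 : 1 <= A ^+ (3 * (K.+1 + d)) by rewrite exprn_ege1.
  have lc0 : 0 <= lower_coef d delta K.+1 by case/andP: (lower_coef01 d delta01 K.+1) => /ltW.
  rewrite expRN -[X in X <= _]mul1r ler_pdivrMr ?expR_gt0 //.
  by apply: (le_trans A3); apply: (le_trans hcoef); exact: ler_wpM2l.
set m := (n %/ q)%N.
have mq : m%:R * q%:R <= n%:R :> R by rewrite -natrM ler_nat leq_trunc_div.
have m1 : (0 < m)%N by rewrite divn_gt0.
have mq2 : n%:R <= 2 * (m%:R * q%:R) :> R.
  rewrite -!natrM ler_nat.
  have := ltn_ceil n q0; rewrite -/m => h.
  have : (q <= m * q)%N by rewrite leq_pmull.
  by clear -h; lia.
pose b := beta / n%:R.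
have b0 : 0 < b by rewrite divr_gt0.
have bn : b * n%:R = beta by rewrite divfK // gt_eqF.
have mb : m%:R * b <= 1.
  have : m%:R * beta <= n%:R by apply: le_trans mq; apply: ler_wpM2l.
  by rewrite /b mulrA ler_pdivrMr // mul1r.
have L1 : 1 <= L by clear -L2; lra.
have poly k x : (k <= 3)%N -> x <= L ^+ k -> 0 <= x -> 32 * q%:R * x * b <= 1.
  move=> kk xk x0; rewrite /b !mulrA ler_pdivrMr // mul1r.
  apply: le_trans hn; rewrite -!mulrA.
  apply: ler_wpM2l => //; apply: ler_wpM2l => //; rewrite mulrC.
  apply: ler_wpM2l; first exact: ltW.
  by apply: (le_trans xk); apply: ler_weXn2l.
have qb0 : 0 <= q%:R * b by rewrite mulr_ge0 // ltW.
have Bb0 : 0 <= B%:R * b by rewrite mulr_ge0 // ltW.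
have Bb : B%:R * b <= 1 / 2.
  have := poly 1%N B%:R isT BL1 (ler0n _ _); move: Bb0 q1R; clear.
  rewrite -!mulrA; set z := _ * b => *; nra.
have hdelta l : (0 < l <= K)%N -> 4 * B%:R * b <= delta l.
  move=> /andP[_ lK].
  have e1 : 2 ^+ l * d%:R * B%:R <= L ^+ 3.
    have -> : L ^+ 3 = L * (L * L) by ring.
    have -> : 2 ^+ l * d%:R * B%:R = d%:R * (2 ^+ l * B%:R) :> R by ring.
    apply: ler_pM; [by []|by rewrite mulr_ge0 // exprn_ge0|exact: dL1|].
    apply: ler_pM; [by rewrite exprn_ge0|by []| |exact: BL1].
    apply: le_trans BL1; rewrite BE.
    apply: (@le_trans _ _ (d%:R ^+ l)); first by apply: lerXn2r; rewrite ?nnegrE.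
    by apply: ler_weXn2l; [by rewrite ler1n|exact: leqW].
  have := poly 3 _ isT e1 (mulr_ge0 (mulr_ge0 (exprn_ge0 _ (ler0n _ _)) (ler0n _ _)) (ler0n _ _)).
  rewrite /delta ler_pdivlMr ?mulr_gt0 // -[2 ^- l]mul1r ler_pdivlMr ?exprn_gt0 //.
  apply: le_trans; rewrite le_eqVlt; apply/orP; left; apply/eqP; ring.
have Bb1 : B%:R * b <= 1 by clear -Bb; lra.
have hmean := lower_mean i0 d2 ds hunif hbal (ltW beta0) delta01 mb Bb1 hdelta.
set g := (fun y : 'I_n -> nat => #|[set i | (K < y i)%N]%SET|%:R : R) in hmean.
set law := round_law R d H i0 in hmean *.
have {}hmean : expR (- (L / 4)) * (m%:R / 2) <= run law m g (fun=> 0%N).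
  apply: le_trans hmean; rewrite -/B -/b.
  have e1 : expR (- (L / 8)) <= (1 - B%:R * b) ^+ m.
    apply: le_trans (pow_onem_ge _ _); last by rewrite Bb0.
    rewrite ler_expR lerN2.
    have h : m%:R * (B%:R * b) <= eta * L.
      by apply: le_trans BL; rewrite mulrCA; apply: ler_piMr.
    have : 20 * (eta * L) <= L by rewrite mulrA ler_piMl // ltW.
    by clear -h etaL; lra.
  have e2 : m%:R / 2 <= m%:R - n%:R * d%:R * \sum_(l < K) (delta l.+1 + b).
    have -> : \sum_(l < K) (delta l.+1 + b) = (\sum_(l < K) 2 ^- l.+1) / (8 * q%:R * d%:R) + K%:R * b.
      by rewrite big_split /= sumr_const card_ord -[b *+ _]mulr_natl mulr_suml.
    have h1 := sum_half_pow R K; set S := \sum_(l < K) _ in h1 *.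
    have -> : n%:R * d%:R * (S / (8 * q%:R * d%:R) + K%:R * b) =
       S * (n%:R / (8 * q%:R)) + d%:R * K%:R * (b * n%:R).
      by field; rewrite !pnatr_eq0 -!lt0n q0 d0.
    have h2 : n%:R / (8 * q%:R) <= m%:R / 4 :> R.
      rewrite ler_pdivrMr ?mulr_gt0 //; clear -mq2; lra.
    have h3 : S * (n%:R / (8 * q%:R)) <= m%:R / 4.
      by apply: le_trans h2; rewrite ler_piMl // divr_ge0 // mulr_ge0.
    have KB : K%:R <= L.
      apply: le_trans BL1; rewrite ler_nat; apply: ltnW; apply: ltnW.
      exact: ltn_expl.
    have h4 : 32 * q%:R * (d%:R * K%:R) * b <= 1.
      by apply: (poly 2) => //; rewrite ?mulr_ge0 // expr2 ler_pM.
    have h5 : d%:R * K%:R * (b * n%:R) <= m%:R / 4.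
      rewrite -[X in X <= _]mul1r.
      rewrite -(ler_pM2l (_ : 0 < 32 * q%:R)) ?mulr_gt0 // mul1r.
      have := ler_wpM2r (ltW n0R) h4; rewrite mul1r => h.
      have -> : 32 * q%:R * (d%:R * K%:R * (b * n%:R)) = 32 * q%:R * (d%:R * K%:R) * b * n%:R by ring.
      apply: (le_trans h); clear -mq2; have : 0 <= m%:R * q%:R :> R by rewrite -natrM.
      by lra.
    by clear -h3 h5; lra.
  have -> : expR (- (L / 4)) = expR (- (L / 8)) * expR (- (L / 8)) :> R.
    by rewrite -expRD; congr expR; field.
  apply: ler_pM; rewrite ?divr_ge0 ?mulr_ge0 ?expR_ge0 //.
  by apply: ler_pM; rewrite ?expR_ge0.
(* The maximizer of [lam * mu - m * lam ^+ 2] at the lower bound [mu = expR (- (L / 4)) * (m / 2)]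
   of the mean; the maximum is of order [expR (L / 2)]. *)
pose lam := expR (- (L / 4)) / 4.
have eL0 := expR_gt0 (- (L / 4)).
have lam01 : 0 <= lam <= 1.
  have : expR (- (L / 4)) <= 1 :> R by rewrite -[X in _ <= X]expR0 ler_expR; clear -L0; lra.
  by rewrite /lam => h; apply/andP; split; clear -h eL0; lra.
have hchoice := round_law_choice R i0 ds hunif.
have p0 t D : 0 <= law t D by case: (hchoice t).
have hrun := run_expR m (fun=> 0%N) d0 hchoice (lipschitz_count R K) lam01.
apply: (@le_trans _ _ (run law m (fun y => expR (- lam * g y)) (fun=> 0%N))).
  apply: run_le => // y.
  suff h : g y != 0 -> loglog R d n - (1 - 2 * ln eta) <= (\max_(i < n) y i)%:R.
    have [->|/h ->] := eqVneq (g y) 0; last exact: expR_ge0.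
    by rewrite mulr0 expR0; case: (~~ _).
  rewrite /g pnatr_eq0 -lt0n => /card_gt0P[i]; rewrite inE => yi.
  apply: (@le_trans _ _ K.+1%:R); last by rewrite ler_nat (leq_trans yi) // leq_bigmax.
  have lnd : 1 / 2 <= ln d%:R :> R.
    by apply: le_trans (half_le_ln2 R) _; rewrite ler_ln ?posrE.
  have lnd0 : 0 < ln d%:R :> R by clear -lnd; lra.
  (* The upper half of the bracket for [eta * L]. Dividing by [ln d >= 1 / 2] produces the constant
     [- 2 * ln eta]. *)
  have hl : ln eta + ln L <= K.+2%:R * ln d%:R.
    rewrite -lnM ?posrE // mulr_natl -lnXn // ler_ln ?posrE ?exprn_gt0 //.
    exact: ltW.
  have e0 : ln eta <= 0 by apply: ln_le0; clear -eta1 eta0; lra.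
  have : loglog R d n <= K.+2%:R - 2 * ln eta.
    rewrite /loglog -/L ler_pdivrMr // mulrBl.
    have : ln eta * (2 * ln d%:R) <= ln eta.
      rewrite -[X in _ <= X]mulr1 ler_wnM2l //; clear -lnd; lra.
    by clear -hl; lra.
  by rewrite -[K.+2%:R]natr1; clear; lra.
apply: (le_trans hrun); rewrite ler_expR.
have h1 : lam * (expR (- (L / 4)) * (m%:R / 2)) <= lam * run law m g (fun=> 0%N).
  by apply: ler_wpM2l => //; case/andP: lam01.
have -> : - (c + 1) * L = - ((c + 1) * L) by ring.
rewrite -lerN2 opprB opprK.
have h2 : m%:R * lam ^+ 2 = lam * (expR (- (L / 4)) * (m%:R / 4)).
  by rewrite /lam; ring.
have h3 : (c + 1) * L <= lam * (expR (- (L / 4)) * (m%:R / 4)).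
  have -> : lam * (expR (- (L / 4)) * (m%:R / 4)) =
      expR (- (L / 4)) * expR (- (L / 4)) * m%:R / 16 by rewrite /lam; field.
  rewrite -expRD (_ : - (L / 4) + - (L / 4) = - (L / 2)); last by field.
  have eL : expR (- (L / 2)) * n%:R = expR (L / 2).
    by rewrite nE -expRD; congr expR; field.
  have e0 := expR_gt0 (- (L / 2)).
  have := ler_wpM2l (ltW e0) mq2; rewrite eL => h.
  rewrite -(ler_pM2l q0R).
  by clear -h hn2; nra.
by clear -h1 h2 h3; lra.
Qed.

(** * Large [n] and assembly of the theorem *)

Lemma littleo_ln_near (R : realType) (d : nat -> nat) (e : R) : 0 < e ->
  (fun n => (d n)%:R : R^o) =o_\oo (fun n => ln n%:R : R^o) ->
  \forall n \near \oo, (d n)%:R <= e * ln n%:R.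
Proof.
move=> e0 /eqoP/(_ e e0) h; near=> n.
have l0 : 0 <= ln n%:R :> R by near: n; exact: ln_near.
have : `|(d n)%:R : R^o| <= e * `|ln n%:R : R^o| by near: n.
by rewrite !ger0_norm.
Unshelve. all: by end_near. Qed.

Section Near.
Variables (R : realType) (beta eps c : R) (s d : nat -> nat).
Variables (H : forall n, dynamic_hypergraph n) (q : nat).
Hypothesis beta1 : 1 <= beta.
Hypothesis hq : 4096 * beta <= q%:R.
Hypothesis c0 : 0 < c.
Hypothesis ds : \forall n \near \oo, (2 <= d n <= s n)%N.
Hypothesis dln : (fun n => (d n)%:R : R^o) =o_\oo (fun n => ln n%:R : R^o).
Hypothesis hunif : \forall n \near \oo, uniform_hypergraph (s n) (@H n).
Hypothesis hbal : \forall n \near \oo, balanced (s n) beta (@H n).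

Lemma upper_near J : 0 < eps < 1 -> (\forall n \near \oo, visible (s n) eps (@H n)) ->
  4 * (c + 3) / eps <= J.+1%:R ->
  \forall n \near \oo, forall a (i0 : 'I_n), (a * (n %/ q) <= n)%N ->
  run (round_law R (d n) (@H n) i0) (a * (n %/ q)) (fun y => (~~ ((\max_(i < n) y i)%:R <=
      a%:R * (loglog R (d n) n + J.+1%:R)))%:R) (fun=> 0%N)
  <= a%:R * (n%:R * (8 * expR (- (c + 3) * ln n%:R))).
Proof.
move=> heps hviz hJ; have /andP[eps0 eps1] := heps.
have e1 : 0 < eps / 32 / 5 by rewrite !divr_gt0.
have e2 : 0 < eps / 32 by rewrite divr_gt0.
near=> n => a i0 am.
have /andP[d2 dsn] : (2 <= d n <= s n)%N by near: n.
have hd1 : (d n)%:R <= 1 * ln n%:R :> R by near: n; exact: littleo_ln_near.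
have hd5 : (d n)%:R <= eps / 32 / 5 * ln n%:R by near: n; exact: littleo_ln_near.
apply: (@upper_failure R n (d n) (s n) (@H n) i0 beta eps c J q a) => //.
- by near: n.
- by near: n.
- by near: n.
- by rewrite -[X in _ <= X]mul1r.
- by apply: le_trans (ler_wpM2l _ hd5) _; rewrite // le_eqVlt; apply/orP; left; apply/eqP; field.
- by near: n; exact: polylog_near.
- rewrite -[ln _]expr1 -[X in _ <= X]powRr1 //; near: n; exact: polylog_near.
- by near: n; exact: nbhs_infty_ge.
Unshelve. all: by end_near. Qed.

Lemma lower_near :
  \forall n \near \oo, forall i0 : 'I_n,
  run (round_law R (d n) (@H n) i0) (n %/ q) (fun y => (~~ (loglog R (d n) n -
      (1 - 2 * ln (40 * ln (16 * q)%:R)^-1) <= (\max_(i < n) y i)%:R))%:R) (fun=> 0%N)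
  <= expR (- (c + 1) * ln n%:R).
Proof.
have q0 : (0 < q)%N.
  rewrite -(ltr0n R); apply: lt_le_trans hq; apply: mulr_gt0; first exact: ltr0Sn.
  exact: lt_le_trans beta1.
have e1 : 0 < (40 * ln (16 * q)%:R)^-1 :> R.
  by rewrite invr_gt0 mulr_gt0 // ln_gt0 // ltr1n (@leq_trans (16 * 1)) // leq_mul2l q0 orbT.
have bq : beta <= q%:R.
  apply: le_trans hq; apply: ler_peMl; first exact: le_trans beta1.
  by rewrite ler1n.
near=> n => i0.
have /andP[d2 dsn] : (2 <= d n <= s n)%N by near: n.
apply: (@lower_failure R n (d n) (s n) (@H n) i0 beta c q) => //.
- by near: n.
- by near: n.
- by near: n; exact: littleo_ln_near.
- rewrite -[X in _ <= X]powRr1 //; near: n; exact: polylog_near.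
- have n0 : (0 < n)%N by apply: leq_trans (ltn_ord i0).
  rewrite (_ : ln n%:R / 2 = 1 / 2 * ln n%:R); last by ring.
  by rewrite -powR_expR // -[ln _]expr1; near: n; exact: polylog_near.
- by near: n; exact: nbhs_infty_ge.
Unshelve. all: by end_near. Qed.

End Near.

Lemma expR_decay (R : realType) (n k : nat) (c : R) : (0 < n)%N ->
  expR (- (c + k%:R) * ln n%:R) = n%:R `^ (- c) * n%:R ^- k.
Proof.
move=> n0; rewrite powR_expR // natr_expR // -expRN -expRD; congr expR; ring.
Qed.

Unset Implicit Arguments.

Theorem theorem1 (R : realType) (beta c0 kappa : R)
    (hbeta : 1 <= beta) (hc0 : 1 <= c0) (hkappa : 0 < kappa) :
  exists C : R -> R,
  forall (eps : R) (s d : nat -> nat) (H : forall n, dynamic_hypergraph n),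
    0 < eps < 1 ->
    (\forall n \near \oo, (2 <= s n <= n)%N) ->
    (\forall n \near \oo, (2 <= d n <= s n)%N) ->
    (fun n => (d n)%:R : R^o) =o_\oo (fun n => ln n%:R : R^o) ->
    (\forall n \near \oo, uniform_hypergraph (s n) (H n)) ->
    (\forall n \near \oo, balanced (s n) beta (H n)) ->
    (\forall n \near \oo, visible (s n) eps (H n)) ->
    (\forall n \near \oo, size_property (s n) kappa c0 (H n)) ->
  exists m : nat -> nat,
    (exists2 a : R, 0 < a &
       \forall n \near \oo, a * n%:R <= (m n)%:R /\ (m n <= n)%N) /\
    (forall c : R, 0 < c ->
       \forall n \near \oo,
         1 - n%:R `^ (- c) <=
         process_prob R (d n) (H n)
           [pred w | `|(max_load w (m n))%:R - loglog R (d n) n|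
                       <= C c / eps]) /\
    (forall (gamma : nat) (c : R), (0 < gamma)%N -> 0 < c ->
       \forall n \near \oo, (gamma * m n <= n)%N ->
         1 - n%:R `^ (- c) <=
         process_prob R (d n) (H n)
           [pred w | (max_load w (gamma * m n))%:R
                       <= gamma%:R * (loglog R (d n) n + C c / eps)]).
Proof.
(* With [m = n / q] balls this gives [4096 * b * m <= 1], the standing hypothesis of the weights. *)
pose q := (Num.truncn (4096 * beta)).+1.
have hq : 4096 * beta <= q%:R by apply/ltW/truncnS_gt.
pose C0 : R := 1 - 2 * ln (40 * ln (16 * q)%:R)^-1.
have C00 : 0 <= C0.
  rewrite subr_ge0; apply: le_trans ler01; apply: mulr_ge0_le0 => //; apply: ln_le0.
  have l2 : 1 / 2 <= ln (16 * q)%:R :> R.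
    apply: le_trans (half_le_ln2 R) _; rewrite ler_ln ?posrE ?ltr0n ?muln_gt0 //.
    by rewrite ler_nat (@leq_trans (16 * 1)) // leq_mul2l.
  by rewrite invf_le1; clear -l2; lra.
(* As [eps < 1], the extra levels satisfy [J.+1 <= 4 * (c + 3) / eps + 1 <= (4 * c + 13) / eps], and
   the constant [C0] of the lower bound is at most [C0 / eps]. *)
exists (fun c => 4 * c + 13 + C0) => eps s d H heps hs hd hdln hunif hbal hviz _.
have /andP[eps0 eps1] := heps.
have q0 : (0 < q)%N by [].
have hJ (c : R) : 0 < c -> exists J : nat, 4 * (c + 3) / eps <= J.+1%:R /\
    J.+1%:R <= (4 * c + 13 + C0) / eps.
  move=> c1; exists (Num.truncn (4 * (c + 3) / eps)); split; first exact/ltW/truncnS_gt.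
  have e0 : 0 <= 4 * (c + 3) / eps by apply: divr_ge0; clear -c1 eps0; lra.
  have /andP[h _] := truncn_itv e0.
  rewrite -natr1; apply: le_trans (_ : 4 * (c + 3) / eps + 1 <= _); first by rewrite lerD2r.
  rewrite -[X in _ + X](divff (lt0r_neq0 eps0)) -mulrDl ler_wpM2r ?invr_ge0 ?(ltW eps0) //.
  by clear -C00 eps1; lra.
have nn0 : \forall n \near \oo, (0 < n)%N by exact: nbhs_infty_gt.
exists (fun n => n %/ q)%N; split; [|split].
- exists (2 * q%:R)^-1; first by rewrite invr_gt0 mulr_gt0 // ltr0n.
  near=> n; split; last exact: leq_div.
  have qn : (q <= n)%N by near: n; exact: nbhs_infty_ge.
  rewrite mulrC ler_pdivrMr ?mulr_gt0 ?ltr0n // -!natrM ler_nat.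
  have h := ltn_ceil n q0; have h2 : (0 < n %/ q)%N by rewrite divn_gt0.
  have : (q <= n %/ q * q)%N by rewrite leq_pmull.
  by clear -h; lia.
- move=> c c1; have [J [hJ1 hJ2]] := hJ _ c1.
  have hup := upper_near hbeta hq c1 hd hdln hunif hbal heps hviz hJ1.
  have hlo := lower_near hbeta hq c1 hd hdln hunif hbal.
  near=> n.
  have n0 : (0 < n)%N by near: n.
  have /andP[d2 dsn] : (2 <= d n <= s n)%N by near: n.
  have hu : uniform_hypergraph (s n) (H n) by near: n.
  have n9 : 9 <= n%:R :> R by near: n; exact: nbhs_infty_ger.
  pose i0 : 'I_n := Ordinal n0.
  have up : forall a (i0 : 'I_n), (a * (n %/ q) <= n)%N ->
    run (round_law R (d n) (H n) i0) (a * (n %/ q)) (fun y => (~~ ((\max_(i < n) y i)%:R <=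
      a%:R * (loglog R (d n) n + J.+1%:R)))%:R) (fun=> 0%N)
    <= a%:R * (n%:R * (8 * expR (- (c + 3) * ln n%:R))) by near: n.
  have lo : forall i0 : 'I_n,
    run (round_law R (d n) (H n) i0) (n %/ q) (fun y => (~~ (loglog R (d n) n -
      (1 - 2 * ln (40 * ln (16 * q)%:R)^-1) <= (\max_(i < n) y i)%:R))%:R) (fun=> 0%N)
    <= expR (- (c + 1) * ln n%:R) by near: n.
  have {}up := up 1%N i0; rewrite !mul1n !mul1r in up.
  have {up} := up (leq_div n q); have {lo} := lo i0.
  set ll := loglog R (d n) n; rewrite -/C0.
  rewrite expR_decay // (@expR_decay R n 1) // => lo up.
  have hch := round_law_choice R i0 dsn hu.
  have p0 t D : 0 <= round_law R (d n) (H n) i0 t D by case: (hch t).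
  apply: (@process_prob_ge R n (d n) (s n) (H n) i0 d2 dsn hu (n %/ q)%N
    (fun x => `|(\max_(i < n) x i)%:R - ll| <= (4 * c + 13 + C0) / eps)).
    exact: leq_div.
  have hC0 : C0 <= (4 * c + 13 + C0) / eps.
    rewrite ler_pdivlMr //; apply: (@le_trans _ _ C0).
      by rewrite ler_piMr // ltW.
    by clear -c1; lra.
  (* A union bound over the two tails; beside [n ^ - c] it leaves the factor [(8 + n) / n ^ 2],
     below one for [n >= 9]. *)
  apply: (@le_trans _ _ (run (round_law R (d n) (H n) i0) (n %/ q)
    (fun y => (~~ ((\max_(i < n) y i)%:R <= ll + J.+1%:R))%:R +
      (~~ (ll - C0 <= (\max_(i < n) y i)%:R))%:R) (fun=> 0%N))).
    apply: run_le => // y; set M : R := (\max_(i < n) y i)%:R.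
    rewrite -natrD ler_nat ler_norml.
    case: (leP M (ll + J.+1%:R)) => h1; last by case: (_ && _).
    case: (leP (ll - C0) M) => h2; last by case: (_ && _).
    rewrite (_ : _ && _) //; apply/andP; split.
      by rewrite lerBrDr addrC; apply: le_trans h2; rewrite lerD2l lerN2.
    by rewrite lerBlDl; apply: (le_trans h1); rewrite lerD2l.
  rewrite runD //; apply: le_trans (lerD up lo) _.
  have N0 : 0 < n%:R :> R by rewrite ltr0n.
  have P0 : 0 <= n%:R `^ (- c) by exact: powR_ge0.
  have -> : n%:R * (8 * (n%:R `^ (- c) * n%:R ^- 3)) + n%:R `^ (- c) * n%:R ^- 1 =
    n%:R `^ (- c) * ((8 + n%:R) / n%:R ^+ 2) :> R.
    by move: (n%:R `^ (- c)) => P; field; rewrite pnatr_eq0 -lt0n.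
  rewrite -[X in _ <= X]mulr1; apply: ler_wpM2l => //.
  by rewrite ler_pdivrMr ?exprn_gt0 // mul1r expr2; clear -n9; nra.
- move=> gamma c g0 c1; have [J [hJ1 hJ2]] := hJ _ c1.
  have hup := upper_near hbeta hq c1 hd hdln hunif hbal heps hviz hJ1.
  near=> n => gm.
  have n0 : (0 < n)%N by near: n.
  have /andP[d2 dsn] : (2 <= d n <= s n)%N by near: n.
  have hu : uniform_hypergraph (s n) (H n) by near: n.
  have n8 : gamma%:R * 8 <= n%:R :> R by near: n; exact: nbhs_infty_ger.
  pose i0 : 'I_n := Ordinal n0.
  have up : forall a (i0 : 'I_n), (a * (n %/ q) <= n)%N ->
    run (round_law R (d n) (H n) i0) (a * (n %/ q)) (fun y => (~~ ((\max_(i < n) y i)%:R <=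
      a%:R * (loglog R (d n) n + J.+1%:R)))%:R) (fun=> 0%N)
    <= a%:R * (n%:R * (8 * expR (- (c + 3) * ln n%:R))) by near: n.
  have {up} := up gamma i0 gm.
  set ll := loglog R (d n) n; rewrite expR_decay // => up.
  have hch := round_law_choice R i0 dsn hu.
  have p0 t D : 0 <= round_law R (d n) (H n) i0 t D by case: (hch t).
  apply: (@process_prob_ge R n (d n) (s n) (H n) i0 d2 dsn hu (gamma * (n %/ q))%N
    (fun x => (\max_(i < n) x i)%:R <= gamma%:R * (ll + (4 * c + 13 + C0) / eps))) => //.
  apply: le_trans (le_trans up _).
    apply: run_le => // y; set M : R := (\max_(i < n) y i)%:R; rewrite ler_nat.
    case: (leP M (gamma%:R * (ll + J.+1%:R))) => h1; last by case: (_ <= _).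
    rewrite (_ : _ <= _) //; apply: (le_trans h1); apply: ler_wpM2l => //.
    by rewrite lerD2l.
  have N0 : 0 < n%:R :> R by rewrite ltr0n.
  have N1 : 1 <= n%:R :> R by rewrite ler1n.
  have -> : gamma%:R * (n%:R * (8 * (n%:R `^ (- c) * n%:R ^- 3))) =
    n%:R `^ (- c) * (gamma%:R * 8 / n%:R ^+ 2) :> R.
    by move: (n%:R `^ (- c)) => P; field; rewrite pnatr_eq0 -lt0n.
  rewrite -[X in _ <= X]mulr1; apply: ler_wpM2l; first exact: powR_ge0.
  by rewrite ler_pdivrMr ?exprn_gt0 // mul1r expr2 (le_trans n8) // ler_peMl // ltW.
Unshelve. all: by end_near. Qed.
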